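(* Assume that the log-Minkowski inequality holds in $\mathbb{R}^{n+1}$, i.e. that for all centrally symmetric convex bodies $C,D\subset\mathbb{R}^{n+1}$ with unit volume, $\int\log\left(\frac{h_D}{h_C}\right)d\nu_C\ge0$. Then $c_{n+1}^S$ is the best (that is, the greatest) constant $c>0$ such that the inequality $$H(\eta_{C_1}|\sigma)+H(\eta_{C_2}|\sigma)+(n+1)\mathcal{T}_\alpha(\nu_{C_1},\nu_{C_2})\le\log\left(\frac{|B_2^{n+1}|^2}{c}\right)+\frac{n+1}{2}\int\log\left(1+\frac{|\nabla_{\mathbb{S}^n}V_1|^2}{(n+1)^2}\right)e^{-V_1}\,d\sigma+\frac{n+1}{2}\int\log\left(1+\frac{|\nabla_{\mathbb{S}^n}V_2|^2}{(n+1)^2}\right)e^{-V_2}\,d\sigma$$ holds for all centrally symmetric convex bodies $C_1,C_2\subset\mathbb{R}^{n+1}$ with unit volume, where, for $i=1,2$, $d\eta_{C_i}=|B_2^{n+1}|\rho_{C_i}^{n+1}\,d\sigma=:e^{-V_i}\,d\sigma$ and $\nu_{C_i}$ is the cone measure of $C_i$.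
   Context: $\mathbb{S}^n\subset\mathbb{R}^{n+1}$ is the Euclidean unit sphere, $\sigma$ its uniform probability measure, $\nabla_{\mathbb{S}^n}$ the spherical gradient (defined $\sigma$-a.e. for the $V_i$), $B_2^{n+1}$ the Euclidean unit ball. $C^\circ=\{y:\langle x,y\rangle\le1\ \forall x\in C\}$ and $c_{k}^S=\inf|C||C^\circ|$ over all centrally symmetric convex bodies $C\subset\mathbb{R}^{k}$. $h_C(y)=\sup_{x\in C}x\cdot y$ is the support function and $\rho_C(x)=\sup\{r\ge0:rx\in C\}$ the radial function of $C$; $N_C:\partial C\to\mathbb{S}^n$ is the Gauss map (defined almost everywhere). The cone measure $\nu_C$ of a centrally symmetric convex body $C$ of volume $1$ is the pushforward of the uniform probability measure on $C$ under $x\mapsto N_C(\rho_C(x)x)$. The cost $\alpha:\mathbb{S}^n\times\mathbb{S}^n\to[0,\infty]$ is $\alpha(u,v)=\log\frac{1}{u\cdot v}$ if $u\cdot v>0$ and $+\infty$ otherwise, and $\mathcal{T}_\alpha(\nu_1,\nu_2)=\inf_\pi\int\alpha\,d\pi$ over all couplings $\pi$ of $\nu_1,\nu_2$. The relative entropy is $H(\eta|\sigma)=\int\log\frac{d\eta}{d\sigma}\,d\eta$ if $\eta\ll\sigma$ and $+\infty$ otherwise. *)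

(* Defs.v *)
From HB Require Import structures.
From mathcomp Require Import all_boot all_order all_algebra.
From mathcomp Require Import all_classical all_reals all_analysis.
From mathcomp Require Import measurable_realfun.

Set Implicit Arguments.
Unset Strict Implicit.
Unset Printing Implicit Defensive.

Import Order.TTheory GRing.Theory Num.Theory.
Import numFieldTopology.Exports numFieldNormedType.Exports.

Local Open Scope classical_set_scope.
Local Open Scope ring_scope.

(* Borel sets of R^n. The topology of 'rV[R]_n comes from the sup norm and is
   thus the Euclidean one; the Euclidean norm is [enorm] below. *)
HB.instance Definition _ (R : realType) (n : nat) :=
  @isMeasurable.Build (sigma_display (@open 'rV[R]_n)) 'rV[R]_n
    <<s @open 'rV[R]_n >> (@sigma_algebra0 _ setT _) (@sigma_algebraC _ _)
    (@sigma_algebra_bigcup _ setT _).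

Section borel_rV.
Variables (R : realType) (n : nat).

Lemma open_measurable_rV (A : set 'rV[R]_n) : open A -> measurable A.
Proof. exact: sub_sigma_algebra. Qed.

Lemma closed_measurable_rV (A : set 'rV[R]_n) : closed A -> measurable A.
Proof.
by move=> cA; rewrite -[A]setCK; apply: measurableC;
  apply: open_measurable_rV; exact: closed_openC.
Qed.

Let box (p : 'rV[rat]_n * nat) : set 'rV[R]_n :=
  [set v | forall i, `|v 0 i - ratr (p.1 0 i)| <= p.2.+1%:R^-1].

Let closed_box p : closed (box p).
Proof.
rewrite (_ : box p = \bigcap_(i in [set: 'I_n])
  [set v : 'rV[R]_n | `|v 0 i - ratr (p.1 0 i)| <= p.2.+1%:R^-1]).
  apply: closed_bigI => i _.
  rewrite -[X in closed X]/((fun v : 'rV[R]_n => `|v 0 i - ratr (p.1 0 i)|) @^-1`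
    [set x | x <= p.2.+1%:R^-1]).
  apply: preimage_closed; last exact: closed_le.
  move=> v _; apply: (@cvg_norm _ R _ (nbhs v)).
  apply: (@cvgB _ R _ (nbhs v)); last exact: cvg_cst.
  exact: coord_continuous.
apply/seteqP; split=> v bv i; first by move=> _; exact: bv.
exact: bv.
Qed.

Let box_basis (O : set 'rV[R]_n) x : open O -> O x ->
  exists2 p, box p x & box p `<=` O.
Proof.
rewrite openE => /[apply]; rewrite /interior => /nbhs_ballP[e /= e0 eO].
have [k ke] : exists k : nat, 2 * k.+1%:R^-1 < e.
  have /ltr_add_invr[k] : 0 < e / 2 by rewrite divr_gt0.
  rewrite add0r => ke; exists k.
  by move: ke; rewrite ltr_pdivlMr// mulrC.
have ki : 0 < k.+1%:R^-1 :> R by rewrite invr_gt0.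
have qP i : exists q : rat, `|x 0 i - ratr q| < k.+1%:R^-1.
  have [|q] := @rat_in_itvoo R (x 0 i - k.+1%:R^-1) (x 0 i + k.+1%:R^-1).
    by rewrite ltrD2l (lt_trans _ ki)// oppr_lt0.
  rewrite in_itv/= => /andP[q1 q2]; exists q.
  by rewrite distrC ltr_distl q1 q2.
exists (\row_i sval (cid (qP i)), k) => [i /=|y yb].
  by rewrite mxE; case: cid => q /= /ltW.
apply: eO; split => // i j; rewrite ord1.
have := yb j; rewrite /= mxE; case: cid => q /= xq yq.
rewrite /ball/= (le_lt_trans _ ke)//.
rewrite (_ : x 0 j - y 0 j = (x 0 j - ratr q) - (y 0 j - ratr q)).
  by rewrite (le_trans (ler_normB _ _))// mulr_natl mulr2n lerD// ltW.
by rewrite opprB addrA subrK.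
Qed.

Let box_cover (O : set 'rV[R]_n) : open O ->
  O = \bigcup_(p in [set p | box p `<=` O]) box p.
Proof.
move=> oO; apply/seteqP; split=> [x Ox|x [p pO]]; last exact: pO.
by have [p px pO] := box_basis oO Ox; exists p.
Qed.

Lemma rV_closed_countable_basis :
  exists F : nat -> set 'rV[R]_n, (forall k, closed (F k)) /\
    forall (U : set 'rV[R]_n) x, open U -> U x -> exists2 k, F k x & F k `<=` U.
Proof.
exists (fun k => if unpickle k is Some p then box p else set0); split=> [k|U x].
  by case: unpickle => [p|]; [exact: closed_box|exact: closed0].
move=> oU Ux; have [p px pU] := box_basis oU Ux.
by exists (pickle p); rewrite pickleK.
Qed.

Lemma measurable_fun_rV d (T : measurableType d) (f : T -> 'rV[R]_n) :
  (forall i, measurable_fun [set: T] (fun x => f x 0 i)) ->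
  measurable_fun [set: T] f.
Proof.
move=> mf; apply: (@measurability _ _ _ _ _ _ (@open 'rV[R]_n)) => //.
move=> _ [U oU <-]; rewrite setTI (box_cover oU) preimage_bigcup.
rewrite bigcup_mkcond.
apply: countable_bigcupT_measurable; first exact: countableP.
move=> p; case: ifPn => // _; rewrite (_ : _ @^-1` _ = \bigcap_(i in [set: 'I_n])
  [set x | `|f x 0 i - ratr (p.1 0 i)| <= p.2.+1%:R^-1]).
  apply: fin_bigcap_measurable => // i _.
  rewrite -[X in measurable X]setTI.
  apply: measurable_fun_le => //.
  by apply: measurableT_comp => //; exact: measurable_funB.
by apply/seteqP; split=> x bx i => [_|]; exact: bx.
Qed.

End borel_rV.

Section lebesgue_measure_rV.
Variable R : realType.

Definition cons_rV n (p : R * 'rV[R]_n) : 'rV[R]_n.+1 :=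
  \row_i oapp (fun j => p.2 0 j) p.1 (unlift ord0 i).

Lemma measurable_coord n (i : 'I_n) :
  measurable_fun [set: 'rV[R]_n] (fun v => v 0 i).
Proof.
apply: (measurability _ (RGenOInfty.measurableE R)) => _ [_ [a ->] <-].
rewrite setTI; apply: open_measurable_rV; apply: open_comp.
  by move=> v _; exact: coord_continuous.
exact: interval_open.
Qed.

Lemma measurable_cons_rV n :
  measurable_fun [set: R * 'rV[R]_n] (@cons_rV n).
Proof.
apply: measurable_fun_rV => i; rewrite /cons_rV.
under eq_fun do rewrite mxE.
case: (unlift ord0 i) => [j|] /=; last exact: measurable_fst.
exact: (measurableT_comp (measurable_coord j) measurable_snd).
Qed.

HB.instance Definition _ n := isMeasurableFun.Build _ _ _ _
  (@cons_rV n) (@measurable_cons_rV n).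

Section step.
Variables (n : nat) (mu : {sigma_finite_measure set 'rV[R]_n -> \bar R}).

Definition lebesgue_measure_rV_step : set 'rV[R]_n.+1 -> \bar R :=
  pushforward (@lebesgue_measure R \x mu)%E (@cons_rV n).

Local Notation step := lebesgue_measure_rV_step.

Let step0 : step set0 = 0%E.
Proof. by rewrite /step /pushforward preimage_set0 measure0. Qed.

Let step_ge0 A : (0 <= step A)%E.
Proof. by rewrite /step /pushforward; exact: measure_ge0. Qed.

Let step_sigma_additive : semi_sigma_additive step.
Proof.
rewrite /step; apply: measure_semi_sigma_additive.
exact: measurable_cons_rV.
Qed.

HB.instance Definition _ := isMeasure.Build _ _ _ step
  step0 step_ge0 step_sigma_additive.

Let step_sigma_finite : sigma_finite setT step.
Proof.
have /sigma_finiteP[F [TF ndF Foo]] := sigma_finiteT (@lebesgue_measure R).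
have /sigma_finiteP[G [TG ndG Goo]] := sigma_finiteT mu.
pose uncons (v : 'rV[R]_n.+1) : R * 'rV[R]_n :=
  (v 0 ord0, \row_j v 0 (lift ord0 j)).
have muncons : measurable_fun setT uncons.
  apply/measurable_fun_pairP; split; first exact: measurable_coord.
  apply: measurable_fun_rV => i /=.
  under eq_fun do rewrite mxE.
  exact: measurable_coord.
have consK : cancel (@cons_rV n) uncons.
  move=> [a v]; rewrite /uncons /cons_rV !mxE unlift_none/=; congr pair.
  by apply/rowP => j; rewrite !mxE liftK.
exists (fun k => uncons @^-1` (F k `*` G k)).
  rewrite -preimage_bigcup; apply/esym/seteqP; split => // v _.
  have [i _ Fi] : (\bigcup_k F k) (v 0 ord0) by rewrite -TF.
  have [j _ Gj] : (\bigcup_k G k) (\row_j v 0 (lift ord0 j)) by rewrite -TG.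
  exists (maxn i j) => //; split.
    by move: Fi; exact/subsetPset/ndF/leq_maxl.
  by move: Gj; exact/subsetPset/ndG/leq_maxr.
move=> k; have [mF Fk] := Foo k; have [mG Gk] := Goo k; split.
  by rewrite -[X in measurable X]setTI; apply: muncons => //; exact: measurableX.
rewrite /step /pushforward -comp_preimage (_ : uncons \o _ = id).
  by rewrite /= product_measure1E// lte_mul_pinfty// ge0_fin_numE.
by apply/funext => x; exact: consK.
Qed.

HB.instance Definition _ := Measure_isSigmaFinite.Build _ _ _ step
  step_sigma_finite.

End step.

(* Identifies R^(n+1) with R * R^n and iterates the binary product measure. *)
Fixpoint lebesgue_measure_rV n : {sigma_finite_measure set 'rV[R]_n -> \bar R} :=
  match n with
  | 0 => @dirac _ 'rV[R]_0 0 R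
  | m.+1 => lebesgue_measure_rV_step (lebesgue_measure_rV m)
  end.

End lebesgue_measure_rV.

Section euclidean.
Variables (R : realType) (n : nat).
Implicit Types u v x y : 'rV[R]_n.

Definition dot u v : R := \sum_(i < n) u 0 i * v 0 i.

Definition enorm u : R := Num.sqrt (dot u u).

Definition unit_ball : set 'rV[R]_n := [set x | enorm x <= 1].

Definition unit_sphere : set 'rV[R]_n := [set x | enorm x = 1].

Definition vol : {sigma_finite_measure set 'rV[R]_n -> \bar R} :=
  lebesgue_measure_rV R n.

Definition radial_proj x : 'rV[R]_n := (enorm x)^-1 *: x.

Lemma dotZ a b u v : dot (a *: u) (b *: v) = a * b * dot u v.
Proof.
by rewrite /dot mulr_sumr; apply: eq_bigr => i _; rewrite !mxE mulrACA.
Qed.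

Lemma dot_ge0 u : 0 <= dot u u.
Proof. by apply: sumr_ge0 => i _; rewrite -expr2 sqr_ge0. Qed.

Lemma enorm_ge0 u : 0 <= enorm u.
Proof. exact: sqrtr_ge0. Qed.

Lemma enormZ a u : enorm (a *: u) = `|a| * enorm u.
Proof. by rewrite /enorm dotZ -expr2 sqrtrM ?sqr_ge0// sqrtr_sqr. Qed.

Lemma enorm0 : enorm 0 = 0.
Proof. by rewrite -(scale0r 0) enormZ normr0 mul0r. Qed.

Lemma enorm_gt0 u : u != 0 -> 0 < enorm u.
Proof.
move=> u0; rewrite lt_neqAle enorm_ge0 andbT eq_sym sqrtr_eq0 -ltNge.
rewrite lt_neqAle dot_ge0 andbT eq_sym; apply: contra u0.
rewrite psumr_eq0 => [/allP u0|i _]; last by rewrite -expr2 sqr_ge0.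
apply/eqP/rowP => i; rewrite mxE; apply/eqP.
by have := u0 i (mem_index_enum _); rewrite mulf_eq0 orbb.
Qed.

Lemma coord_le_enorm u i : `|u 0 i| <= enorm u.
Proof.
rewrite -sqrtr_sqr ler_sqrt ?dot_ge0// /dot (bigD1 i)//= expr2 lerDl.
by apply: sumr_ge0 => j _; rewrite -expr2 sqr_ge0.
Qed.

Lemma cvg_dot (T : Type) (F : set_system T) (FF : Filter F)
    (f g : T -> 'rV[R]_n) u v : f @ F --> u -> g @ F --> v ->
  (fun t => dot (f t) (g t)) @ F --> dot u v.
Proof.
move=> fu gv; apply: cvg_big => [|i _]; first exact: add_continuous.
apply: (@cvgM _ _ F).
  exact: (cvg_comp _ _ fu (@coord_continuous _ _ _ 0 i u)).
exact: (cvg_comp _ _ gv (@coord_continuous _ _ _ 0 i v)).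
Qed.

Lemma enorm_continuous : continuous enorm.
Proof.
move=> x; have dx : dot y y @[y --> x] --> dot x x.
  by apply: (@cvg_dot _ (nbhs x) _ id id); exact: cvg_id.
exact: (cvg_comp _ _ dx (@sqrt_continuous _ _)).
Qed.

Lemma closed_unit_ball : closed unit_ball.
Proof.
apply: (@preimage_closed _ _ enorm [set x | x <= 1]); last exact: closed_le.
by move=> x _; exact: enorm_continuous.
Qed.

Lemma closed_unit_sphere : closed unit_sphere.
Proof.
apply: (@preimage_closed _ _ enorm [set 1]); last exact: closed_eq.
by move=> x _; exact: enorm_continuous.
Qed.

Lemma compact_unit_sphere : compact unit_sphere.
Proof.
apply: (subclosed_compact closed_unit_sphere
  (@rV_compact R n (fun=> `[(- 1), 1]%classic) _)).
  by move=> _; exact: segment_compact.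
by move=> x x1 i /=; rewrite in_itv/= -ler_norml -x1 coord_le_enorm.
Qed.

Lemma measurable_unit_ball : measurable unit_ball.
Proof. exact: closed_measurable_rV closed_unit_ball. Qed.

Lemma measurable_unit_sphere : measurable unit_sphere.
Proof. exact: closed_measurable_rV closed_unit_sphere. Qed.

Lemma continuous_measurable_rV (f : 'rV[R]_n -> R) :
  continuous f -> measurable_fun [set: 'rV[R]_n] f.
Proof.
move=> cf; apply: (measurability _ (RGenOInfty.measurableE R)).
move=> _ [_ [a ->] <-].
rewrite setTI; apply: open_measurable_rV; apply: open_comp.
  by move=> v _; exact: cf.
exact: interval_open.
Qed.

Lemma measurable_enorm : measurable_fun [set: 'rV[R]_n] enorm.
Proof. exact: continuous_measurable_rV enorm_continuous. Qed.

Lemma measurable_scale_rV d (T : measurableType d) (a : T -> R)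
    (f : T -> 'rV[R]_n) :
  measurable_fun [set: T] a -> measurable_fun [set: T] f ->
  measurable_fun [set: T] (fun t => a t *: f t).
Proof.
move=> ma mf; apply: measurable_fun_rV => i.
under eq_fun do rewrite mxE.
apply: measurable_funM => //.
exact: (measurableT_comp (@measurable_coord R n i) mf).
Qed.

Lemma measurable_inv_enorm :
  measurable_fun [set: 'rV[R]_n] (fun x => (enorm x)^-1).
Proof.
under eq_fun do rewrite -powR_inv1 ?enorm_ge0//.
exact: (measurableT_comp (@measurable_powR R (-1)) measurable_enorm).
Qed.

Lemma measurable_radial_proj : measurable_fun [set: 'rV[R]_n] radial_proj.
Proof. by apply: measurable_scale_rV; [exact: measurable_inv_enorm|exact: measurable_id]. Qed.

HB.instance Definition _ := isMeasurableFun.Build _ _ _ _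
  radial_proj measurable_radial_proj.

(* [mnormalize] returns its last argument, here a Dirac mass, when the measure
   to normalize is null or infinite; this never happens for a convex body. *)
Definition uniform_on (D : set 'rV[R]_n) (mD : measurable D) :
  probability 'rV[R]_n R := mnormalize (mrestr vol mD) \d_(0 : 'rV[R]_n).

(* The rotation-invariant probability on the sphere, as the image of the uniform
   probability on the ball under x |-> x / |x|. Here and below, measures on the
   sphere are Borel measures on the ambient space carried by [unit_sphere]. *)
Definition sphere_measure : probability 'rV[R]_n R :=
  distribution (uniform_on measurable_unit_ball) radial_proj.

End euclidean.
Arguments unit_ball {R n}.
Arguments unit_sphere {R n}.
Arguments vol {R n}.
Arguments sphere_measure {R n}.

Definition ball_volume (R : realType) (n : nat) : R :=
  fine (@vol R n unit_ball).

Record sym_convex_body (R : realType) (n : nat) := SymConvexBody {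
  body_set :> set 'rV[R]_n ;
  body_compact : compact body_set ;
  body_convex : convex_set body_set ;
  body_sym : forall x, body_set x -> body_set (- x) ;
  body_interior : interior body_set !=set0 }.

Section convex_geometry.
Variables (R : realType) (n : nat).
Implicit Types (C : set 'rV[R]_n) (u x y : 'rV[R]_n).

Definition polar C : set 'rV[R]_n := [set y | forall x, C x -> dot x y <= 1].

Definition support_fun C y : R := sup [set dot x y | x in C].

(* When C is a neighbourhood of 0, radial_fun C 0 = 0 by the convention that
   [sup] is 0 on unbounded sets; only x != 0 matters. *)
Definition radial_fun C x : R := sup [set r | 0 <= r /\ C (r *: x)].

Definition unit_normals C x : set 'rV[R]_n :=
  [set u | unit_sphere u /\ forall y, C y -> dot y u <= dot x u].

(* The outer unit normal at x where it is unique, and 0 elsewhere: on the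
   boundary of a convex body, the latter is a null set. *)
Definition gauss_map C x : 'rV[R]_n :=
  xget 0 [set u | unit_normals C x = [set u]].

Definition radial_gauss_map C x : 'rV[R]_n :=
  gauss_map C (radial_fun C x *: x).

End convex_geometry.

Section body_measurability.
Variables (R : realType) (n : nat) (K : sym_convex_body R n).
Local Notation C := (body_set K).
Implicit Types (u x y : 'rV[R]_n).

Lemma body_closed : closed C.
Proof.
by apply: compact_closed; [exact: norm_hausdorff|exact: body_compact].
Qed.

Lemma measurable_body : measurable C.
Proof. exact: closed_measurable_rV body_closed. Qed.

Lemma body_conv (t : R) x y : 0 <= t -> t <= 1 -> C x -> C y ->
  C (t *: x + (1 - t) *: y).
Proof.
move=> t0 t1 Cx Cy.
exact: (set_mem (@body_convex _ _ K x y (Itv01 t0 t1) (mem_set Cx) (mem_set Cy))).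
Qed.

Lemma body0 : C 0.
Proof.
have [x /interior_subset Cx] := body_interior K.
have h0 : 0 <= 2^-1 :> R by rewrite invr_ge0.
have h1 : 2^-1 <= 1 :> R by rewrite invf_le1// ler1n.
have := body_conv h0 h1 Cx (body_sym Cx).
rewrite scalerN -scalerBl opprB addrA (_ : 2^-1 + 2^-1 = 1).
  by rewrite subrr scale0r.
by rewrite [RHS]splitr mul1r.
Qed.

Lemma bodyZ (r : R) x : 0 <= r -> r <= 1 -> C x -> C (r *: x).
Proof.
by move=> r0 r1 Cx; have := body_conv r0 r1 Cx body0; rewrite scaler0 addr0.
Qed.

Lemma body_bounded : exists2 M : R, 0 < M & forall x, C x -> enorm x <= M.
Proof.
have : compact (@enorm R n @` C).
  apply: continuous_compact; last exact: body_compact.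
  by apply: continuous_subspaceT; exact: enorm_continuous.
move=> /compact_bounded [M [_ MC]].
exists (`|M| + 1); first by rewrite ltr_wpDl.
move=> x Cx; rewrite (le_trans (ler_norm _))//.
by apply: (MC (`|M| + 1)); [rewrite (le_lt_trans (ler_norm _))// ltrDl|exists x].
Qed.

Let ray x : set R := [set r | 0 <= r /\ C (r *: x)].

Let ray0 x : ray x 0.
Proof. by split => //; rewrite scale0r; exact: body0. Qed.

Let ray_ub M x : (forall y, C y -> enorm y <= M) -> x != 0 ->
  ubound (ray x) (M / enorm x).
Proof.
move=> CM x0 r [r0 Cr]; rewrite ler_pdivlMr ?enorm_gt0//.
by have := CM _ Cr; rewrite enormZ ger0_norm.
Qed.

Let ray_bounded x : x != 0 -> has_ubound (ray x).
Proof.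
by move=> x0; have [M _ CM] := body_bounded; exists (M / enorm x); exact: ray_ub.
Qed.

Let ray_closed x : closed (ray x).
Proof.
rewrite (_ : ray x = [set r | 0 <= r] `&` ((fun r : R => r *: x) @^-1` C)) //.
apply: closedI; first exact: closed_ge.
apply: (@preimage_closed _ _ (fun r : R => r *: x)); last exact: body_closed.
by move=> r _; apply: cvgZr_tmp; exact: cvg_id.
Qed.

Lemma radial_fun_ge0 x : 0 <= radial_fun C x.
Proof.
have [x0|/ray_bounded bx] := eqVneq x 0; last exact: (ub_le_sup bx (ray0 x)).
rewrite /radial_fun sup_out// => -[_ [M]].
rewrite x0 => /(_ (`|M| + 1)).
rewrite /= scaler0 => H.
have : `|M| + 1 <= M by apply: H; split; [rewrite addr_ge0|exact: body0].
by rewrite leNgt (le_lt_trans (ler_norm _))// ltrDl.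
Qed.

Lemma radial_fun0 : radial_fun C 0 = 0.
Proof.
rewrite /radial_fun sup_out// => -[_ [M]] => /(_ (`|M| + 1)).
rewrite /= scaler0 => H.
have : `|M| + 1 <= M by apply: H; split; [rewrite addr_ge0|exact: body0].
by rewrite leNgt (le_lt_trans (ler_norm _))// ltrDl.
Qed.

Lemma radial_funP a x : 0 < a -> x != 0 ->
  (a <= radial_fun C x) <-> C (a *: x).
Proof.
move=> a0 x0; have bx := ray_bounded x0; split => [ar|Ca]; last first.
  by apply: (ub_le_sup bx); split => //; exact: ltW.
have r0 : 0 < radial_fun C x by exact: lt_le_trans ar.
have [_ Cr] : ray x (radial_fun C x).
  have /closure_id -> := @ray_closed x.
  by apply: closure_sup => //; exists 0; exact: ray0.
have -> : a *: x = (a / radial_fun C x) *: (radial_fun C x *: x).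
  by rewrite scalerA divfK// gt_eqF.
by apply: bodyZ => //; [rewrite divr_ge0// ltW|rewrite ler_pdivrMr// mul1r].
Qed.

Lemma radial_fun_le : exists2 M : R, 0 <= M &
  forall x, unit_sphere x -> radial_fun C x <= M.
Proof.
have [M M0 CM] := body_bounded; exists M; first exact: ltW.
move=> x x1; have x0 : x != 0.
  apply/eqP => x0; move: x1; rewrite /unit_sphere/= x0 enorm0 => /eqP.
  by rewrite eq_sym oner_eq0.
apply: ge_sup; first by exists 0; exact: ray0.
by have := ray_ub CM x0; rewrite x1 divr1.
Qed.

Lemma measurable_radial_fun :
  measurable_fun [set: 'rV[R]_n] (radial_fun C).
Proof.
apply: (measurability _ (RGenCInfty.measurableE R)) => _ [_ [a ->] <-].
rewrite setTI preimage_itvcy.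
have [a0|a0] := leP a 0.
  rewrite (_ : [set _ | _] = setT)//; apply/seteqP; split => // x _ /=.
  exact: le_trans a0 (radial_fun_ge0 x).
rewrite (_ : [set _ | _] = ~` [set 0] `&` ((fun x => a *: x) @^-1` C)).
  apply: measurableI.
    apply: measurableC; apply: closed_measurable_rV.
    by apply: compact_closed; [exact: norm_hausdorff|exact: compact_set1].
  apply: closed_measurable_rV.
  apply: (@preimage_closed _ _ (fun x => a *: x)); last exact: body_closed.
  by move=> r _; exact: scaler_continuous.
apply/seteqP; split => x /=.
  have [->|x0] := eqVneq x 0; first by rewrite radial_fun0 leNgt a0.
  by move=> /(radial_funP a0 x0) Cx; split => //; exact/eqP.
by move=> [/eqP x0 Cx]; apply/(radial_funP a0 x0).
Qed.

End body_measurability.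

Section gauss_map_measurability.
Variables (R : realType) (n : nat) (K : sym_convex_body R n).
Local Notation C := (body_set K).
Implicit Types (u x y : 'rV[R]_n) (F : set 'rV[R]_n).

Let meets F : set 'rV[R]_n := [set x | exists2 u, F u & unit_normals C x u].

Let closed_meets F : closed F -> closed (meets F).
Proof.
move=> cF; rewrite -[meets F]setCK; apply: open_closedC.
rewrite openE => x xF; rewrite /interior.
have cS : compact (unit_sphere `&` F).
  by apply: compact_closedI => //; exact: compact_unit_sphere.
have : \forall x' \near x,
    unit_sphere `&` F `<=` [set u | ~ unit_normals C x' u].
  move/compact_near_coveringP : cS => /(_ _ (nbhs x)
    (fun x' u => ~ unit_normals C x' u)); apply => u [u1 Fu].
  have [y Cy yu] : exists2 y, C y & dot x u < dot y u.
    apply: contrapT => H; apply: xF; exists u => //; split => // y Cy.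
    by rewrite leNgt; apply/negP => xy; apply: H; exists y.
  have : \forall p \near filter_prod (nbhs u) (nbhs x),
      0 < dot y p.1 - dot p.2 p.1.
    have : dot y p.1 - dot p.2 p.1 @[p --> filter_prod (nbhs u) (nbhs x)] -->
        dot y u - dot x u.
      apply: (@cvgB _ R _ (filter_prod (nbhs u) (nbhs x)));
        apply: (@cvg_dot _ _ _ (filter_prod (nbhs u) (nbhs x)));
        [exact: cvg_cst|exact: cvg_fst|exact: cvg_snd|exact: cvg_fst].
    by move=> /cvgr_gt; apply; rewrite subr_gt0.
  apply: filterS => -[u' x'] /=; rewrite subr_gt0 => xy [_ /(_ _ Cy)].
  by rewrite leNgt xy.
apply: filterS => x' H [u Fu xu]; exact: (H u (conj xu.1 Fu)).
Qed.

Let unique_normal : set 'rV[R]_n :=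
  [set x | exists u, unit_normals C x = [set u]].

Let measurable_meets (U : set 'rV[R]_n) : open U -> measurable (meets U).
Proof.
have [F [cF FU]] := @rV_closed_countable_basis R n.
move=> oU; rewrite (_ : meets U = \bigcup_(k in [set k | F k `<=` U]) meets (F k)).
  by apply: bigcup_measurable => k _; apply: closed_measurable_rV; apply: closed_meets; exact: cF.
apply/seteqP; split => [x [u Uu xu]|x [k /= kU [u Fu xu]]].
  by have [k Fk kU] := FU _ _ oU Uu; exists k => //; exists u.
by exists u => //; exact: kU.
Qed.

Let measurable_unique_normal : measurable unique_normal.
Proof.
have [F [cF FU]] := @rV_closed_countable_basis R n.
rewrite (_ : unique_normal = meets setT `\`
  \bigcup_k \bigcup_(l in [set l | F k `&` F l = set0])
    (meets (F k) `&` meets (F l))).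
  apply: measurableD; first by apply: measurable_meets; exact: openT.
  apply: bigcup_measurable => k _; apply: bigcup_measurable => l _.
  by apply: measurableI; apply: closed_measurable_rV; apply: closed_meets; exact: cF.
apply/seteqP; split => x.
  move=> [u xu]; split; first by exists u => //; rewrite xu.
  move=> [k _ [l /= kl [[v kv xv] [w lw xw]]]].
  move: xv xw; rewrite xu => vu wu.
  have : (F k `&` F l) u by split; [rewrite -(vu : v = u)|rewrite -(wu : w = u)].
  by rewrite kl.
move=> [[u _ xu] H]; exists u; apply/seteqP; split => [v xv|_ ->//].
apply: contrapT => vu; apply: H.
have /eqP := vu; have := @norm_hausdorff _ 'rV[R]_n.
rewrite open_hausdorff => /[apply] -[[A B]] /= [vA uB] [oA oB AB].
have [k Fkv kA] := FU _ _ oA (set_mem vA).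
have [l Flu lB] := FU _ _ oB (set_mem uB).
exists k => //; exists l; last by split; [exists v|exists u].
by apply/seteqP; split => // z [kz lz]; rewrite -(eqP AB); split; [exact: kA|exact: lB].
Qed.

Lemma measurable_gauss_map : measurable_fun [set: 'rV[R]_n] (gauss_map C).
Proof.
apply: (@measurability _ _ _ _ _ _ (@open 'rV[R]_n)) => // _ [U oU <-].
rewrite setTI (_ : _ @^-1` _ = (unique_normal `&` meets U) `|`
    (~` unique_normal `&` [set _ | U 0])).
  apply: measurableU; apply: measurableI => //.
  - exact: measurable_meets.
  - exact: measurableC.
  - have [U0|U0] := pselect (U 0).
      by rewrite (_ : [set _ | _] = setT)//; apply/seteqP; split.
    by rewrite (_ : [set _ | _] = set0)//; apply/seteqP; split.
apply/seteqP; split => x /=.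
  have [ux|nux] := pselect (unique_normal x).
    move=> Ux; left; split => //; exists (gauss_map C x) => //.
    by have -> := xgetPex 0 ux.
  by rewrite {1}/gauss_map xgetPN => [U0|u xu]; [right|apply: nux; exists u].
move=> [[ux [u Uu]]|[nux U0]].
  by rewrite (xgetPex 0 ux) => xu; rewrite -(xu : u = gauss_map C x).
by rewrite /gauss_map xgetPN// => u xu; apply: nux; exists u.
Qed.

Lemma measurable_radial_gauss_map :
  measurable_fun [set: 'rV[R]_n] (radial_gauss_map C).
Proof.
apply: (measurableT_comp measurable_gauss_map).
apply: measurable_scale_rV; last exact: measurable_id.
exact: measurable_radial_fun.
Qed.

HB.instance Definition _ := isMeasurableFun.Build _ _ _ _
  (radial_gauss_map C) measurable_radial_gauss_map.

End gauss_map_measurability.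

Section sphere_density.
Variables (R : realType) (n : nat).
Implicit Types (C : set 'rV[R]_n) (u : 'rV[R]_n).

Definition radial_density C u : R :=
  ball_volume R n * radial_fun C u ^+ n.

(* The measure eta_C, with density |B| rho_C ^ n with respect to sigma;
   [potential] is the V such that this density is exp (- V). *)
Definition radial_measure C (A : set 'rV[R]_n) : \bar R :=
  (\int[sphere_measure]_(u in A `&` unit_sphere)
    (radial_density C u)%:E)%E.

Definition potential C u : R := - ln (radial_density C u).

(* At u on the sphere, the spherical gradient is the Euclidean gradient of the
   0-homogeneous extension x |-> f (x / |x|) of f. *)
Definition sphere_grad (f : 'rV[R]_n -> R) u : 'rV[R]_n :=
  \row_(i < n) 'D_(delta_mx 0 i) (f \o @radial_proj R n) u.

End sphere_density.

Section radial_measure_instance.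
Variables (R : realType) (n : nat) (K : sym_convex_body R n).
Local Notation C := (body_set K).
Local Notation eta := (radial_measure C).

Lemma radial_density_ge0 u : 0 <= radial_density C u.
Proof.
by rewrite mulr_ge0//; [exact: fine_ge0|rewrite exprn_ge0// radial_fun_ge0].
Qed.

Lemma measurable_radial_density :
  measurable_fun [set: 'rV[R]_n] (radial_density C).
Proof.
apply: measurable_funM => //; apply: measurable_funX.
exact: measurable_radial_fun.
Qed.

Let measurable_density D :
  measurable_fun D (fun u => (radial_density C u)%:E).
Proof.
apply: measurable_funTS; apply/measurable_EFinP.
exact: measurable_radial_density.
Qed.

Let eta0 : eta set0 = 0%E.
Proof. by rewrite /radial_measure set0I integral_set0. Qed.

Let eta_ge0 A : (0 <= eta A)%E.
Proof. by apply: integral_ge0 => u _; rewrite lee_fin radial_density_ge0. Qed.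

Let eta_sigma_additive : semi_sigma_additive eta.
Proof.
move=> /= A mA tA mUA; rewrite /radial_measure setI_bigcupl.
rewrite ge0_integral_bigcup//=.
- apply: is_cvg_ereal_nneg_natsum_cond => k _ _; exact: eta_ge0.
- by move=> k; apply: measurableI => //; exact: measurable_unit_sphere.
- by move=> u _; rewrite lee_fin radial_density_ge0.
- exact: trivIset_setIr.
Qed.

HB.instance Definition _ := isMeasure.Build _ _ _ eta
  eta0 eta_ge0 eta_sigma_additive.

Let eta_fin_num : fin_num_fun eta.
Proof.
move=> A mA; have [M M0 rM] := radial_fun_le K.
have mS := @measurable_unit_sphere R n.
pose c := ball_volume R n * M ^+ n.
rewrite ge0_fin_numE; last exact: eta_ge0.
apply: (@le_lt_trans _ _ (\int[sphere_measure]_(u in A `&` unit_sphere)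
    (cst c%:E u))%E).
  apply: ge0_le_integral => //.
  - exact: measurableI.
  - by move=> u _; rewrite lee_fin radial_density_ge0.
  - move=> u [_ u1]; rewrite lee_fin ler_wpM2l ?fine_ge0//.
    by rewrite lerXn2r ?nnegrE ?radial_fun_ge0// rM.
rewrite integral_cst; last exact: measurableI.
by rewrite lte_mul_pinfty ?lee_fin ?mulr_ge0 ?fine_ge0 ?exprn_ge0//
  (le_lt_trans (probability_le1 _ _)) ?ltry//; exact: measurableI.
Qed.

HB.instance Definition _ := Measure_isFinite.Build _ _ _ eta eta_fin_num.

End radial_measure_instance.

Definition relative_entropy d (T : measurableType d) (R : realType)
    (eta : {finite_measure set T -> \bar R})
    (sigma : {sigma_finite_measure set T -> \bar R}) : \bar R :=
  if `[< eta `<< sigma >] then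
    (\int[eta]_x lne (Radon_Nikodym (charge_of_finite_measure eta) sigma x))%E
  else +oo%E.

Section transport.
Variables (R : realType) (n : nat).

Definition alpha (u v : 'rV[R]_n) : \bar R :=
  if 0 < dot u v then (ln (1 / dot u v))%:E else +oo%E.

Definition coupling (nu1 nu2 : probability 'rV[R]_n R) :
    set (probability ('rV[R]_n * 'rV[R]_n)%type R) :=
  [set pi | forall A : set 'rV[R]_n, measurable A ->
    pi (A `*` setT) = nu1 A /\ pi (setT `*` A) = nu2 A].

Definition transport_cost (nu1 nu2 : probability 'rV[R]_n R) : \bar R :=
  ereal_inf [set (\int[pi]_(p in unit_sphere `*` unit_sphere)
    alpha p.1 p.2)%E | pi in coupling nu1 nu2].

End transport.

Definition cone_measure (R : realType) (n : nat) (K : sym_convex_body R n) :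
    probability 'rV[R]_n R :=
  distribution (uniform_on (measurable_body K))
    (radial_gauss_map (body_set K)).

(* Both volumes are finite, so that [fine] loses nothing. *)
Definition min_volume_product (R : realType) (n : nat) : R :=
  inf [set fine (vol K) * fine (vol (polar K)) |
    K in [set: sym_convex_body R n]].

Definition log_minkowski (R : realType) (n : nat) : Prop :=
  forall C D : sym_convex_body R n, vol C = 1%E -> vol D = 1%E ->
  (0 <= \int[cone_measure C]_(u in unit_sphere)
    (ln (support_fun D u / support_fun C u))%:E)%E.

(* Main.v *)
(* Write N = n + 1. The gauge g = 1 / rho_C is differentiable off a null set; there its
   gradient p is an outer normal with h_C (p / |p|) = 1 / |p|, and on the sphere
   1 + |grad V|^2 / N^2 = |p|^2 / g^2. As eta_C is the image of the uniform measure of C under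
   x |-> x / |x|, the terms in log rho_C cancel, and the inequality for (C1, C2) becomes
     int log h_C1 dnu_C1 + int log h_C2 dnu_C2 + T (nu_C1, nu_C2) <= - (log c) / N.

   For c = c^S, Kantorovich duality bounds T by the supremum of int phi dnu_C1 + int psi dnu_C2
   over phi + psi <= alpha. The measures nu_C being even, phi and psi may be made even; if L
   is the Wulff shape of exp (- phi), the constraint says that h_{L^o} <= exp (- psi), and the
   log-Minkowski inequality for (C1, L) and (C2, L^o), rescaled to unit volume, bounds the dual
   value by - int log h_C1 dnu_C1 - int log h_C2 dnu_C2 - (log (|L| |L^o|)) / N. Only finite
   duality is needed: it yields discrete plans on finer and finer partitions of the sphere,
   for costs below alpha, and a weak limit of these plans is a coupling.

   Conversely, for C1 and C2 the normalised K and K^o, the bound u.v <= h_K (u) h_{K^o} (v)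
   gives a lower bound of T which forces c <= |K| |K^o|. Finally c^S > 0, by induction on the
   dimension: slicing compares |K| |K^o| with the same product for a hyperplane section of K. *)

From HB Require Import structures.
Require Import Defs.
From mathcomp Require Import all_boot all_order all_algebra.
From mathcomp Require Import all_classical all_reals all_analysis.
From mathcomp Require Import measurable_realfun ring lra.

Set Implicit Arguments.
Unset Strict Implicit.
Unset Printing Implicit Defensive.

Import Order.TTheory GRing.Theory Num.Theory.
Import numFieldTopology.Exports numFieldNormedType.Exports.

Local Open Scope classical_set_scope.
Local Open Scope ring_scope.

(** * Lebesgue volume of row vectors *)

Section vol.
Variable R : realType.
Implicit Type n : nat.

(** The bound drawn from the log-Minkowski inequality is the same for all admissible potentials. The
    cost of a pair of cells is chosen below [alpha] on the whole pair, so discrete potentials give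
    admissible step functions and every discrete problem obeys [transport_bound] with no error term
    to control. Rescaling L and its polar to unit volume costs ln |L| and ln |L^o|, divided by the
    dimension, so that only the scale-invariant product enters. Its infimum must be positive, both
    for c^S to be a legitimate constant and for its logarithm to be monotonically compared with that
    of |L| |L^o|. Differentiability is needed along the coordinate axes only: [sphere_grad] is built
    from partial derivatives, and where a convex function has all of them they form its unique
    subgradient, hence give the unique normal. An axis fails at a point only if two rationals
    separate the left and right slopes, which leaves countably many closed null sets. The integrands
    of the theorem are controlled only off null sets, so integrals are compared with measurability
    on one side at most. *)

Lemma cons_rV0 n (p : R * 'rV[R]_n) : cons_rV p 0 ord0 = p.1.
Proof. by rewrite mxE unlift_none. Qed.

Lemma cons_rVS n (p : R * 'rV[R]_n) i : cons_rV p 0 (lift ord0 i) = p.2 0 i.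
Proof. by rewrite mxE liftK. Qed.

Lemma cons_rVP n (v w : 'rV[R]_n.+1) : v 0 ord0 = w 0 ord0 ->
  (forall i, v 0 (lift ord0 i) = w 0 (lift ord0 i)) -> v = w.
Proof.
move=> h0 hS; apply/rowP => i.
by case: (unliftP ord0 i) => [j ->|->].
Qed.

Lemma vol_section1 n (A : set 'rV[R]_n.+1) : measurable A ->
  vol A = (\int[lebesgue_measure]_t vol [set y | A (cons_rV (t, y))])%E.
Proof.
move=> mA; rewrite /vol/= /lebesgue_measure_rV_step /pushforward.
rewrite /product_measure1/=; apply: eq_integral => t _ /=; congr (_ _).
by rewrite /xsection; apply/seteqP; split => y /=; rewrite inE.
Qed.

Lemma vol_section2 n (A : set 'rV[R]_n.+1) : measurable A ->
  vol A = (\int[vol]_y (@lebesgue_measure R) [set t | A (cons_rV (t, y))])%E.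
Proof.
move=> mA; rewrite {1}/vol/= /lebesgue_measure_rV_step /pushforward.
have := @product_measure_unique _ _ _ _ R (@lebesgue_measure R) (@vol R n)
   (@lebesgue_measure R \x^ @vol R n)%E.
move=> ->; last 2 first.
- by move=> A1 A2 mA1 mA2; rewrite -product_measure2E.
- by rewrite -[X in measurable X]setTI; exact: measurable_cons_rV.
rewrite /product_measure2/=; apply: eq_integral => t _ /=; congr (_ _).
by rewrite /ysection; apply/seteqP; split => y /=; rewrite inE.
Qed.

Lemma measurable_section1 n (A : set 'rV[R]_n.+1) t : measurable A ->
  measurable [set y | A (cons_rV (t, y))].
Proof.
move=> mA; rewrite -[X in measurable X]setTI.
apply: (measurableT_comp (@measurable_cons_rV R n)) => //.
Qed.

Lemma measurable_section2 n (A : set 'rV[R]_n.+1) y : measurable A ->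
  measurable [set t : R | A (cons_rV (t, y))].
Proof.
move=> mA; rewrite -[X in measurable X]setTI.
apply: (measurableT_comp (@measurable_cons_rV R n)) => //.
Qed.

Lemma measurable_vol_section1 n (A : set 'rV[R]_n.+1) : measurable A ->
  measurable_fun setT (fun t : R => vol [set y | A (cons_rV (t, y))]).
Proof.
move=> mA.
have := @measurable_fun_xsection _ _ (measurableTypeR R) 'rV[R]_n R vol
  (@cons_rV R n @^-1` A).
rewrite -[X in measurable X]setTI => /(_ (@measurable_cons_rV R n measurableT A mA)).
congr (measurable_fun _ _); apply/funext => t /=; congr (_ _).
by rewrite /xsection; apply/seteqP; split => y /=; rewrite inE.
Qed.

Lemma measurable_lebesgue_section2 n (A : set 'rV[R]_n.+1) : measurable A ->
  measurable_fun setT (fun y => (@lebesgue_measure R) [set t : R | A (cons_rV (t, y))]).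
Proof.
move=> mA.
have := @measurable_fun_ysection _ _ (measurableTypeR R) 'rV[R]_n R (@lebesgue_measure R)
  (@cons_rV R n @^-1` A).
rewrite -[X in measurable X]setTI => /(_ (@measurable_cons_rV R n measurableT A mA)).
congr (measurable_fun _ _); apply/funext => t /=; congr (_ _).
by rewrite /ysection; apply/seteqP; split => y /=; rewrite inE.
Qed.

(** Fubini along the coordinate [i]: each line in that direction meets [A] in at most one point, and
    points are Lebesgue null. The induction peels off the coordinates before [i]. *)
Lemma vol_line_null n (A : set 'rV[R]_n) (i : 'I_n) : measurable A ->
  (forall x s, A x -> A (x + s *: delta_mx 0 i) -> s = 0) -> vol A = 0%E.
Proof.
elim: n A i => [A [] //|n IH A i mA H].
have [j|] := unliftP ord0 i => [ij|i0].
  rewrite vol_section1// integral0_eq// => t _.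
  apply: (IH _ j); first exact: measurable_section1.
  move=> y s /= Ay Ays; apply: (H _ _ Ay).
  rewrite (_ : _ + _ = cons_rV (t, y + s *: delta_mx 0 j))//.
  apply: cons_rVP => [|k]; rewrite ij !mxE ?unlift_none ?liftK.
    by rewrite (negbTE (neq_lift _ _)) andbF mulr0 addr0.
  by rewrite (inj_eq lift_inj) /= !mxE.
rewrite vol_section2// integral0_eq// => y _.
have [[t At]|nA] := pselect (exists t, A (cons_rV (t, y))); last first.
  rewrite (_ : [set _ | _] = set0) ?measure0//; apply/seteqP; split => // t At.
  by apply: nA; exists t.
rewrite (_ : [set _ | _] = [set t]) ?lebesgue_measure_set1//.
apply/seteqP; split => [s As|_ ->//] /=.
apply/eqP; rewrite -subr_eq0; apply/eqP; apply: (H _ _ At).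
rewrite (_ : _ + _ = cons_rV (s, y))//.
apply: cons_rVP => [|k]; rewrite i0 !mxE ?unlift_none ?liftK /= ?eqxx ?mulr1.
  by rewrite addrCA subrr addr0.
by rewrite mulr0 addr0.
Qed.

(** Common induction step for translations, the reflection and dilations: a map acting separately on
    the first coordinate and on the others multiplies the two scaling factors. *)
Lemma vol_map_cons n (c d : R) (phi : measurableTypeR R -> measurableTypeR R) (psi : 'rV[R]_n -> 'rV[R]_n)
    (Phi : 'rV[R]_n.+1 -> 'rV[R]_n.+1) :
  0 <= c -> 0 <= d ->
  measurable_fun setT phi -> measurable_fun setT Phi ->
  (forall t y, Phi (cons_rV (t, y)) = cons_rV (phi t, psi y)) ->
  (forall A, measurable A -> c%:E * lebesgue_measure (phi @^-1` A) = lebesgue_measure A)%E ->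
  (forall A, measurable A -> d%:E * vol (psi @^-1` A) = vol A)%E ->
  forall A, measurable A -> ((c * d)%:E * vol (Phi @^-1` A) = vol A)%E.
Proof.
move=> c0 d0 mphi mPhi PhiE phiE psiE A mA.
have mPA : measurable (Phi @^-1` A) by rewrite -[X in measurable X]setTI; exact: mPhi.
rewrite [in LHS]vol_section1// EFinM -muleA -ge0_integralZl//; last exact: measurable_vol_section1.
under eq_integral => t _.
  rewrite (_ : [set y | _] = psi @^-1` [set y | A (cons_rV (phi t, y))]); last first.
    by apply/seteqP; split => y /=; rewrite PhiE.
  rewrite psiE; last exact: measurable_section1.
  over.
rewrite (vol_section1 mA).
pose mphi' := isMeasurableFun.Build _ _ _ _ phi mphi.
pose phi' : {mfun (measurableTypeR R) >-> (measurableTypeR R)} := HB.pack phi mphi'.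
rewrite -(@ge0_integral_pushforward _ _ _ _ R phi' mphi lebesgue_measure setT
  (fun t => vol [set y | A (cons_rV (t, y))]))//=; last exact: measurable_vol_section1.
pose k : {nonneg R} := NngNum c0.
rewrite -[c%:E]/(k%:num%:E) -ge0_integral_mscale//=; last exact: measurable_vol_section1.
apply: eq_measure_integral => //= B mB _; rewrite /mscale/= /pushforward.
exact: phiE.
Qed.

Lemma lebesgue_measureD c (A : set R) : measurable A ->
  lebesgue_measure ((fun t => t + c) @^-1` A) = lebesgue_measure A.
Proof.
move=> mA; pose f0 : measurableTypeR R -> measurableTypeR R := fun t : R => t + c.
have mf : measurable_fun setT f0 by exact: measurable_funD.
pose mf' := isMeasurableFun.Build _ _ _ _ f0 mf.
pose f : {mfun (measurableTypeR R) >-> (measurableTypeR R)} := HB.pack f0 mf'.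
rewrite -[LHS]/(pushforward lebesgue_measure f A).
apply/esym/lebesgue_measure_unique => //= _ [[a b]] _ <-.
rewrite /pushforward/= (_ : _ @^-1` _ = `]a - c, b - c]%classic).
  rewrite !lebesgue_measure_itv/= !lte_fin ltrD2r; case: ifPn => // _.
  by rewrite -!EFinB; congr (_%:E); ring.
by apply/seteqP; split => t /=; rewrite !in_itv/= ltrBlDr lerBrDr.
Qed.

Lemma lebesgue_measureM c (A : set R) : 0 < c -> measurable A ->
  (c%:E * lebesgue_measure ((fun t => c * t)%R @^-1` A) = lebesgue_measure A)%E.
Proof.
move=> c0 mA; pose f0 : measurableTypeR R -> measurableTypeR R := fun t : R => c * t.
have mf : measurable_fun setT f0 by exact: measurable_funM.
pose mf' := isMeasurableFun.Build _ _ _ _ f0 mf.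
pose f : {mfun (measurableTypeR R) >-> (measurableTypeR R)} := HB.pack f0 mf'.
pose k : {nonneg R} := NngNum (ltW c0).
pose m : {measure set (measurableTypeR R) -> \bar R} :=
  mscale k (pushforward lebesgue_measure f).
rewrite -[LHS]/(m mf A) {}/m; apply/esym/lebesgue_measure_unique => //= _ [[a b]] _ <-.
rewrite /mscale/= /pushforward/= (_ : _ @^-1` _ = `]a / c, b / c]%classic).
  rewrite !lebesgue_measure_itv/= !lte_fin ltr_pM2r ?invr_gt0//; case: ifPn => [|_].
    by move=> _; rewrite -!EFinB -EFinM; congr EFin; field; rewrite gt_eqF.
  by rewrite mule0.
by apply/seteqP; split => t /=; rewrite !in_itv/= ltr_pdivrMr// ler_pdivlMr// ![t * c]mulrC.
Qed.

Lemma measurable_rV_coords n m (Phi : 'rV[R]_n -> 'rV[R]_m) :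
  continuous Phi -> measurable_fun setT Phi.
Proof.
move=> cP; apply: measurable_fun_rV => i.
apply: continuous_measurable_rV => x.
exact: (cvg_comp _ _ (cP x) (@coord_continuous _ _ _ 0 i (Phi x))).
Qed.

Lemma volD n (c : 'rV[R]_n) A : measurable A -> vol ((fun x => x + c) @^-1` A) = vol A.
Proof.
elim: n c A => [c A mA|n IH c A mA].
  by congr (_ _); apply/seteqP; split => x /=; rewrite (thinmx0 c) addr0.
rewrite -[LHS]mul1e -[1%:E]/((1:R)%:E) -[X in X%:E](mulr1 1).
apply: (@vol_map_cons n 1 1 (fun t => t + c 0 ord0)
  (fun y => y + \row_j c 0 (lift ord0 j))) => //.
- exact: measurable_funD.
- apply: measurable_rV_coords => x.
  by apply: (@cvgD _ _ _ (nbhs x)); [exact: cvg_id|exact: cvg_cst].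
- move=> t y; apply: cons_rVP => [|i]; first by rewrite !mxE !unlift_none.
  by rewrite !mxE !liftK/= !mxE.
- by move=> B mB; rewrite mul1e lebesgue_measureD.
- by move=> B mB; rewrite mul1e IH.
Qed.

Lemma volN n A : measurable A -> vol ((fun x : 'rV[R]_n => - x) @^-1` A) = vol A.
Proof.
elim: n A => [A mA|n IH A mA].
  by congr (_ _); apply/seteqP; split => x /=; rewrite (thinmx0 x) oppr0.
rewrite -[LHS]mul1e -[1%:E]/((1:R)%:E) -[X in X%:E](mulr1 1).
apply: (@vol_map_cons n 1 1 (fun t => - t) (fun y => - y)) => //.
- exact: oppr_measurable.
- apply: measurable_rV_coords => x.
  by apply: (@cvgN _ _ _ (nbhs x)); exact: cvg_id.
- move=> t y; apply: cons_rVP => [|i]; first by rewrite !mxE !unlift_none.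
  by rewrite !mxE !liftK/= !mxE.
- by move=> B mB; rewrite mul1e -[RHS]lebesgue_measureN.
- by move=> B mB; rewrite mul1e IH.
Qed.

Lemma volZ n (a : R) A : 0 < a -> measurable A ->
  ((a ^+ n)%:E * vol ((fun x : 'rV[R]_n => a *: x) @^-1` A) = vol A)%E.
Proof.
move=> a0; elim: n A => [A mA|n IH A mA].
  rewrite expr0 mul1e.
  by congr (_ _); apply/seteqP; split => x /=; rewrite (thinmx0 x) scaler0.
rewrite exprS.
apply: (@vol_map_cons n a (a ^+ n) (fun t => a * t) (fun y => a *: y)) => //.
- exact: ltW.
- by rewrite exprn_ge0 ?ltW.
- exact: measurable_funM.
- apply: measurable_rV_coords => x; exact: scaler_continuous.
- move=> t y; apply: cons_rVP => [|i]; first by rewrite !mxE !unlift_none.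
  by rewrite !mxE !liftK/= !mxE.
- by move=> B mB; rewrite lebesgue_measureM.
Qed.

Definition box n (c : 'rV[R]_n) (M : R) : set 'rV[R]_n :=
  [set x | forall i, `|x 0 i - c 0 i| <= M].

Lemma closed_box n (c : 'rV[R]_n) M : closed (box c M).
Proof.
rewrite (_ : box c M = \bigcap_(i in [set: 'I_n])
  [set v : 'rV[R]_n | `|v 0 i - c 0 i| <= M]); last first.
  by apply/seteqP; split=> v bv i; [move=> _; exact: bv|exact: bv].
apply: closed_bigI => i _.
apply: (@preimage_closed _ _ (fun v : 'rV[R]_n => `|v 0 i - c 0 i|) [set x | x <= M]).
  move=> v _; apply: (@cvg_norm _ R _ (nbhs v)).
  apply: (@cvgB _ R _ (nbhs v)); last exact: cvg_cst.
  exact: coord_continuous.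
exact: closed_le.
Qed.

Lemma vol_box n (c : 'rV[R]_n) M : 0 <= M -> vol (box c M) = ((M *+ 2) ^+ n)%:E.
Proof.
move=> M0; elim: n c => [|n IH] c.
  rewrite expr0 (_ : box c M = setT); last by apply/seteqP; split => // x _ [].
  by rewrite /vol/= diracT.
rewrite vol_section1; last by apply: closed_measurable_rV; exact: closed_box.
rewrite (eq_integral (fun t : measurableTypeR R => (\1_(`[c 0 ord0 - M, c 0 ord0 + M]%classic) t)%:E *
    ((M *+ 2) ^+ n)%:E))%E.
  rewrite ge0_integralZr//=; [|by apply/measurable_EFinP|
    by rewrite lee_fin exprn_ge0// mulrn_wge0].
  rewrite integral_indic//= setIT lebesgue_measure_itv/= lte_fin.
  rewrite exprS EFinM; case: ifPn => h.
    congr (_ * _)%E; rewrite -EFinB; congr _%:E; ring.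
  have -> : M = 0 by apply/eqP; rewrite eq_le M0 andbT; lra.
  by rewrite mul0rn mul0e.
move=> t _; rewrite indicE; case: (boolP (t \in _)) => /=; rewrite ?inE ?notin_setE /= in_itv/= => ht.
  rewrite mul1e -(IH (\row_j c 0 (lift ord0 j))); congr (_ _).
  apply/seteqP; split => y /= H i.
    by have := H (lift ord0 i); rewrite cons_rVS mxE.
  have [j ->|->] := unliftP ord0 i; last by rewrite cons_rV0 ler_distl.
  by rewrite cons_rVS; have := H j; rewrite mxE.
rewrite mul0e (_ : [set _ | _] = set0) ?measure0//.
apply/seteqP; split => // y /= /(_ ord0); rewrite cons_rV0 ler_distl => h.
by apply: ht.
Qed.

Lemma vol_le n (A B : set 'rV[R]_n) : measurable A -> measurable B -> A `<=` B ->
  (vol A <= vol B)%E.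
Proof. by move=> mA mB AB; apply: le_measure; rewrite ?inE. Qed.

Lemma vol_bounded n (A : set 'rV[R]_n) M : measurable A ->
  (forall x, A x -> enorm x <= M) -> (vol A < +oo)%E.
Proof.
move=> mA AM; have [M0|M0] := leP 0 M; last first.
  rewrite (_ : A = set0) ?measure0//; apply/seteqP; split => // x /AM.
  by rewrite leNgt (lt_le_trans M0 (enorm_ge0 _)).
apply: (@le_lt_trans _ _ (vol (box (0 : 'rV[R]_n) M))); last by rewrite vol_box// ltry.
apply: vol_le => //; first by apply: closed_measurable_rV; exact: closed_box.
by move=> x /AM xM i; rewrite mxE subr0 (le_trans (coord_le_enorm _ _)).
Qed.

Lemma vol_interior_gt0 n (A : set 'rV[R]_n) : measurable A -> interior A !=set0 ->
  (0 < vol A)%E.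
Proof.
move=> mA [x]; rewrite /interior => /nbhs_ballP[e /= e0 eA].
apply: (@lt_le_trans _ _ (vol (box x (e / 2)))).
  by rewrite vol_box ?lte_fin ?exprn_gt0 ?pmulrn_rgt0 ?divr_gt0// ltW// divr_gt0.
apply: vol_le => //; first by apply: closed_measurable_rV; exact: closed_box.
move=> y yx; apply: eA; split => // i j; rewrite ord1 /ball/= distrC (le_lt_trans (yx j))//.
by rewrite ltr_pdivrMr// ltr_pMr// ltr1n.
Qed.
End vol.

(** * From contents to measures *)

Section content_to_measure.
Variables (R : realType) (T : normedModType R).
Variables (Q : set T) (m : set T -> R).
Hypothesis cQ : compact Q.
Hypothesis clQ : closed Q.
Hypothesis m_ge0 : forall A, 0 <= m A.
Hypothesis m_mono : forall A B, A `<=` B -> m A <= m B.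
Hypothesis mU : forall A B, A `&` B = set0 -> m (A `|` B) = m A + m B.
Hypothesis mQ : forall A, m (A `&` Q) = m A.
Local Open Scope ereal_scope.

(* [m] is only finitely additive. Inner regularisation by closed sets makes it countably
   subadditive on open sets, because [m] is carried by the compact set [Q]. *)
Definition inner_content (U : set T) : \bar R :=
  ereal_sup [set (m F)%:E | F in [set F | closed F /\ F `<=` U]].

Definition content_outer (A : set T) : \bar R :=
  ereal_inf [set inner_content U | U in [set U | open U /\ A `<=` U]].

Local Notation lam := inner_content.
Local Notation om := content_outer.

Let lam_ub F U : closed F -> F `<=` U -> (m F)%:E <= lam U.
Proof. by move=> cF FU; apply: ereal_sup_ubound; exists F. Qed.

Let normalT : normal_space T. Proof. exact: (@pseudometric_normal R). Qed.

Let m0 : m set0 = 0%R.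
Proof.
have := @mU set0 set0 (setI0 _); rewrite setU0 => /eqP.
by rewrite -subr_eq0 opprD addrA subrr sub0r oppr_eq0 => /eqP.
Qed.

Let lam_ge0 U : 0 <= lam U.
Proof.
by apply: le_trans (lam_ub closed0 (sub0set U)); rewrite m0.
Qed.

Let lam_le U : lam U <= (m U)%:E.
Proof. by apply: ge_ereal_sup => _ [F [cF FU] <-]; rewrite lee_fin m_mono. Qed.

Let lam_fin U : lam U \is a fin_num.
Proof. by rewrite ge0_fin_numE// (le_lt_trans (lam_le _))// ltry. Qed.

Let lam_mono U V : U `<=` V -> lam U <= lam V.
Proof.
move=> UV; apply: ge_ereal_sup => _ [F [cF FU] <-].
by apply: lam_ub => //; exact: subset_trans UV.
Qed.

Let lam_adh U (e : R) : (0 < e)%R -> exists F, [/\ closed F, F `<=` U & lam U - e%:E < (m F)%:E].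
Proof.
move=> e0; have /(_ _ e0) := @ub_ereal_sup_adherent _ _ _ _ (lam_fin U).
by move=> [_ [F [cF FU] <-] h]; exists F.
Qed.

Let lam0 : lam set0 = 0.
Proof. by apply/eqP; rewrite eq_le lam_ge0 andbT (le_trans (lam_le _))// m0. Qed.

Let m_sub A B : (m (A `|` B) <= m A + m B)%R.
Proof.
rewrite -(setDUK (@subsetUl _ A B)) mU ?lerD2l; last by rewrite setDIK.
by apply: m_mono => x [[]].
Qed.

(** Normality separates the disjoint closed sets [F]\[V] and [F]\[U] by disjoint open sets [W1] and
    [W2]. Then [F] is the union of the closed sets [F]\[W2], contained in [U], and [F]\[W1],
    contained in [V]. *)
Let lamU U V : open U -> open V -> lam (U `|` V) <= lam U + lam V.
Proof.
move=> oU oV; apply: ge_ereal_sup => _ [F [cF FUV] <-].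
have cFV : closed (F `\` V) by apply: closedI => //; exact: open_closedC.
have cFU : closed (F `\` U) by apply: closedI => //; exact: open_closedC.
have dis : (F `\` V) `&` (F `\` U) = set0.
  apply/seteqP; split => // x [[Fx nV] [_ nU]].
  by have [] := FUV x Fx.
have [W1 [W2 [oW1 oW2 FW1 FW2 W12]]] := (@normal_openP R T).1 normalT _ _ cFV cFU dis.
have -> : F = (F `\` W2) `|` (F `\` W1).
  apply/seteqP; split => [x Fx|x [[]|[]]//].
  have [W2x|nW2x] := pselect (W2 x); [right|left]; split => // W1x.
  by rewrite -[False]/(set0 x) -W12.
apply: (@le_trans _ _ ((m (F `\` W2))%:E + (m (F `\` W1))%:E)).
  by rewrite -EFinD lee_fin m_sub.
apply: leeD; apply: lam_ub.
- by apply: closedI => //; exact: open_closedC.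
- move=> x [Fx nW2]; apply: contrapT => nU; apply: nW2; apply: FW2; split => //.
- by apply: closedI => //; exact: open_closedC.
- move=> x [Fx nW1]; apply: contrapT => nV; apply: nW1; apply: FW1; split => //.
Qed.

Let lam_bigU (U : nat -> set T) n : (forall k, open (U k)) ->
  lam (\bigcup_(k < n) U k) <= \sum_(0 <= k < n) lam (U k).
Proof.
move=> oU; elim: n => [|n IH].
  by rewrite big_nil bigcup_mkord big_ord0 lam0.
rewrite big_nat_recr//= bigcup_mkord big_ord_recr/= -bigcup_mkord.
apply: le_trans (leeD2r _ IH); apply: lamU => //.
by apply: bigcup_open => k _.
Qed.

(** By [mQ] only [F]&[Q] counts, and compactness leaves finitely many of the [U k]: this is how
    finite additivity yields a countable statement. *)
Let lam_sigma (U : nat -> set T) : (forall k, open (U k)) ->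
  lam (\bigcup_k U k) <= \sum_(k <oo) lam (U k).
Proof.
move=> oU; apply: ge_ereal_sup => _ [F [cF FU] <-].
have cFQ : compact (F `&` Q).
  by rewrite setIC; apply: compact_closedI.
have [n FUn] : exists n, F `&` Q `<=` \bigcup_(k < n) U k.
  have : \forall n \near \oo, F `&` Q `<=` \bigcup_(k < n) U k.
    move/compact_near_coveringP : cFQ => /(_ _ \oo (fun n x => (\bigcup_(k < n) U k) x)).
    apply => x [Fx Qx]; have [k _ Ukx] := FU x Fx.
    exists (U k, [set n | (k < n)%N]) => /=.
      split; first by apply: open_nbhs_nbhs.
      by exists k.+1.
    by move=> [y l] [/= Uky kl]; exists k.
  by move=> [n _ H]; exists n; apply: H => /=.
rewrite -mQ; apply: (@le_trans _ _ (lam (\bigcup_(k < n) U k))).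
  by apply: lam_ub => //; exact: closedI.
apply: (le_trans (lam_bigU n oU)).
by apply: nneseries_lim_ge => k _ _; exact: lam_ge0.
Qed.

Let om_open U : open U -> om U = lam U.
Proof.
move=> oU; apply/eqP; rewrite eq_le; apply/andP; split.
  by apply: ereal_inf_lbound; exists U => //; split.
by apply: le_ereal_inf_tmp => _ [V [oV UV] <-]; exact: lam_mono.
Qed.

Let om_ge0 A : 0 <= om A.
Proof. by apply: le_ereal_inf_tmp => _ [V [oV UV] <-]; exact: lam_ge0. Qed.

Let om_fin A : om A \is a fin_num.
Proof.
rewrite ge0_fin_numE//; apply: (@le_lt_trans _ _ (lam setT)).
  by apply: ereal_inf_lbound; exists setT => //; split => //; exact: openT.
by rewrite (le_lt_trans (lam_le _))// ltry.
Qed.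

Let om0 : om set0 = 0.
Proof. by rewrite om_open ?lam0//; exact: open0. Qed.

Let om_mono : {homo om : A B / A `<=` B >-> A <= B}.
Proof.
move=> A B AB; apply: le_ereal_inf_tmp => _ [V [oV BV] <-].
by apply: ereal_inf_lbound; exists V => //; split => //; exact: subset_trans BV.
Qed.

Let om_adh A (e : R) : (0 < e)%R -> exists U, [/\ open U, A `<=` U & lam U <= om A + e%:E].
Proof.
move=> e0; have /(_ _ e0) := @lb_ereal_inf_adherent _ _ _ _ (om_fin A).
by move=> [_ [U [oU AU] <-] /ltW h]; exists U.
Qed.

Let om_sigma : sigma_subadditive om.
Proof.
move=> A; apply/lee_addgt0Pr => e e0.
have en n : (0 < e / (2 ^ n.+1)%:R)%R by rewrite divr_gt0// ltr0n expn_gt0.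
have [U PU] := choice (fun n => om_adh (A n) (en n)).
apply: (le_trans _ (epsilon_trick _ _ (ltW e0))); last by move=> n; exact: om_ge0.
apply: (@le_trans _ _ (lam (\bigcup_n U n))).
  rewrite -om_open; last by apply: bigcup_open => n _; have [] := PU n.
  apply: om_mono => x [n _ Anx]; exists n => //.
  by have [_ + _] := PU n; exact.
apply: (le_trans (lam_sigma _)); first by move=> k; have [] := PU k.
apply: lee_nneseries => [k _ _|k _]; first exact: lam_ge0.
by have [] := PU k.
Qed.

HB.instance Definition _ := isOuterMeasure.Build R T om om0 om_ge0 om_mono om_sigma.

(** [F1] nearly exhausts [V]&[U] from inside, and [F2] nearly exhausts the open set [V]\[F1], which
    contains what [X] has outside [U]. Both are closed, disjoint and inside [V], so [m] adds up on
    them. *)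
Lemma content_outer_open U : open U -> om.-caratheodory U.
Proof using cQ clQ m_ge0 m_mono mU mQ.
move=> oU; apply: le_caratheodory_measurable => X.
apply: le_ereal_inf_tmp => _ [V [oV XV] <-].
apply/lee_addgt0Pr => e e0; have e2 : (0 < e / 2)%R by rewrite divr_gt0.
have [F1 [cF1 F1V hF1]] := @lam_adh (V `&` U) _ e2.
have [F2 [cF2 F2V hF2]] := @lam_adh (V `\` F1) _ e2.
have oVU : open (V `&` U) by exact: openI.
have oVF : open (V `\` F1) by apply: openI => //; exact: closed_openC.
apply: (@le_trans _ _ (lam (V `&` U) + lam (V `\` F1))).
  rewrite -!om_open//; apply: leeD; apply: om_mono; first exact: setSI.
  by move=> x [Xx nUx]; split; [exact: XV|move=> /F1V []].
apply: (@le_trans _ _ (((m F1)%:E + (e / 2)%:E) + ((m F2)%:E + (e / 2)%:E))).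
  by apply: leeD; rewrite -leeBlDr// ltW.
rewrite addeACA -!EFinD -splitr -mU; last first.
  by apply/seteqP; split => // x [F1x /F2V []].
rewrite EFinD leeD2r//; apply: lam_ub; first exact: closedU.
by move=> x [/F1V[]//|/F2V[]].
Qed.

Lemma content_outer_openE U : open U -> om U = lam U.
Proof using cQ clQ m_ge0 m_mono mU mQ. exact: om_open. Qed.

Lemma content_outer0 : om set0 = 0. Proof using cQ clQ m_ge0 m_mono mU mQ. exact: om0. Qed.

Lemma content_outer_ge0 A : 0 <= om A. Proof using cQ clQ m_ge0 m_mono mU mQ. exact: om_ge0. Qed.

Lemma content_outer_mono : {homo om : A B / A `<=` B >-> A <= B}.
Proof using cQ clQ m_ge0 m_mono mU mQ. exact: om_mono. Qed.

Lemma content_outer_sigma : sigma_subadditive om. Proof using cQ clQ m_ge0 m_mono mU mQ. exact: om_sigma. Qed.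

Lemma content_outer_additive (F : (set T)^nat) :
  (forall k, om.-caratheodory (F k)) -> trivIset setT F ->
  om.-caratheodory (\bigcup_k F k) ->
  (fun n => \sum_(0 <= i < n) om (F i)) @ \oo --> om (\bigcup_k F k).
Proof using cQ clQ m_ge0 m_mono mU mQ.
move=> mF tF mUF.
exact: (@caratheodory_measure_sigma_additive _ _ om).
Qed.

Lemma inner_content_le U : lam U <= (m U)%:E. Proof using cQ clQ m_ge0 m_mono mU mQ. exact: lam_le. Qed.

Lemma inner_contentT : lam setT = (m setT)%:E.
Proof using cQ clQ m_ge0 m_mono mU mQ.
by apply/eqP; rewrite eq_le lam_le lam_ub//; exact: closedT.
Qed.

End content_to_measure.

Section product_content.
Variables (R : realType) (n p : nat).
Local Notation X := ('rV[R]_n * 'rV[R]_p)%type.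
Variables (Q : set X) (m : set X -> R).
Hypothesis cQ : compact Q.
Hypothesis clQ : closed Q.
Hypothesis m_ge0 : forall A, 0 <= m A.
Hypothesis m_mono : forall A B, A `<=` B -> m A <= m B.
Hypothesis mU : forall A B, A `&` B = set0 -> m (A `|` B) = m A + m B.
Hypothesis mQ : forall A, m (A `&` Q) = m A.

Lemma measure_of_content : exists mu : {measure set X -> \bar R},
  mu setT = (m setT)%:E /\ forall U, open U -> mu U = inner_content m U.
Proof.
pose om := content_outer m.
pose om' : outer_measure R X := HB.pack om
  (isOuterMeasure.Build R X om (content_outer0 cQ clQ m_ge0 m_mono mU mQ)
    (content_outer_ge0 cQ clQ m_ge0 m_mono mU mQ)
    (content_outer_mono cQ clQ m_ge0 m_mono mU mQ) (content_outer_sigma cQ clQ m_ge0 m_mono mU mQ)).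
(* The sigma-algebra of the product is generated by the two projections, under which open sets have
   open preimages; it is enough that both be measurable for the Caratheodory sigma-algebra. *)
have mom : forall A : set X, measurable A -> caratheodory_measurable om A.
  pose C := caratheodory_type (om' Q cQ clQ m_mono mU mQ).
  have mfst : measurable_fun [set: C] (fst : C -> 'rV[R]_n).
    apply: (@measurability _ _ _ _ _ _ (@open 'rV[R]_n)) => // _ [U oU <-].
    rewrite setTI; apply: (content_outer_open cQ clQ) => //.
    by apply: open_comp => // x _; exact: cvg_fst.
  have msnd : measurable_fun [set: C] (snd : C -> 'rV[R]_p).
    apply: (@measurability _ _ _ _ _ _ (@open 'rV[R]_p)) => // _ [U oU <-].
    rewrite setTI; apply: (content_outer_open cQ clQ) => //.
    by apply: open_comp => // x _; exact: cvg_snd.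
  apply: smallest_sub; first exact: (@sigma_algebra_measurable _ C).
  rewrite subUset; split => _ [B mB <-]; [exact: mfst|exact: msnd].
have om0 : om set0 = 0%E by apply: (content_outer0 cQ clQ).
have omge0 A : (0 <= om A)%E by apply: (content_outer_ge0 cQ clQ).
have oms : semi_sigma_additive om.
  move=> F mF tF mUF.
  apply: (content_outer_additive cQ clQ) => //; last exact: mom.
  by move=> k; exact: mom.
pose omM := isMeasure.Build _ _ _ om om0 omge0 oms.
pose mu : {measure set X -> \bar R} := HB.pack om omM.
exists mu; split; last by move=> U oU; apply: (content_outer_openE cQ clQ).
rewrite -(inner_contentT cQ clQ m_ge0 m_mono mU mQ).
by apply: (content_outer_openE cQ clQ) => //; exact: openT.
Qed.

End product_content.

(** * Weak limits of discrete couplings *)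

Section ultralimit.
Variables (R : realType) (U : set_system nat).
Hypothesis UU : UltraFilter U.
Hypothesis oU : \oo `<=` U.

Let UP : ProperFilter U. Proof. exact: ultra_proper. Qed.

(** An ultrafilter refining [\oo] gives every bounded sequence a limit at once. The masses of all
    sets converge together, with no extraction of subsequences, and finite additivity passes to the
    limit. *)
Definition ulim (a : nat -> R) : R := lim (a k @[k --> U]).

Lemma cvg_ulim (a : nat -> R) M : (forall k, `|a k| <= M) ->
  a k @[k --> U] --> ulim a.
Proof.
move=> aM; suff : cvg (a k @[k --> U]) by [].
have /(_ (a k @[k --> U]) _ _)[|p [_ pa]] := @segment_compact R (- M) M.
  by apply: nearW => k; rewrite /= in_itv/= -ler_norml.
apply/cvg_ex; exists p => V pV /=.
have [//|nV] := in_ultra_setVsetC (a @^-1` V) UU.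
by have [x [/= + Vx]] := pa (~` V) V nV pV.
Qed.

Lemma ulim_le (a b : nat -> R) M : (forall k, `|a k| <= M) -> (forall k, `|b k| <= M) ->
  (\forall k \near \oo, a k <= b k) -> ulim a <= ulim b.
Proof.
move=> aM bM ab; apply: (ler_cvg_to (cvg_ulim aM) (cvg_ulim bM)).
exact: oU.
Qed.

Lemma ulimD (a b : nat -> R) M : (forall k, `|a k| <= M) -> (forall k, `|b k| <= M) ->
  ulim (fun k => a k + b k) = ulim a + ulim b.
Proof.
move=> aM bM; apply: cvg_lim => //.
by apply: (@cvgD _ _ _ U); [exact: cvg_ulim aM|exact: cvg_ulim bM].
Qed.

Lemma ulim_cst c : ulim (fun=> c) = c.
Proof. by apply: cvg_lim => //; exact: cvg_cst. Qed.

End ultralimit.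

Section probability_of_measure.
Context d (T : measurableType d) (R : realType).
Variable mu : {measure set T -> \bar R}.
Hypothesis mu1 : mu setT = 1%E.

Definition as_probability of mu setT = 1%E : set T -> \bar R := mu.

HB.instance Definition _ := Measure.on (as_probability mu1).
HB.instance Definition _ :=
  Measure_isProbability.Build _ _ _ (as_probability mu1) mu1.

Lemma probability_of_measure :
  exists P : probability T R, P = mu :> (set T -> \bar R).
Proof. by exists (as_probability mu1). Qed.

End probability_of_measure.

Section open_domination.
Variables (R : realType) (n : nat).
Local Notation V := 'rV[R]_n.
Local Open Scope ereal_scope.

(** Complements reverse the inequality on closed sets. An open set is an increasing union of closed
    sets, so equality holds on open sets, which are stable under intersection and generate the Borel
    sets. *)
Lemma probability_open_le_eq (P1 P2 : probability V R) :
  (forall A, open A -> P1 A <= P2 A) -> forall A, measurable A -> P1 A = P2 A.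
Proof.
move=> P12.
have P21 F : closed F -> P2 F <= P1 F.
  move=> cF; have mF := closed_measurable_rV cF.
  have := P12 _ (closed_openC cF); rewrite !probability_setC//.
  rewrite -[P1 F]fineK ?fin_num_measure// -[P2 F]fineK ?fin_num_measure//.
  by rewrite -!EFinB !lee_fin lerD2l lerN2.
have P12o A : open A -> P1 A = P2 A.
  move=> oA; apply/eqP; rewrite eq_le P12//=.
  have [F [cF FU]] := @rV_closed_countable_basis R n.
  pose F' k := if `[< F k `<=` A >] then F k else set0.
  have cF' k : closed (F' k).
    by rewrite /F'; case: asboolP => // _; exact: closed0.
  pose G k : set V := \big[setU/set0]_(i < k.+1) F' i.
  have cG k : closed (G k) by apply: closed_bigsetU => i _; exact: cF'.
  have AE : A = \bigcup_k G k.
    rewrite bigcup_bigsetU_bigcup; apply/seteqP; split => [x Ax|x [k _]].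
      have [k Fkx FkA] := FU _ _ oA Ax; exists k => //.
      by rewrite /F'; case: asboolP.
    by rewrite /F'; case: asboolP => // FA; exact: FA.
  have GA k : G k `<=` A by rewrite AE; exact: bigcup_sup.
  have : P2 (G k) @[k --> \oo] --> P2 A.
    rewrite [in X in _ --> X]AE; apply: nondecreasing_cvg_mu.
    - by move=> k; exact: closed_measurable_rV.
    - by rewrite -AE; exact: open_measurable_rV.
    - by move=> k l kl; apply/subsetPset; exact: subset_bigsetU.
  move=> cv; rewrite -(cvg_lim _ cv)//; apply: lime_le.
    by apply/cvg_ex; eexists; exact: cv.
  apply: nearW => k; apply: (le_trans (P21 _ (cG k))).
  by apply: le_measure; rewrite ?inE//; [exact: closed_measurable_rV|exact: open_measurable_rV].
move=> A mA; apply: (measure_unique (@open V) (fun=> setT)) => //.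
- by move=> B C oB oC; exact: openI.
- by move=> _; exact: openT.
- by apply/seteqP; split => // x _; exists 0%N.
- by move=> k; rewrite (le_lt_trans (probability_le1 _ _)) ?ltry.
Qed.
End open_domination.

(** The sum is [h] times the number of levels h, 2h, ..., Jh strictly below [y]. Strictness makes
    the matching superlevel sets of a lower semicontinuous function open. *)
Lemma staircase_bounds (R : realType) (J : nat) (h y : R) : 0 < h -> 0 <= y ->
  y <= J%:R * h ->
  \sum_(j < J) h * (j.+1%:R * h < y)%R%:R <= y <= h + \sum_(j < J) h * (j.+1%:R * h < y)%R%:R.
Proof.
move=> h0 y0 yJ; apply/andP; split.
  elim: J {yJ} => [|J IH]; first by rewrite big_ord0.
  rewrite big_ord_recr/=; have [yJ|_] := ltP; last by rewrite mulr0 addr0.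
  rewrite mulr1 (le_trans _ (ltW yJ))// -addn1 natrD mulrDl mul1r lerD2r.
  rewrite mulrC mulr_natr -[X in _ *+ X](card_ord J) -sumr_const.
  apply: ler_sum => j _.
  by case: (_ < y); rewrite ?mulr1 ?mulr0 ?lexx ?ltW.
elim: J yJ => [|J IH]; first by rewrite big_ord0 addr0 mul0r => /le_trans; apply; exact: ltW.
move=> yJ; rewrite big_ord_recr/= ltNge yJ/= mulr0 addr0.
have [/IH//|Jy] := leP y (J%:R * h).
rewrite (eq_bigr (fun=> h)) => [|j _].
  rewrite sumr_const card_ord -mulr_natl (le_trans yJ)//.
  by rewrite -add1n natrD mulrDl mul1r.
by rewrite (le_lt_trans _ Jy) ?mulr1// ler_wpM2r ?ler_nat ?(ltW h0).
Qed.

Section coupling_limit.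
Variables (R : realType) (n : nat).
Local Notation V := 'rV[R]_n.
Local Notation X := (V * V)%type.
Variables (nu1 nu2 : probability V R) (Q1 : set V).
Variables (I : nat -> finType) (w : forall k, I k -> R) (z : forall k, I k -> X).
Hypothesis cQ1 : compact Q1.
Hypothesis w_ge0 : forall k i, 0 <= @w k i.
Hypothesis w_sum : forall k, \sum_i @w k i = 1.
Hypothesis zQ1 : forall k i, Q1 (@z k i).1.
Hypothesis zQ2 : forall k i, Q1 (@z k i).2.
Hypothesis marg1 : forall F A, closed F -> open A -> F `<=` A -> F `<=` Q1 ->
  \forall k \near \oo, ((\sum_i @w k i * \1_F (@z k i).1)%:E <= nu1 A)%E.
Hypothesis marg2 : forall F A, closed F -> open A -> F `<=` A -> F `<=` Q1 ->
  \forall k \near \oo, ((\sum_i @w k i * \1_F (@z k i).2)%:E <= nu2 A)%E.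

(* The masses of the discrete plans have an ultralimit, a finitely additive content on Q1 * Q1,
   whose regularisation has marginals below nu1 and nu2 on open sets, hence equal to them. *)
Lemma coupling_limit : exists2 pi : probability X R, coupling nu1 nu2 pi &
  forall (f : X -> R) (M B : R), measurable_fun setT f ->
    (forall x, 0 <= f x <= M) -> (forall t, open [set x | t < f x]) ->
    (\forall k \near \oo, \sum_i @w k i * f (@z k i) <= B) ->
    (\int[pi]_x (f x)%:E <= B%:E)%E.
Proof.
have [U [UU oU]] := ultraFilterLemma eventually_filter.
pose Q : set X := Q1 `*` Q1.
have cQ : compact Q by exact: compact_setX.
have clQ : closed Q by apply: compact_closed => //; exact: norm_hausdorff.
pose S k (A : set X) := \sum_i @w k i * \1_A (@z k i).
have S_ge0 k A : 0 <= S k A by apply: sumr_ge0 => i _; rewrite mulr_ge0.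
have S_mono k A B : A `<=` B -> S k A <= S k B.
  move=> AB; apply: ler_sum => i _; rewrite ler_wpM2l// !indicE.
  have [zA|] := boolP (_ \in A); last by rewrite ler0n.
  by rewrite (mem_set (AB _ (set_mem zA))).
have ST k : S k setT = 1.
  by rewrite -[RHS](w_sum k); apply: eq_bigr => i _; rewrite indicT mulr1.
have S_le1 k A : `|S k A| <= 1 by rewrite ger0_norm// -(ST k) S_mono.
pose m A := ulim U (S ^~ A).
have mle A B : (\forall k \near \oo, S k A <= S k B) -> m A <= m B.
  by move=> AB; apply: (ulim_le UU oU (S_le1^~ A) (S_le1^~ B)).
have m_le A c : 0 <= c <= 1 -> (\forall k \near \oo, S k A <= c) -> m A <= c.
  move=> /andP[c0 c1] Ac; rewrite -[leRHS](ulim_cst UU).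
  apply: (ulim_le UU oU (S_le1^~ A)) => //.
  by move=> k; rewrite ger0_norm.
have mT : m setT = 1.
  by rewrite /m (_ : S^~ setT = fun=> 1) ?ulim_cst//; apply/funext => k; exact: ST.
have m_ge0 A : 0 <= m A.
  rewrite -[leLHS](ulim_cst UU).
  by apply: (ulim_le UU oU _ (S_le1^~ A)) => [k|]; [rewrite normr0|exact: nearW].
have m_mono A B : A `<=` B -> m A <= m B.
  by move=> AB; apply: mle; apply: nearW => k; exact: S_mono.
have mU A B : A `&` B = set0 -> m (A `|` B) = m A + m B.
  move=> AB; rewrite /m -(ulimD UU (S_le1^~ A) (S_le1^~ B)).
  congr (ulim U _); apply/funext => k; rewrite /S -big_split/=.
  apply: eq_bigr => i _; rewrite -mulrDr; congr (_ * _).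
  rewrite !indicE in_setU; have [zA|zA] := boolP (_ \in A); last by rewrite add0r.
  have [zB|zB] := boolP (_ \in B); last by rewrite addr0.
  have : (A `&` B) (z i) by split; exact: set_mem.
  by rewrite AB.
have mQ A : m (A `&` Q) = m A.
  congr (ulim U _); apply/funext => k; apply: eq_bigr => i _; congr (_ * _).
  have zQ : Q (z i) := conj (zQ1 i) (zQ2 i).
  by rewrite !indicE in_setI (mem_set zQ) andbT.
have [mu [muT muo]] := measure_of_content cQ clQ m_ge0 m_mono mU mQ.
have mu1 : mu setT = 1%E by rewrite muT mT.
have [pi piE] := probability_of_measure mu1.
(* The regularisation may lose mass on open sets but never gains any: the one-sided estimate behind
   both the marginals and the bound on integrals. *)
have piU A : open A -> (pi A <= (m A)%:E)%E.
  by move=> oA; rewrite piE muo//; exact: inner_content_le cQ clQ m_ge0 m_mono mU mQ _.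
exists pi.
  suff H : (forall A, open A -> pi (A `*` setT) <= nu1 A)%E /\
           (forall A, open A -> pi (setT `*` A) <= nu2 A)%E.
    pose f1 : {mfun X >-> V} := HB.pack (fst : X -> V)
      (isMeasurableFun.Build _ _ _ _ (fst : X -> V) measurable_fst).
    pose f2 : {mfun X >-> V} := HB.pack (snd : X -> V)
      (isMeasurableFun.Build _ _ _ _ (snd : X -> V) measurable_snd).
    have XT B : B `*` setT = (fst : X -> V) @^-1` B by apply/seteqP; split => x //= [].
    have TX B : setT `*` B = (snd : X -> V) @^-1` B by apply/seteqP; split => x //= [].
    move=> A mA; split.
      rewrite -(probability_open_le_eq (P1 := distribution pi f1))//; first by rewrite XT.
      by move=> B oB; have := H.1 B oB; rewrite XT.
    rewrite -(probability_open_le_eq (P1 := distribution pi f2))//; first by rewrite TX.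
    by move=> B oB; have := H.2 B oB; rewrite TX.
  split=> A oA.
  - rewrite piE muo; last first.
      rewrite (_ : _ `*` _ = fst @^-1` A); last by apply/seteqP; split => x //= [].
      by apply: open_comp => // x _; exact: cvg_fst.
    apply: ge_ereal_sup => _ [F [cF FA] <-].
    (* The projection of [F] alone need not be closed; that of [F]&[Q] is compact, and [mQ] makes
       the intersection free. *)
    pose F1 := fst @` (F `&` Q).
    have cF1 : compact F1.
      apply: continuous_compact; last by rewrite setIC; exact: compact_closedI.
      by apply: continuous_subspaceT => x; exact: cvg_fst.
    have clF1 : closed F1 by apply: compact_closed => //; exact: norm_hausdorff.
    have F1A : F1 `<=` A by move=> _ [x [/FA []]] ? _ _ <-.
    have F1Q : F1 `<=` Q1 by move=> _ [x [_ [? _]] <-].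
    have nuf : nu1 A \is a fin_num by rewrite fin_num_measure//; exact: open_measurable_rV.
    rewrite -(fineK nuf) lee_fin -mQ; apply: m_le.
      rewrite fine_ge0//= -lee_fin fineK// probability_le1//; exact: open_measurable_rV.
    have := marg1 clF1 oA F1A F1Q; apply: filterS => k; rewrite -(fineK nuf) lee_fin.
    apply: le_trans; apply: ler_sum => i _; rewrite ler_wpM2l// !indicE.
    have [zF|] := boolP (_ \in F `&` Q); last by rewrite ler0n.
    by rewrite mem_set//; exists (@z k i) => //; exact: set_mem.
  - rewrite piE muo; last first.
      rewrite (_ : _ `*` _ = snd @^-1` A); last by apply/seteqP; split => x //= [].
      by apply: open_comp => // x _; exact: cvg_snd.
    apply: ge_ereal_sup => _ [F [cF FA] <-].
    pose F1 := snd @` (F `&` Q).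
    have cF1 : compact F1.
      apply: continuous_compact; last by rewrite setIC; exact: compact_closedI.
      by apply: continuous_subspaceT => x; exact: cvg_snd.
    have clF1 : closed F1 by apply: compact_closed => //; exact: norm_hausdorff.
    have F1A : F1 `<=` A by move=> _ [x [/FA []]] ? ? _ <-.
    have F1Q : F1 `<=` Q1 by move=> _ [x [_ [_ ?]] <-].
    have nuf : nu2 A \is a fin_num by rewrite fin_num_measure//; exact: open_measurable_rV.
    rewrite -(fineK nuf) lee_fin -mQ; apply: m_le.
      rewrite fine_ge0//= -lee_fin fineK// probability_le1//; exact: open_measurable_rV.
    have := marg2 clF1 oA F1A F1Q; apply: filterS => k; rewrite -(fineK nuf) lee_fin.
    apply: le_trans; apply: ler_sum => i _; rewrite ler_wpM2l// !indicE.
    have [zF|] := boolP (_ \in F `&` Q); last by rewrite ler0n.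
    by rewrite mem_set//; exists (@z k i) => //; exact: set_mem.
move=> f M B mf f0M of_ LB.
(* [f] is replaced, up to [h], by a staircase over open superlevel sets. There [pi] is at most [m],
   and [m] is the limit of the masses of the discrete plans, whose sums are eventually at most
   [B]. *)
apply/lee_addgt0Pr => h h0.
have [J MJ] : exists J : nat, M <= J%:R * h.
  exists (Num.bound `|M / h|); rewrite -ler_pdivrMr//.
  by rewrite (le_trans (ler_norm _))// ltW// archi_boundP.
pose E (j : nat) := [set x | j.+1%:R * h < f x].
have mE j : measurable (E j).
  rewrite (_ : E j = [set: X] `&` f @^-1` `]j.+1%:R * h, +oo[%classic).
    exact: mf.
  by rewrite setTI; apply/seteqP; split => x /=; rewrite in_itv/= andbT.
pose s x : R := \sum_(j < J) h * \1_(E j) x.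
have sf x : s x <= f x <= h + s x.
  have /andP[fx0 /le_trans /(_ MJ) fxJ] := f0M x.
  have sE j : \1_(E j) x = (j.+1%:R * h < f x)%R%:R :> R.
    rewrite indicE; congr (nat_of_bool _)%:R.
    by apply/idP/idP => [/set_mem//|?]; apply/mem_set.
  rewrite (_ : s x = \sum_(j < J) h * (j.+1%:R * h < f x)%R%:R); first exact: staircase_bounds.
  by apply: eq_bigr => j _; rewrite sE.
have mS j : measurable_fun setT (fun x => (h * \1_(E j) x)%:E).
  by apply/measurable_EFinP; apply: measurable_funM.
apply: (@le_trans _ _ (\int[pi]_x (h%:E + \sum_(j < J) (h * \1_(E j) x)%:E))%E).
  apply: ge0_le_integral => //.
  - by move=> x _; rewrite lee_fin; have /andP[] := f0M x.
  - exact/measurable_EFinP.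
  - apply: emeasurable_funD => //; apply: emeasurable_sum => j _; exact: mS.
  - by move=> x _; rewrite sumEFin -EFinD lee_fin; have /andP[] := sf x.
rewrite ge0_integralD//; last 3 first.
- by move=> x _; rewrite lee_fin ltW.
- by move=> x _; apply: sume_ge0 => j _; rewrite lee_fin mulr_ge0// ltW.
- by apply: emeasurable_sum => j _; exact: mS.
rewrite integral_cst// [X in (h%:E * X)%E](_ : _ = 1%E); last exact: probability_setT.
rewrite mule1 addeC leeD2r//.
rewrite ge0_integral_sum//; last by move=> j x _; rewrite lee_fin mulr_ge0// ltW.
apply: (@le_trans _ _ (\sum_(j < J) (h * m (E j))%:E)%E).
  apply: lee_sum => j _; under eq_integral do rewrite EFinM.
  rewrite ge0_integralZl//=; last 2 first.
  - exact/measurable_EFinP.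
  - by rewrite lee_fin ltW.
  by rewrite integral_indic// setIT EFinM lee_pmul2l ?lte_fin//; apply: piU; exact: of_.
rewrite sumEFin lee_fin.
have cv : (fun k => \sum_(j < J) h * S k (E j)) @ U --> \sum_(j < J) h * m (E j).
  apply: cvg_big => [|j _]; first exact: add_continuous.
  apply: (@cvgM _ _ U); first exact: cvg_cst.
  exact: cvg_ulim (S_le1^~ (E j)).
apply: (ler_cvg_to cv (cvg_cst B)).
apply: oU; apply: filterS LB => k; apply: le_trans.
under eq_bigr do rewrite mulr_sumr.
rewrite exchange_big/=; apply: ler_sum => i _.
have /andP[sfi _] := sf (z i); apply: le_trans (ler_wpM2l (w_ge0 i) sfi).
by rewrite /s mulr_sumr; apply: ler_sum => j _; rewrite mulrCA.
Qed.
End coupling_limit.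

(** * Finite linear programming duality *)

Lemma continuous_sumr (U : topologicalType) (R : realType) (I : finType) (f : I -> U -> R) :
  (forall i, continuous (f i)) -> continuous (fun x => \sum_i f i x).
Proof.
move=> cf x; apply: (@cvg_big _ I +%R 0 xpredT _ U (nbhs x) _ f (f^~ x)).
  exact: add_continuous.
by move=> i _; exact: cf.
Qed.

Section finite_duality.
Variables (R : realType) (T K : finType).
Variables (a : T -> K -> R) (b : K -> R) (c : T -> R) (B : R).

Let mean (w : T -> R) (f : T -> R) := \sum_t w t * f t.
Let res (w : T -> R) k := b k - mean w (a^~ k).
Let pos (x : R) := (`|x| + x) / 2.
Let exc (w : T -> R) := pos (mean w c - B).
(** A penalty: on the simplex it vanishes exactly at the plans that satisfy all constraints [b] at a
    cost of at most [B]. *)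
Let F w := \sum_k res w k ^+ 2 + exc w ^+ 2.
Let simplex (w : T -> R) := (forall t, 0 <= w t) /\ \sum_t w t = 1.

Let toward (w : T -> R) (e : R) t0 t := (1 - e) * w t + e * (t == t0)%:R.

Let meanD w e t0 f : mean (toward w e t0) f = (1 - e) * mean w f + e * f t0.
Proof.
rewrite /mean /toward mulr_sumr; under eq_bigr do rewrite mulrDl.
rewrite big_split/=; congr (_ + _).
  by apply: eq_bigr => t _; rewrite mulrA.
rewrite (bigD1 t0)//= eqxx mulr1 big1 ?addr0// => t /negbTE ->.
by rewrite mulr0 mul0r.
Qed.

Let simplex_toward w e t0 : 0 <= e <= 1 -> simplex w -> simplex (toward w e t0).
Proof.
move=> /andP[e0 e1] [w0 w1]; split.
  by move=> t; rewrite addr_ge0// mulr_ge0// subr_ge0.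
have := meanD w e t0 (fun=> 1); rewrite /mean.
under eq_bigr do rewrite mulr1; move=> ->.
by under eq_bigr do rewrite mulr1; rewrite w1 !mulr1 subrK.
Qed.

Let pos_ge0 x : 0 <= pos x.
Proof. by rewrite divr_ge0// addrC -lerBlDl sub0r -normrN ler_norm. Qed.

Let pos_sqr x : pos x ^+ 2 = pos x * x.
Proof. by rewrite /pos expr2; case: (ger0P x) => _; field. Qed.

(** A quadratic majorant in [y], tangent at 0; it replaces differentiating the squared positive
    part. *)
Let pos_shift x y : pos (x + y) ^+ 2 <= (pos x + y) ^+ 2.
Proof. by rewrite /pos; case: (ger0P x) => hx; case: (ger0P (x + y)) => hxy; nra. Qed.

(* The residuals at a minimiser of [F] over the simplex are dual variables: by the first-order
   condition they would contradict the hypotheses of [finite_duality] if [F] did not vanish. *)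
Let exists_min : (exists t : T, True) -> exists2 w, simplex w & forall v, simplex v -> F w <= F v.
Proof.
move=> [t0 _].
pose fw (x : 'rV[R]_#|T|) t := x 0 (enum_rank t).
pose A := [set x : 'rV[R]_#|T| | simplex (fw x)].
have cm f : continuous (fun x => mean (fw x) f).
  apply: continuous_sumr => t x.
  by apply: (@cvgM _ _ (nbhs x)); [exact: coord_continuous|exact: cvg_cst].
have cF : continuous (fun x => F (fw x)).
  move=> x; apply: (@cvgD _ _ _ (nbhs x)).
    apply: (@continuous_sumr _ _ _ (fun k x => res (fw x) k ^+ 2)) => k {}x.
    have cr : res (fw y) k @[y --> x] --> res (fw x) k.
      by apply: (@cvgB _ _ _ (nbhs x)); [exact: cvg_cst|exact: cm].
    exact: (cvg_comp _ _ cr (@exprn_continuous _ 2 _)).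
  have ce : exc (fw y) @[y --> x] --> exc (fw x).
    apply: (@cvgM _ _ (nbhs x)); last exact: cvg_cst.
    have cB : mean (fw y) c - B @[y --> x] --> mean (fw x) c - B.
      by apply: (@cvgB _ _ _ (nbhs x)); [exact: cm|exact: cvg_cst].
    by apply: (@cvgD _ _ _ (nbhs x)) => //; apply: (@cvg_norm _ _ _ (nbhs x)).
  exact: (cvg_comp _ _ ce (@exprn_continuous _ 2 _)).
have fwK v : fw (\row_i v (enum_val i)) = v.
  by apply/funext => t; rewrite /fw mxE enum_rankK.
have clA : closed A.
  rewrite (_ : A = (\bigcap_(t in [set: T]) [set x | 0 <= fw x t]) `&`
      [set x | mean (fw x) (fun=> 1) = 1]); last first.
    apply/seteqP; split => x /=.
      move=> [x0 x1]; split => [t _|]; first exact: x0.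
      by rewrite /mean/=; under eq_bigr do rewrite mulr1.
    move=> [x0 x1]; split => [t|]; first exact: x0.
    by rewrite -[RHS]x1 /mean; apply: eq_bigr => t _; rewrite mulr1.
  apply: closedI.
    apply: closed_bigI => t _.
    apply: (@preimage_closed _ _ (fun x => fw x t) [set y | 0 <= y]).
      by move=> x _; exact: coord_continuous.
    exact: closed_ge.
  apply: (@preimage_closed _ _ (fun x => mean (fw x) (fun=> 1)) [set 1]).
    by move=> x _; exact: cm.
  exact: closed_eq.
have cA : compact A.
  apply: (subclosed_compact clA (@rV_compact R #|T| (fun=> `[0, 1]%classic) _)).
    by move=> _; exact: segment_compact.
  move=> x [x0 x1] i /=; rewrite in_itv/=.
  have := x0 (enum_val i); rewrite /fw enum_valK => -> /=.
  rewrite -x1 (bigD1 (enum_val i))//= /fw enum_valK lerDl.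
  by apply: sumr_ge0 => t _; exact: x0.
have A0 : A !=set0.
  exists (\row_i (enum_val i == t0)%:R); rewrite /A/= (fwK (fun t => (t == t0)%:R)); split.
    by move=> t; rewrite ler0n.
  by rewrite (bigD1 t0)//= eqxx big1 ?addr0// => t /negbTE ->.
have [x /set_mem Ax xm] := compact_EVT_min A0 cA (continuous_subspaceT cF).
exists (fw x) => // v sv.
have := xm (\row_i v (enum_val i)); rewrite fwK; apply.
by apply/mem_set; rewrite /A/= fwK.
Qed.

(** A theorem of alternatives. In both hypotheses [m] is the multiplier of the constraint of total
    mass one; the first excludes multipliers that give the cost weight 0, the second those that give
    it a positive weight, normalised to 1. *)
Lemma finite_duality :
  (forall (y : K -> R) m, (forall t, \sum_k y k * a t k <= m) -> \sum_k y k * b k <= m) ->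
  (forall (y : K -> R) m, (forall t, \sum_k y k * a t k <= c t + m) ->
     \sum_k y k * b k <= B + m) ->
  exists w : T -> R, [/\ forall t, 0 <= w t, \sum_t w t = 1,
    forall k, \sum_t w t * a t k = b k & \sum_t w t * c t <= B].
Proof.
move=> H0 H1.
(* Over an empty [T] the first hypothesis, with [y] zero and [m] equal to -1, would give 0 <= -1. *)
have T0 : exists t : T, True.
  apply: contrapT => nT.
  have := H0 (fun=> 0) (-1) (fun t => False_ind _ (nT (ex_intro _ t I))).
  rewrite big1 => [|k _]; last by rewrite mul0r.
  by rewrite leNgt ltrN10.
have [w [w0 w1] wm] := exists_min T0.
pose r := res w; pose t := exc w.
pose m := \sum_k r k * (b k - r k) - t * (B + t).
(* First-order condition at the minimiser [w] when it is moved towards the vertex [t0]: up to a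
   factor, [S] is the rate of decrease of [F] and [Q] bounds the quadratic error. *)
have first_order t0 : \sum_k r k * a t0 k - t * c t0 <= m.
  pose D k := a t0 k - mean w (a^~ k); pose g := c t0 - mean w c.
  pose S := \sum_k r k * D k - t * g.
  pose Q := \sum_k D k ^+ 2 + g ^+ 2.
  have Sle e : 0 < e <= 1 -> 2 * S <= e * Q.
    move=> /andP[e0 e1]; rewrite -(ler_pM2l e0).
    have e01 : 0 <= e <= 1 by rewrite ltW.
    have := wm _ (simplex_toward t0 e01 (conj w0 w1)).
    rewrite {2}/F (_ : \sum_k _ = \sum_k (r k - e * D k) ^+ 2); last first.
      by apply: eq_bigr => k _; rewrite /res meanD /r /D /res; congr (_ ^+ 2); ring.
    have -> : exc (toward w e t0) = pos ((mean w c - B) + e * g).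
      by rewrite /exc meanD /g; congr (pos _); ring.
    move=> /le_trans /(_ (lerD (lexx _) (pos_shift _ _))).
    rewrite /F -/t -/(exc w) -/t.
    have -> : \sum_k (r k - e * D k) ^+ 2 =
        \sum_k r k ^+ 2 - 2 * e * (\sum_k r k * D k) + e ^+ 2 * \sum_k D k ^+ 2.
      rewrite !mulr_sumr -sumrB -big_split/=; apply: eq_bigr => k _; ring.
    rewrite -/r /S /Q; lra.
  have S0 : S <= 0.
    rewrite leNgt; apply/negP => S0.
    have Q0 : 0 <= Q by rewrite addr_ge0 ?sqr_ge0// sumr_ge0// => k _; rewrite sqr_ge0.
    (* This [e] lies in ]0, 1] and turns [2 * S <= e * Q] into 2 S (S + Q) <= S Q, absurd for
       positive [S]. *)
    pose e := S / (S + Q).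
    have SQ : 0 < S + Q by rewrite ltr_pwDl.
    have e0 : 0 < e by rewrite divr_gt0.
    have e1 : e <= 1 by rewrite ler_pdivrMr// mul1r lerDl.
    have := Sle e; rewrite e0 e1 => /(_ isT).
    move=> h; have : 2 * S * (S + Q) <= S * Q by rewrite -ler_pdivlMr// mulrAC.
    have : 0 < S * S by rewrite mulr_gt0.
    have : 0 <= S * Q by rewrite mulr_ge0// ltW.
    lra.
  rewrite -subr_le0 (le_trans _ S0)// le_eqVlt; apply/orP; left; apply/eqP.
  rewrite /m /S /D /g.
  have -> : t * (B + t) = t * mean w c.
    (* [t] is the positive part of [mean w c - B], hence its square is its product with that
       number. *)
    have tt : t ^+ 2 = t * (mean w c - B) by exact: pos_sqr.
    by rewrite mulrDr -expr2 tt; ring.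
  have -> : \sum_k r k * (b k - r k) = \sum_k r k * mean w (a^~ k).
    by apply: eq_bigr => k _; rewrite /r /res opprB addrCA subrr addr0.
  have -> : \sum_k r k * (a t0 k - mean w (a^~ k)) =
      \sum_k r k * a t0 k - \sum_k r k * mean w (a^~ k).
    by rewrite -sumrB; apply: eq_bigr => k _; rewrite mulrBr.
  by ring.
have rsum : \sum_k r k * (b k - r k) = \sum_k r k * b k - \sum_k r k ^+ 2.
  by rewrite -sumrB; apply: eq_bigr => k _; rewrite mulrBr expr2.
have r2 : 0 <= \sum_k r k ^+ 2 by apply: sumr_ge0 => k _; exact: sqr_ge0.
have t_ge0 : 0 <= t by exact: pos_ge0.
have [t0|t0] := eqVneq t 0.
  have : \sum_k r k * b k <= m.
    by apply: H0 => t1; have := first_order t1; rewrite t0 mul0r subr0.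
  rewrite /m t0 mul0r subr0 rsum => h.
  have /eqP : \sum_k r k ^+ 2 = 0 by apply/eqP; rewrite eq_le r2 andbT; lra.
  rewrite psumr_eq0 => [/allP r0|k _]; last exact: sqr_ge0.
  exists w; split => // [k|].
    have := r0 k (mem_index_enum _); rewrite sqrf_eq0 /r /res subr_eq0 => /eqP ->.
    by [].
  move: t0; rewrite /t /exc /pos => /eqP; rewrite mulf_eq0 invr_eq0 pnatr_eq0 orbF.
  rewrite addr_eq0 => /eqP h0; have := normr_ge0 (mean w c - B); rewrite h0 oppr_ge0.
  by rewrite subr_le0.
have tp : 0 < t by rewrite lt_neqAle eq_sym t0.
have : \sum_k (r k / t) * b k <= B + m / t.
  apply: H1 => t1; rewrite -(ler_pM2l tp) mulr_sumr.
  rewrite (eq_bigr (fun k => r k * a t1 k)) => [|k _]; last by field.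
  rewrite mulrDr (mulrC _ (m / t)) divfK//; have := first_order t1; lra.
rewrite -(ler_pM2l tp) mulr_sumr (eq_bigr (fun k => r k * b k)) => [|k _]; last by field.
rewrite mulrDr (mulrC _ (m / t)) divfK// /m rsum => h.
have : 0 < t * t by rewrite mulr_gt0.
nra.
Qed.

End finite_duality.

(** * Gauges of convex bodies *)

Section dot.
Variables (R : realType) (n : nat).
Implicit Types u v w x y : 'rV[R]_n.

Lemma dotC u v : dot u v = dot v u.
Proof. by apply: eq_bigr => i _; rewrite mulrC. Qed.

Lemma dotDl u v w : dot (u + v) w = dot u w + dot v w.
Proof. by rewrite /dot -big_split; apply: eq_bigr => i _; rewrite mxE mulrDl. Qed.

Lemma dotDr u v w : dot w (u + v) = dot w u + dot w v.
Proof. by rewrite dotC dotDl !(dotC w). Qed.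

Lemma dotZl a u v : dot (a *: u) v = a * dot u v.
Proof. by rewrite -[v in LHS]scale1r dotZ mulr1. Qed.

Lemma dotZr a u v : dot u (a *: v) = a * dot u v.
Proof. by rewrite dotC dotZl dotC. Qed.

Lemma dotNl u v : dot (- u) v = - dot u v.
Proof. by rewrite -scaleN1r dotZl mulN1r. Qed.

Lemma dotNr u v : dot u (- v) = - dot u v.
Proof. by rewrite dotC dotNl dotC. Qed.

Lemma dotBl u v w : dot (u - v) w = dot u w - dot v w.
Proof. by rewrite dotDl dotNl. Qed.

Lemma dotBr u v w : dot w (u - v) = dot w u - dot w v.
Proof. by rewrite dotDr dotNr. Qed.

Lemma dot0l u : dot 0 u = 0.
Proof. by rewrite -(scale0r 0) dotZl mul0r. Qed.

Lemma dot_delta u i : dot u (delta_mx 0 i) = u 0 i.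
Proof.
rewrite /dot (bigD1 i)//= mxE !eqxx mulr1 big1 ?addr0// => j ji.
by rewrite mxE (negbTE ji) andbF mulr0.
Qed.

Lemma dotE u : dot u u = enorm u ^+ 2.
Proof. by rewrite sqr_sqrtr// dot_ge0. Qed.

Lemma enormN u : enorm (- u) = enorm u.
Proof. by rewrite -scaleN1r enormZ normrN normr1 mul1r. Qed.

Lemma enorm_eq0 u : (enorm u == 0) = (u == 0).
Proof.
apply/idP/idP => [|/eqP ->]; last by rewrite enorm0.
by apply: contraTT => /enorm_gt0; rewrite lt_neqAle eq_sym => /andP[].
Qed.

Lemma dot_le u v : dot u v <= enorm u * enorm v.
Proof.
have [->|u0] := eqVneq u 0; first by rewrite dot0l enorm0 mul0r.
have [->|v0] := eqVneq v 0; first by rewrite dotC dot0l enorm0 mulr0.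
have pu := enorm_gt0 u0; have pv := enorm_gt0 v0.
have := dot_ge0 ((enorm v) *: u - (enorm u) *: v).
rewrite dotBl !dotBr !dotZ (dotC v u) !dotE => h.
have : 0 <= 2 * (enorm u * enorm v) * (enorm u * enorm v - dot u v) by lra.
by rewrite pmulr_rge0 ?subr_ge0// !mulr_gt0.
Qed.

Lemma unit_sphere_neq0 u : unit_sphere u -> u != 0.
Proof. by move=> u1; rewrite -enorm_eq0 (u1 : enorm u = 1) oner_eq0. Qed.

Lemma radial_proj_unit x : x != 0 -> unit_sphere (radial_proj x).
Proof.
move=> x0; rewrite /unit_sphere/= /radial_proj enormZ ger0_norm ?invr_ge0 ?enorm_ge0//.
by rewrite mulVf// enorm_eq0.
Qed.

Lemma enorm_le_sum u : enorm u <= \sum_i `|u 0 i|.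
Proof.
have s0 : 0 <= \sum_i `|u 0 i| by exact: sumr_ge0.
rewrite -(ger0_norm s0) -sqrtr_sqr ler_sqrt ?sqr_ge0// /dot.
rewrite expr2 mulr_suml; apply: ler_sum => i _.
rewrite (le_trans (ler_norm _))// normrM ler_wpM2l//.
by rewrite (bigD1 i)//= lerDl sumr_ge0.
Qed.
End dot.

Section gauge.
Variables (R : realType) (n : nat) (K : sym_convex_body R n).
Local Notation C := (body_set K).
Implicit Types (u v x y p : 'rV[R]_n).

Lemma body_inner_ball : exists2 r : R, 0 < r & forall x, enorm x <= r -> C x.
Proof.
have [x0] := body_interior K; rewrite /interior => /nbhs_ballP[e /= e0 eC].
(* [x] is the midpoint of [x0 + 2 *: x] and [- x0]; the factor 1/4 keeps the first point within [e]
   of [x0]. *)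
exists (e / 4); first by rewrite divr_gt0.
move=> x xe.
have C1 : C (x0 + 2 *: x).
  apply: eC; split => // i j; rewrite ord1 /ball/= !mxE opprD addrA subrr sub0r normrN.
  rewrite normrM ger0_norm//.
  have := le_trans (coord_le_enorm x j) xe; lra.
have h0 : 0 <= (2 : R)^-1 by lra.
have h1 : (2 : R)^-1 <= 1 by lra.
have := body_conv h0 h1 C1 (body_sym (interior_subset (_ : interior C x0))).
have -> : 2^-1 *: (x0 + 2 *: x) + (1 - 2^-1) *: - x0 = x.
  rewrite scalerDr scalerA mulVf// scale1r scalerN addrAC.
  rewrite (_ : 1 - 2^-1 = 2^-1 :> R); last by lra.
  by rewrite subrr add0r.
apply; apply/nbhs_ballP; exists e => //.
Qed.

(** The Minkowski functional of [C]. At the origin it has the right value 0, since the radial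
    function and the inverse both take the value 0 there. *)
Definition gauge x : R := (radial_fun C x)^-1.

Lemma radial_fun_gt0 x : x != 0 -> 0 < radial_fun C x.
Proof.
move=> x0; have [r r0 rC] := body_inner_ball.
have e0 := enorm_gt0 x0.
apply: (@lt_le_trans _ _ (r / enorm x)); first by rewrite divr_gt0.
apply/radial_funP => //; first by rewrite divr_gt0.
by apply: rC; rewrite enormZ ger0_norm ?divfK ?gt_eqF// divr_ge0 ?ltW.
Qed.

Lemma gauge0 : gauge 0 = 0.
Proof. by rewrite /gauge radial_fun0 invr0. Qed.

Lemma gauge_gt0 x : x != 0 -> 0 < gauge x.
Proof. by move=> x0; rewrite invr_gt0 radial_fun_gt0. Qed.

Lemma gaugeP a x : 0 < a -> (gauge x <= a) <-> C (a^-1 *: x).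
Proof.
move=> a0; have [->|x0] := eqVneq x 0.
  by rewrite gauge0 scaler0 ltW//; split => // _; exact: body0.
rewrite /gauge invf_ple ?posrE ?radial_fun_gt0//.
by apply: radial_funP; rewrite ?invr_gt0.
Qed.

Lemma gauge_body x : (gauge x <= 1) <-> C x.
Proof. by rewrite (gaugeP _ ltr01) invr1 scale1r. Qed.

Lemma gauge_le a x : 0 < a -> C (a^-1 *: x) -> gauge x <= a.
Proof. by move=> a0; move/gaugeP; exact. Qed.

Lemma gauge_mem a x : gauge x <= a -> 0 < a -> C (a^-1 *: x).
Proof. by move=> + a0; move/gaugeP; exact. Qed.

Lemma gaugeZ t x : 0 <= t -> gauge (t *: x) = t * gauge x.
Proof.
rewrite le_eqVlt => /predU1P[<-|t0]; first by rewrite scale0r gauge0 mul0r.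
have H s y : 0 < s -> gauge (s *: y) <= s * gauge y.
  move=> s0; have [->|y0] := eqVneq y 0; first by rewrite scaler0 gauge0 mulr0.
  have gy := gauge_gt0 y0.
  apply: gauge_le; first by rewrite mulr_gt0.
  rewrite scalerA invfM mulrAC mulVf ?gt_eqF// mul1r.
  exact: gauge_mem.
apply/eqP; rewrite eq_le H//= -ler_pdivlMl//.
have ti : 0 < t^-1 by rewrite invr_gt0.
by have := H _ (t *: x) ti; rewrite scalerA mulVf ?gt_eqF// scale1r.
Qed.

Lemma gaugeN x : gauge (- x) = gauge x.
Proof.
have H y : gauge (- y) <= gauge y.
  have [->|y0] := eqVneq y 0; first by rewrite oppr0.
  have gy := gauge_gt0 y0.
  apply: gauge_le => //; rewrite scalerN; apply: body_sym; exact: gauge_mem.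
by apply/eqP; rewrite eq_le H/= -{1}[x]opprK H.
Qed.

Lemma gaugeD x y : gauge (x + y) <= gauge x + gauge y.
Proof.
have [->|x0] := eqVneq x 0; first by rewrite add0r gauge0 add0r.
have [->|y0] := eqVneq y 0; first by rewrite addr0 gauge0 addr0.
have gx := gauge_gt0 x0; have gy := gauge_gt0 y0.
have gxy : 0 < gauge x + gauge y by rewrite addr_gt0.
apply: gauge_le => //.
pose t := gauge x / (gauge x + gauge y).
have t0 : 0 <= t by rewrite divr_ge0// ltW.
have t1 : t <= 1 by rewrite ler_pdivrMr// mul1r lerDl ltW.
have := body_conv t0 t1 (gauge_mem (lexx _) gx) (gauge_mem (lexx _) gy).
rewrite !scalerA (_ : t * _ = (gauge x + gauge y)^-1); last first.
  by rewrite /t mulrAC divff ?mul1r// gt_eqF.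
rewrite (_ : (1 - t) * _ = (gauge x + gauge y)^-1); last first.
  by rewrite /t; field; rewrite !gt_eqF.
by rewrite -scalerDr.
Qed.

Lemma gauge_conv t x y : 0 <= t <= 1 ->
  gauge (t *: x + (1 - t) *: y) <= t * gauge x + (1 - t) * gauge y.
Proof.
by move=> /andP[t0 t1]; rewrite (le_trans (gaugeD _ _))// !gaugeZ// subr_ge0.
Qed.

Lemma gauge_bounds : exists r M : R, [/\ 0 < r, 0 < M,
  forall x, gauge x <= enorm x / r & forall x, enorm x <= M * gauge x].
Proof.
have [r r0 rC] := body_inner_ball; have [M M0 CM] := body_bounded K.
exists r, M; split => // x; have [->|x0] := eqVneq x 0;
  rewrite ?gauge0 ?enorm0 ?mul0r ?mulr0//; have e0 := enorm_gt0 x0; have g0 := gauge_gt0 x0.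
  apply: gauge_le; first by rewrite divr_gt0.
  apply: rC; rewrite enormZ ger0_norm ?invr_ge0 ?divr_ge0 ?(ltW e0) ?(ltW r0)//.
  by rewrite invf_div divfK ?gt_eqF.
have gi : 0 <= (gauge x)^-1 by rewrite invr_ge0 ltW.
by have := CM _ (gauge_mem (lexx _) g0); rewrite enormZ ger0_norm// mulrC ler_pdivrMr.
Qed.

Lemma gauge_continuous : continuous gauge.
Proof.
have [r [M [r0 M0 gr _]]] := gauge_bounds.
move=> x; apply/(@cvgrPdist_le _ _ _ (nbhs x)) => e e0.
have : enorm (y - x) @[y --> x] --> enorm (x - x).
  apply: (@continuous_comp _ _ _ (fun y => y - x) (@enorm R n)); last exact: enorm_continuous.
  by apply: (@cvgB _ _ _ (nbhs x)); [exact: cvg_id|exact: cvg_cst].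
rewrite subrr enorm0 => /(@cvgrPdist_le _ _ _ (nbhs x)) /(_ (e * r)); rewrite mulr_gt0// => /(_ isT).
apply: (@filterS _ (nbhs x)) => y; rewrite sub0r normrN ger0_norm ?enorm_ge0// => yx.
have H z w : gauge z - gauge w <= enorm (w - z) / r.
  rewrite -enormN opprB (le_trans _ (gr _))// lerBlDr.
  by rewrite -{1}(subrK w z) gaugeD.
rewrite ler_norml; apply/andP; split.
  rewrite lerNl opprB (le_trans (H _ _))// ler_pdivrMr//.
  by rewrite -enormN opprB.
by rewrite (le_trans (H _ _))// ler_pdivrMr.
Qed.

Definition subgradient p x := forall y, gauge x + dot p (y - x) <= gauge y.

Lemma subgradient_dot p x : subgradient p x -> dot p x = gauge x.
Proof.
move=> px; apply/eqP; rewrite eq_le; apply/andP; split.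
  have := px (2 *: x); rewrite gaugeZ// (_ : 2 *: x - x = x); first by lra.
  by rewrite -[X in _ - X]scale1r -scalerBl (_ : 2 - 1 = 1 :> R) ?scale1r//; lra.
by have := px 0; rewrite gauge0 sub0r dotNr subr_le0.
Qed.

Lemma subgradient_le p x y : subgradient p x -> dot p y <= gauge y.
Proof.
move=> px; have := px y; rewrite dotBr (subgradient_dot px); lra.
Qed.

(* The points where some partial derivative of the gauge jumps over [q1, q2]. *)
Definition kink i (q : rat * rat) : set 'rV[R]_n :=
  [set x | forall h : R, 0 < h ->
    gauge x - gauge (x - h *: delta_mx 0 i) <= ratr q.1 * h /\
    ratr q.2 * h <= gauge (x + h *: delta_mx 0 i) - gauge x].

(** Ranging over rational pairs makes the complement a countable union of closed null sets, so the
    set is Borel and of full volume. *)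
Definition smooth_points : set 'rV[R]_n :=
  [set x | x != 0 /\ forall i q, q.1 < q.2 -> ~ kink i q x].

End gauge.

(** Slopes of a convex function are monotone, so the supremum of the left slopes is at most the
    infimum of the right ones. A gap between them would contain two rationals, against the
    hypothesis; the common value [p] gives a global lower bound and a local upper expansion. *)
Lemma convex_derivable (R : realType) (f : R -> R) :
  (forall t x y, 0 <= t <= 1 -> f (t * x + (1 - t) * y) <= t * f x + (1 - t) * f y) ->
  (forall q : rat * rat, q.1 < q.2 -> ~ forall h, 0 < h ->
     f 0 - f (- h) <= ratr q.1 * h /\ ratr q.2 * h <= f h - f 0) ->
  exists p, (forall h, p * h <= f h - f 0) /\
    forall e, 0 < e -> exists2 d, 0 < d & forall h, `|h| <= d -> f h - f 0 <= p * h + e * `|h|.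
Proof.
move=> cf nk.
have slope h k : 0 < h -> 0 < k -> (f 0 - f (- k)) / k <= (f h - f 0) / h.
  move=> h0 k0; rewrite ler_pdivrMr// mulrAC ler_pdivlMr//.
  have hk : 0 < h + k by rewrite addr_gt0.
  have t01 : 0 <= h / (h + k) <= 1.
    by rewrite divr_ge0 ?(ltW h0) ?(ltW hk)//= ler_pdivrMr// mul1r lerDl ltW.
  have := cf _ (- k) h t01.
  rewrite (_ : h / (h + k) * - k + (1 - h / (h + k)) * h = 0); last by field; rewrite gt_eqF.
  rewrite -(ler_pM2l hk) => H.
  have : (h + k) * (h / (h + k) * f (- k) + (1 - h / (h + k)) * f h) = h * f (- k) + k * f h.
    by field; rewrite gt_eqF.
  lra.
have mono h k : 0 < h -> h <= k -> (f h - f 0) * k <= (f k - f 0) * h.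
  move=> h0 hk; have k0 : 0 < k by exact: lt_le_trans hk.
  have t01 : 0 <= h / k <= 1 by rewrite divr_ge0 ?(ltW h0) ?(ltW k0)//= ler_pdivrMr// mul1r.
  have := cf _ k 0 t01; rewrite mulr0 addr0 divfK ?gt_eqF// -(ler_pM2l k0) => H.
  have : k * (h / k * f k + (1 - h / k) * f 0) = h * f k + (k - h) * f 0.
    by field; rewrite gt_eqF.
  lra.
have monoN h k : 0 < h -> h <= k -> (f 0 - f (- k)) * h <= (f 0 - f (- h)) * k.
  move=> h0 hk; have k0 : 0 < k by exact: lt_le_trans hk.
  have t01 : 0 <= h / k <= 1 by rewrite divr_ge0 ?(ltW h0) ?(ltW k0)//= ler_pdivrMr// mul1r.
  have := cf _ (- k) 0 t01; rewrite mulr0 addr0 mulrN divfK ?gt_eqF// -(ler_pM2l k0) => H.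
  have : k * (h / k * f (- k) + (1 - h / k) * f 0) = h * f (- k) + (k - h) * f 0.
    by field; rewrite gt_eqF.
  lra.
pose Rs := [set (f h - f 0) / h | h in [set h | 0 < h]].
pose Ls := [set (f 0 - f (- h)) / h | h in [set h | 0 < h]].
have Rs0 : Rs !=set0 by exists ((f 1 - f 0) / 1); exists 1 => //=.
have Ls0 : Ls !=set0 by exists ((f 0 - f (- 1)) / 1); exists 1 => //=.
have RL x y : Ls x -> Rs y -> x <= y.
  by move=> [k k0 <-] [h h0 <-]; exact: slope.
have hiR : has_inf Rs.
  by split => //; have [l Ll] := Ls0; exists l => y; exact: RL.
have hsL : has_sup Ls.
  by split => //; have [r Rr] := Rs0; exists r => y Ly; exact: RL.
pose p := inf Rs; pose p' := sup Ls.
have p'p : p' <= p.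
  by apply: lb_le_inf => // y Ry; apply: ge_sup => // x Lx; exact: RL.
have pR h : 0 < h -> p * h <= f h - f 0.
  move=> h0; rewrite -ler_pdivlMr//; apply: ge_inf; first by case: hiR.
  by exists h.
have pL h : 0 < h -> f 0 - f (- h) <= p' * h.
  move=> h0; rewrite -ler_pdivrMr//; apply: ub_le_sup; first by case: hsL.
  by exists h.
have pp : p' = p.
  apply/eqP; rewrite eq_le p'p/= leNgt; apply/negP => lt.
  have [q1 q1p] := rat_in_itvoo lt.
  have q1p2 : ratr q1 < p by move: q1p; rewrite in_itv/= => /andP[].
  have [q2 q2p] := rat_in_itvoo q1p2.
  move: q1p q2p; rewrite !in_itv/= => /andP[a1 a2] /andP[b1 b2].
  apply: (nk (q1, q2)); first by rewrite /= -(ltr_rat R).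
  move=> h h0 /=; split; first by rewrite (le_trans (pL _ h0))// ler_pM2r// ltW.
  by rewrite (le_trans _ (pR _ h0))// ler_pM2r// ltW.
exists p; split.
  move=> h; have [h0|h0|->] := ltrgt0P h; [exact: pR| |by rewrite mulr0 subrr].
  have := pL (- h); rewrite oppr_gt0 opprK => /(_ h0); rewrite pp; lra.
move=> e e0.
have [_ [h0 /= h0p <-] H0] := inf_adherent e0 hiR.
have [_ [k0 /= k0p <-] H1] := sup_adherent e0 hsL.
exists (Num.min h0 k0); first by rewrite lt_min h0p.
move=> h; rewrite le_min.
have [hp|hn|->] := ltrgt0P h => /andP[hh hk]; last by rewrite !mulr0 subrr addr0.
  have := mono _ _ hp hh; rewrite -ler_pdivlMr// => /le_trans; apply.
  by rewrite mulrAC -[leRHS]mulrDl ler_pM2r// ltW.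
have np : 0 < - h by rewrite oppr_gt0.
have := monoN _ _ np hk; rewrite opprK -ler_pdivrMr// => H2.
have : (p' - e) * (- h) <= (f 0 - f (- k0)) / k0 * (- h) by rewrite ler_pM2r// ltW.
rewrite pp; move: H2; rewrite mulrAC; lra.
Qed.

Section smooth.
Variables (R : realType) (n : nat) (K : sym_convex_body R n).
Local Notation C := (body_set K).
Local Notation g := (gauge K).
Implicit Types (u v x y p : 'rV[R]_n).

Lemma closed_kink i q : closed (kink K i q).
Proof.
have cs (s : R) : continuous (fun x => g (x + s *: delta_mx 0 i)).
  move=> x; apply: (@continuous_comp _ _ _ (fun y => y + s *: delta_mx 0 i) g).
    by apply: (@cvgD _ _ _ (nbhs x)); [exact: cvg_id|exact: cvg_cst].
  exact: gauge_continuous.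
rewrite (_ : kink K i q = \bigcap_(h in [set h : R | 0 < h])
  ([set x | g x - g (x + (- h) *: delta_mx 0 i) <= ratr q.1 * h] `&`
   [set x | ratr q.2 * h <= g (x + h *: delta_mx 0 i) - g x])); last first.
  apply/seteqP; split => x H h h0 /=.
    by rewrite scaleNr; have [] := H h h0.
  by have /= := H h h0; rewrite scaleNr.
apply: closed_bigI => h h0; apply: closedI.
  apply: (@preimage_closed _ _ (fun x => g x - g (x + (- h) *: delta_mx 0 i)) [set y | y <= ratr q.1 * h]).
    by move=> x _; apply: (@cvgB _ _ _ (nbhs x)); [exact: gauge_continuous|exact: cs].
  exact: closed_le.
apply: (@preimage_closed _ _ (fun x => g (x + h *: delta_mx 0 i) - g x) [set y | ratr q.2 * h <= y]).
  by move=> x _; apply: (@cvgB _ _ _ (nbhs x)); [exact: cs|exact: gauge_continuous].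
exact: closed_ge.
Qed.

(** If [x] and [x + s *: delta_mx 0 i] with [0 < s] were both kinks, the slope of the gauge between
    them would be at least [q.2] seen from the first and at most [q.1] seen from the second. A line
    along the axis [i] thus meets the set at most once. *)
Lemma vol_kink i q : q.1 < q.2 -> vol (kink K i q) = 0%E.
Proof.
move=> q12; apply: (vol_line_null (i := i)).
  by apply: closed_measurable_rV; exact: closed_kink.
have q12R : ratr q.1 < ratr q.2 :> R by rewrite ltr_rat.
have H x s : 0 < s -> kink K i q x -> kink K i q (x + s *: delta_mx 0 i) -> False.
  move=> s0 /(_ _ s0)[_ h2] /(_ _ s0)[h1 _]; move: h1; rewrite addrK => h1.
  have := le_trans h2 h1; rewrite ler_pM2r//; lra.
move=> x s kx ks; have [s0|s0|//] := ltrgt0P s.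
  by have := H _ _ s0 kx ks.
have ns0 : 0 < - s by rewrite oppr_gt0.
exfalso; apply: (H _ _ ns0 ks).
by rewrite scaleNr addrK.
Qed.

Lemma gauge_sum (I : finType) (f : I -> 'rV[R]_n) : g (\sum_i f i) <= \sum_i g (f i).
Proof.
elim/big_ind2 : _ => [|x1 y1 x2 y2 h1 h2|//]; first by rewrite gauge0.
by rewrite (le_trans (gaugeD _ _ _))// lerD.
Qed.

(** The upper half of differentiability along the axes; the lower half is the subgradient
    inequality. *)
Definition partial_expansion p x := forall i e, 0 < e ->
  \forall h \near (0 : R), g (x + h *: delta_mx 0 i) <= g x + p 0 i * h + e * `|h|.

(** The vector [p] of partial derivatives is a subgradient because a convex function is controlled
    in every direction by its values along the axes. With [d] equal to [y - x], the upper expansion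
    at [x - t *: d] and sublinearity applied to (1 + t) x = (x - t d) + t y give the lower bound at
    [y]. Uniqueness follows from testing both signs along each axis. *)
Lemma smooth_expansion x : smooth_points K x ->
  exists p, [/\ partial_expansion p x, subgradient K p x &
    forall p', subgradient K p' x -> p' = p].
Proof.
move=> [x0 nk].
have Hi i : exists p : R, (forall h, p * h <= g (x + h *: delta_mx 0 i) - g x) /\
    forall e, 0 < e -> exists2 d, 0 < d & forall h, `|h| <= d ->
      g (x + h *: delta_mx 0 i) - g x <= p * h + e * `|h|.
  pose f t := g (x + t *: delta_mx 0 i).
  have f0 : f 0 = g x by rewrite /f scale0r addr0.
  have [||p [h1 h2]] := @convex_derivable R f.
  - move=> t s r t01; rewrite /f.
    rewrite (_ : x + _ = t *: (x + s *: delta_mx 0 i) + (1 - t) *: (x + r *: delta_mx 0 i)).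
      exact: gauge_conv.
    rewrite !scalerDr !scalerA addrACA -!scalerDl.
    by rewrite (_ : t + (1 - t) = 1) ?scale1r//; ring.
  - move=> q q12 H; apply: (nk i q q12) => h h0; have := H h h0.
    by rewrite f0 /f scaleNr.
  by rewrite f0 in h1 h2; exists p.
have [pf pfP] := choice Hi.
pose p := \row_i pf i; exists p.
have pexp : partial_expansion p x.
  move=> i e e0; have [d d0 H] := (pfP i).2 e e0.
  apply/nbhs_ballP; exists d => //= h; rewrite /ball/= sub0r normrN => hd.
  by have := H h (ltW hd); rewrite mxE; lra.
split => // [y|p' sp'].
  apply/ler_addgt0Pr => e e0.
  have [d dE] : exists d, d = y - x by eexists.
  rewrite -dE; pose S := \sum_i `|d 0 i|.
  have S0 : 0 <= S by exact: sumr_ge0.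
  pose e' := e / (S + 1).
  have e'0 : 0 < e' by rewrite divr_gt0// ltr_wpDl.
  have n0 : (0 < n)%N.
    case: (n) x x0 {nk Hi pfP pexp e' e'0 S S0 p pf d dE y e e0} => // x.
    by rewrite (thinmx0 x) eqxx.
  have nR : n%:R != 0 :> R by rewrite pnatr_eq0 -lt0n.
  have : \forall t \near (0 : R), forall i,
      g (x + (- (n%:R * t * d 0 i)) *: delta_mx 0 i) <=
      g x + p 0 i * (- (n%:R * t * d 0 i)) + e' * `|- (n%:R * t * d 0 i)|.
    have FF : Filter (nbhs (0 : R)) by exact: nbhs_filter.
    refine (@filter_forall _ _ (fun i t =>
      g (x + (- (n%:R * t * d 0 i)) *: delta_mx 0 i) <=
      g x + p 0 i * (- (n%:R * t * d 0 i)) + e' * `|- (n%:R * t * d 0 i)|) _ FF _) => i.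
    have ct : - (n%:R * t * d 0 i) @[t --> (0 : R)] --> (0 : R).
      rewrite [X in _ --> X](_ : 0 = - (n%:R * 0 * d 0 i)); last by rewrite mulr0 mul0r oppr0.
      apply: cvgN; apply: cvgM; last exact: cvg_cst.
      by apply: cvgM; [exact: cvg_cst|exact: cvg_id].
    exact: (ct _ (pexp i e' e'0)).
  move=> /nbhs_ballP[r /= r0 H].
  have [t t0 bt] : exists2 t : R, 0 < t & ball (0 : R) r t.
    exists (r / 2); first by rewrite divr_gt0.
    by rewrite /ball/= sub0r normrN gtr0_norm ?divr_gt0// ltr_pdivrMr// ltr_pMr// ltr1n.
  have {}H i : g (x - (n%:R * t * d 0 i) *: delta_mx 0 i) <=
      g x - n%:R * (t * (p 0 i * d 0 i)) + n%:R * (t * (e' * `|d 0 i|)).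
    have := H t bt i.
    rewrite scaleNr normrN !normrM (ger0_norm (ler0n _ _)) (gtr0_norm t0).
    by move=> /le_trans; apply; rewrite le_eqVlt; apply/orP; left; apply/eqP; ring.
  (* [x - t *: d] is the mean of [n] points, each displaced from [x] along a single axis by [n]
     times its coordinate; this explains the factor [n%:R] in the displacements. *)
  have up : g (x - t *: d) <= g x - t * dot p d + t * (e' * S).
    have -> : x - t *: d = \sum_i n%:R^-1 *: (x - (n%:R * t * d 0 i) *: delta_mx 0 i).
      rewrite -scaler_sumr sumrB sumr_const card_ord -[x *+ n]scaler_nat [in RHS]scalerBr scalerA mulVf// scale1r.
      congr (_ - _); rewrite {1}(row_sum_delta d) !scaler_sumr; apply: eq_bigr => i _.
      by rewrite !scalerA; congr (_ *: _); field.
    apply: (le_trans (gauge_sum _)).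
    under eq_bigr do rewrite gaugeZ ?invr_ge0 ?ler0n//.
    apply: (@le_trans _ _ (\sum_i n%:R^-1 * (g x - n%:R * (t * (p 0 i * d 0 i)) + n%:R * (t * (e' * `|d 0 i|))))).
      by apply: ler_sum => i _; rewrite ler_wpM2l ?invr_ge0 ?ler0n.
    rewrite -mulr_sumr !big_split/= sumrN -!mulr_sumr sumr_const card_ord -/S -/(dot p d).
    rewrite -mulr_natl.
    by rewrite le_eqVlt; apply/orP; left; apply/eqP; field.
  have tri : (1 + t) * g x <= g (x - t *: d) + t * g y.
    rewrite -!gaugeZ ?(ltW t0)//; last by rewrite addr_ge0// ltW.
    rewrite (_ : (1 + t) *: x = (x - t *: d) + t *: y) ?gaugeD//.
    by rewrite dE scalerBr scalerDl scale1r opprB addrA subrK.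
  have eS : e' * S <= e.
    by rewrite /e' mulrAC ler_pdivrMr ?ltr_wpDl// ler_pM2l// lerDl.
  have : t * (g x + dot p d) <= t * (g y + e).
    have : t * (e' * S) <= t * e by rewrite ler_pM2l.
    lra.
  by rewrite ler_pM2l.
apply/rowP => i.
have H e : 0 < e -> p' 0 i <= p 0 i + e /\ p 0 i - e <= p' 0 i.
  move=> e0; have /nbhs_ballP[r /= r0 Hr] := pexp i e e0.
  have r2 : 0 < r / 2 by rewrite divr_gt0.
  have D h : p' 0 i * h <= g (x + h *: delta_mx 0 i) - g x.
    have := sp' (x + h *: delta_mx 0 i).
    by rewrite addrAC subrr add0r dotZr dot_delta; lra.
  have := Hr (r / 2); have := Hr (- (r / 2)).
  rewrite /ball/= !sub0r opprK normrN gtr0_norm// ltr_pdivrMr// ltr_pMr// ltr1n.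
  move=> /(_ isT) h1 /(_ isT) h2.
  have d1 := D (r / 2); have d2 := D (- (r / 2)).
  split; rewrite -(ler_pM2r r2); lra.
apply/eqP; rewrite eq_le; apply/andP; split.
  by apply/ler_addgt0Pr => e /H[].
by apply/ler_addgt0Pr => e /H[]; lra.
Qed.
End smooth.

(** * Normals and spherical gradients *)

Section normal.
Variables (R : realType) (n : nat) (K : sym_convex_body R n).
Local Notation C := (body_set K).
Local Notation g := (gauge K).
Implicit Types (u v x y p : 'rV[R]_n).

Definition gauge_grad x : 'rV[R]_n := xget 0 [set p | subgradient K p x].

Lemma gauge_gradP x : smooth_points K x ->
  [/\ partial_expansion K (gauge_grad x) x, subgradient K (gauge_grad x) x &
    forall p, subgradient K p x -> p = gauge_grad x].
Proof.
move=> /smooth_expansion[p [px sp up]].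
suff -> : gauge_grad x = p by [].
by apply: up; exact: (@xgetPex _ 0 [set p | subgradient K p x] (ex_intro _ p sp)).
Qed.

Lemma subgradientP p x :
  subgradient K p x <-> dot p x = g x /\ forall y, dot p y <= g y.
Proof.
split => [px|[px py] y]; last by rewrite dotBr px; have := py y; lra.
by split=> [|y]; [exact: subgradient_dot|exact: subgradient_le px].
Qed.

Lemma kinkZ a i q x : 0 < a -> kink K i q x -> kink K i q (a *: x).
Proof.
move=> a0 kx h h0; have ha : 0 < h / a by rewrite divr_gt0.
have [h1 h2] := kx _ ha.
have e1 : a *: x - h *: delta_mx 0 i = a *: (x - (h / a) *: delta_mx 0 i).
  by rewrite scalerBr scalerA mulrCA divff ?mulr1// gt_eqF.
have e2 : a *: x + h *: delta_mx 0 i = a *: (x + (h / a) *: delta_mx 0 i).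
  by rewrite scalerDr scalerA mulrCA divff ?mulr1// gt_eqF.
rewrite e1 e2 !gaugeZ ?(ltW a0)// -!mulrBr.
have hE q0 : q0 * h = a * (q0 * (h / a)) by field; rewrite gt_eqF.
by rewrite !hE; split; rewrite ler_pM2l.
Qed.

Lemma smoothZ a x : 0 < a -> smooth_points K x -> smooth_points K (a *: x).
Proof.
move=> a0 [x0 nk]; split; first by rewrite scaler_eq0 gt_eqF//= x0.
move=> i q q12 k; apply: (nk i q q12).
have ai : 0 < a^-1 by rewrite invr_gt0.
by have := kinkZ ai k; rewrite scalerA mulVf ?gt_eqF// scale1r.
Qed.

Lemma smooth_radial x : smooth_points K x -> smooth_points K (radial_proj x).
Proof.
by move=> sx; apply: smoothZ => //; rewrite invr_gt0 enorm_gt0//; case: sx.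
Qed.

Lemma gauge_grad_neq0 x : smooth_points K x -> gauge_grad x != 0.
Proof.
move=> sx; have [_ /subgradientP[p1 _] _] := gauge_gradP sx.
apply/eqP => p0; move: p1; rewrite p0 dot0l => /esym/eqP.
by rewrite gt_eqF// gauge_gt0//; case: sx.
Qed.

Lemma has_sup_dot u : has_sup [set dot x u | x in C].
Proof.
split; first by exists (dot 0 u), 0 => //; exact: body0.
have [M M0 CM] := body_bounded K; exists (M * enorm u) => _ [x Cx <-].
by rewrite (le_trans (dot_le _ _))// ler_wpM2r ?enorm_ge0// CM.
Qed.

Lemma support_fun_ub x u : C x -> dot x u <= support_fun C u.
Proof. by move=> Cx; apply: ub_le_sup; [case: (has_sup_dot u)|exists x]. Qed.

Lemma support_fun_le u b : (forall x, C x -> dot x u <= b) -> support_fun C u <= b.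
Proof.
move=> H; apply: ge_sup; first by case: (has_sup_dot u).
by move=> _ [x Cx <-]; exact: H.
Qed.

(** A supporting hyperplane with unit normal [u], at height [c] over the boundary point, becomes the
    subgradient [c^-1 *: u] once normalised to height 1, and the subgradient at a smooth point is
    unique. An inner ball ensures that [c] is positive. *)
Lemma unit_normals_smooth x : smooth_points K x ->
  unit_normals C (radial_fun C x *: x) = [set radial_proj (gauge_grad x)].
Proof.
move=> sx; have [_ sp up] := gauge_gradP sx; have /subgradientP[p1 p2] := sp.
have x0 : x != 0 by case: sx.
have r0 := radial_fun_gt0 K x0; have g0 := gauge_gt0 K x0.
have p0 := gauge_grad_neq0 sx; have np := enorm_gt0 p0.
have rg : radial_fun C x * g x = 1 by rewrite /gauge divff ?gt_eqF.
apply/seteqP; split => [u [u1 uC]|_ ->] /=; last first.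
  split; first exact: radial_proj_unit.
  move=> y Cy; rewrite /radial_proj !dotZr ler_pM2l ?invr_gt0//.
  rewrite dotZl (dotC x) p1 rg (dotC y) (le_trans (p2 _))//.
  exact/gauge_body.
set c := dot (radial_fun C x *: x) u in uC.
have c0 : 0 < c.
  have [r rp rC] := body_inner_ball K.
  have := uC (r *: u) (rC _ _); rewrite enormZ gtr0_norm// (u1 : enorm u = 1) mulr1 => /(_ (lexx _)).
  by apply: lt_le_trans; rewrite dotZl dotE (u1 : enorm u = 1) expr1n mulr1.
have cup : c^-1 *: u = gauge_grad x.
  apply: up; apply/subgradientP; split => [|y].
    rewrite dotZl dotC /c dotZl; rewrite /c dotZl in c0.
    have d0 : dot x u != 0 by apply/eqP => d0; rewrite d0 mulr0 ltxx in c0.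
    by rewrite /gauge invfM divfK.
  have [->|y0] := eqVneq y 0; first by rewrite dotC dot0l gauge0.
  have gy := gauge_gt0 K y0.
  rewrite dotZl mulrC ler_pdivrMr//.
  have := uC _ (gauge_mem (lexx _) gy).
  by rewrite dotZl mulrC ler_pdivrMr// dotC mulrC.
rewrite -cup /radial_proj enormZ (u1 : enorm u = 1) mulr1 gtr0_norm ?invr_gt0//.
by rewrite invrK scalerA divff ?scale1r// gt_eqF.
Qed.

Lemma radial_gauss_map_smooth x : smooth_points K x ->
  radial_gauss_map C x = radial_proj (gauge_grad x).
Proof.
move=> sx; rewrite /radial_gauss_map /gauss_map.
have H : [set u | unit_normals C (radial_fun C x *: x) = [set u]] (radial_proj (gauge_grad x)).
  exact: unit_normals_smooth.
have := @xgetPex _ 0 _ (ex_intro _ _ H); rewrite /= unit_normals_smooth// => E.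
set y := xget _ _ in E *.
by have : [set radial_proj (gauge_grad x)] y by rewrite E.
Qed.

Lemma support_fun_smooth x : smooth_points K x ->
  support_fun C (radial_proj (gauge_grad x)) = (enorm (gauge_grad x))^-1.
Proof.
move=> sx; have [_ /subgradientP[p1 p2] _] := gauge_gradP sx.
have x0 : x != 0 by case: sx.
have p0 := gauge_grad_neq0 sx; have np := enorm_gt0 p0.
apply/eqP; rewrite eq_le; apply/andP; split.
  apply: support_fun_le => y Cy; rewrite dotZr -[leRHS]mulr1 ler_pM2l ?invr_gt0//.
  by rewrite dotC (le_trans (p2 _))//; exact/gauge_body.
have := support_fun_ub (radial_proj (gauge_grad x)) (gauge_mem (lexx _) (gauge_gt0 K x0)).
rewrite dotZl dotZr (dotC x) p1 mulrA mulrC mulrA divff ?mul1r// gt_eqF//.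
exact: gauge_gt0.
Qed.

Lemma is_derive_gauge x i : smooth_points K x ->
  is_derive (0 : R) 1 (fun t => g (x + t *: delta_mx 0 i)) (gauge_grad x 0 i).
Proof.
move=> sx; have [pe sp _] := gauge_gradP sx.
pose G t := g (x + t *: delta_mx 0 i).
have L : h^-1 *: ((G \o shift 0) (h *: (1 : R)) - G 0) @[h --> (0 : R)^'] --> gauge_grad x 0 i.
  apply/cvgrPdist_le => e e0; have := pe i e e0.
  move=> /nbhs_ballP[d /= d0 H]; apply/nbhs_ballP; exists d => //= h hd h0.
  have {H} := H h hd; rewrite /= addr0 /G scale0r addr0 /GRing.scale/= mulr1.
  have := sp (x + h *: delta_mx 0 i).
  rewrite addrAC subrr add0r dotZr dot_delta => h1 h2.
  set D := g (x + h *: delta_mx 0 i) - g x; set P := gauge_grad x 0 i.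
  have hn : 0 < `|h| by rewrite normr_gt0.
  rewrite -(ler_pM2l hn) -normrM mulrBr mulrA divff// mul1r.
  rewrite ler_norml /D /P; apply/andP; split; lra.
by apply: DeriveDef; [apply/cvg_ex; eexists; exact: L|exact/cvg_lim].
Qed.

Lemma sphere_grad_smooth u : 0 < ball_volume R n -> unit_sphere u -> smooth_points K u ->
  sphere_grad (potential C) u = n%:R *: ((g u)^-1 *: gauge_grad u - u).
Proof.
move=> B0 u1 su; have u0 : u != 0 by case: su.
apply/rowP => i; rewrite !mxE.
pose b := ball_volume R n.
(* Since the gauge is 1-homogeneous, [F] is the 0-homogeneous extension of the potential near [u].
   The term in [dot x x] is the logarithm of the norm, and its derivative at a unit vector yields
   the summand [- u]. *)
pose F x := - ln b + n%:R * (ln (g x) - 2^-1 * ln (dot x x)).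
have -> : 'D_(delta_mx 0 i) (potential C \o @radial_proj R n) u = 'D_(delta_mx 0 i) F u.
  apply: near_eq_derive.
  have : \forall x \near u, 0 < g x.
    by have /cvgr_gt := @gauge_continuous _ _ K u; apply; exact: gauge_gt0.
  apply: (@filterS _ (nbhs u)) => x gx.
  have x0 : x != 0 by apply/eqP => x0; rewrite x0 gauge0 ltxx in gx.
  have e0 := enorm_gt0 x0.
  have r0 : 0 < radial_fun C (radial_proj x).
    apply: radial_fun_gt0; apply: unit_sphere_neq0; exact: radial_proj_unit.
  rewrite /= /potential /radial_density lnM ?posrE ?exprn_gt0//.
  rewrite lnXn// -mulr_natl /F opprD -/b -mulrN; congr (_ + _ * _).
  have -> : radial_fun C (radial_proj x) = (g (radial_proj x))^-1 by rewrite /gauge invrK.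
  rewrite gaugeZ ?invr_ge0 ?enorm_ge0// lnV ?posrE; last by rewrite mulr_gt0// invr_gt0.
  have hr := radial_fun_gt0 K x0.
  rewrite opprK lnM ?posrE ?invr_gt0// lnV ?posrE// dotE lnXn//; lra.
pose phi t := F (u + t *: delta_mx 0 i).
have -> : 'D_(delta_mx 0 i) F u = 'D_1 phi (0 : R).
  apply: (congr1 (fun f : R -> R => lim (f h @[h --> (0 : R)^']))).
  apply/funext => h /=.
  have hE : h *: (1 : R) = h by exact: mulr1.
  by rewrite /phi hE addr0 scale0r addr0 (addrC u).
have dg := is_derive_gauge i su.
have ug : 0 < g (u + 0 *: delta_mx 0 i) by rewrite scale0r addr0 gauge_gt0.
have d1 := @is_derive1_comp R (@ln R) (fun t => g (u + t *: delta_mx 0 i)) 0 _ _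
  (is_derive1_ln ug) dg.
pose q t : R := 1 + (2 * u 0 i * t + t ^+ 2).
have qE t : dot (u + t *: delta_mx 0 i) (u + t *: delta_mx 0 i) = q t.
  rewrite dotDl !dotDr dotZ dotZl dotZr (dotC (delta_mx 0 i) u) !dot_delta dotE (u1 : enorm u = 1).
  by rewrite mxE !eqxx /q /=; ring.
have dq : is_derive (0 : R) 1 q (2 * u 0 i).
  have dX : is_derive (0 : R) 1 (fun t : R => t ^+ 2) 0.
    have d := @is_deriveX R _ id 2 _ _ _ (is_derive_id (0 : R) 1).
    rewrite (_ : (fun t : R => t ^+ 2) = (id : R -> R) ^+ 2) //.
    apply: is_derive_eq d _.
    by rewrite /GRing.scale/= ?expr1 ?mulr0 ?mul0r ?mul0rn ?mulr0 ?mul0r.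
  have d := is_deriveD (is_derive_cst (1 : R) (0 : R) 1)
    (is_deriveD (is_deriveZ (2 * u 0 i) (is_derive_id (0 : R) 1)) dX).
  apply: is_derive_eq d _.
  by rewrite add0r addr0 /GRing.scale/= mulr1.
have q0 : 0 < q 0 by rewrite /q mulr0 expr0n/= !addr0.
have d2 := @is_derive1_comp R (@ln R) q 0 _ _ (is_derive1_ln q0) dq.
have : is_derive (0 : R) 1 phi (n%:R * ((g u)^-1 * gauge_grad u 0 i - u 0 i)).
  have d := is_deriveD (is_derive_cst (- ln b) (0 : R) 1)
    (is_deriveZ n%:R (is_deriveB d1 (is_deriveZ 2^-1 d2))).
  rewrite (_ : phi = (cst (- ln b) + n%:R \*: ((@ln R \o (fun t => g (u + t *: delta_mx 0 i))) -
     2^-1 \*: (@ln R \o q)))).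
    apply: is_derive_eq d _.
    have sE (a c : R) : a *: c = a * c by [].
    rewrite add0r !sE scale0r addr0 /q mulr0 expr0n/= !addr0 invr1.
    by congr (_ * _); field; rewrite gt_eqF// gauge_gt0.
  by apply/funext => t; rewrite /phi /F qE.
by move=> /@derive_val.
Qed.
End normal.

Section smooth_null.
Variables (R : realType) (n : nat) (K : sym_convex_body R n.+1).
Local Notation C := (body_set K).

Let kinks k : set 'rV[R]_n.+1 :=
  match (unpickle k : option ('I_n.+1 * (rat * rat))) with
  | Some (i, q) => if q.1 < q.2 then kink K i q else set0
  | None => set0 end.

Let measurable_kinks k : measurable (kinks k).
Proof.
rewrite /kinks; case: unpickle => [[i q]|//]; case: ifPn => // _.
by apply: closed_measurable_rV; exact: closed_kink.
Qed.

Let kinks_null k : vol (kinks k) = 0%E.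
Proof.
by rewrite /kinks; case: unpickle => [[i q]|]; rewrite ?measure0//; case: ifPn => // /vol_kink.
Qed.

Lemma smooth_pointsC : ~` smooth_points K = [set 0] `|` \bigcup_k kinks k.
Proof.
apply/seteqP; split => x.
  move=> nx; have [->|x0] := eqVneq x 0; [by left|right].
  apply: contrapT => nk; apply: nx; split => // i q q12 k.
  by apply: nk; exists (pickle (i, q)) => //; rewrite /kinks pickleK q12.
move=> [-> [/eqP//]|[k _]]; rewrite /kinks; case: unpickle => // -[i q].
by case: ifPn => // q12 kx [_ nk]; exact: (nk i q).
Qed.

Lemma measurable_smooth_points : measurable (smooth_points K).
Proof.
rewrite -[smooth_points K]setCK; apply: measurableC; rewrite smooth_pointsC.
apply: measurableU; last exact: bigcup_measurable.
apply: closed_measurable_rV; apply: compact_closed; [exact: norm_hausdorff|exact: compact_set1].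
Qed.

Lemma vol_smooth_pointsC : vol (~` smooth_points K) = 0%E.
Proof.
have m0 : measurable [set (0 : 'rV[R]_n.+1)].
  by apply: closed_measurable_rV; apply: compact_closed; [exact: norm_hausdorff|exact: compact_set1].
apply/eqP; rewrite eq_le measure_ge0 andbT smooth_pointsC.
apply: le_trans; first by apply: measureU2 => //; exact: bigcup_measurable.
rewrite [X in (X + _)%E](_ : _ = 0%E) ?add0e; last first.
  apply: (vol_line_null (i := ord0)) => // x s -> /rowP /(_ ord0).
  by rewrite !mxE/= mulr1 add0r.
apply: le_trans.
  by apply: (measure_sigma_subadditive _ measurable_kinks) => //; exact: bigcup_measurable.
by rewrite eseries0// => k _ _; exact: kinks_null.
Qed.

(** By Euler's relation [dot p u = g u], the vector p / g(u) - u is orthogonal to the unit vector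
    [u]; Pythagoras supplies the 1. *)
Lemma enorm_sphere_grad u : 0 < ball_volume R n.+1 -> unit_sphere u -> smooth_points K u ->
  1 + enorm (sphere_grad (potential C) u) ^+ 2 / n.+1%:R ^+ 2 =
  (enorm (gauge_grad K u) / gauge K u) ^+ 2.
Proof.
move=> B0 u1 su; rewrite sphere_grad_smooth// enormZ exprMn.
have g0 : 0 < gauge K u by apply: gauge_gt0; case: su.
have [_ /subgradientP[p1 _] _] := gauge_gradP su.
rewrite ger0_norm ?ler0n// mulrAC divff ?mul1r; last by rewrite expf_neq0// pnatr_eq0.
rewrite -dotE dotBl !dotBr dotZ !dotZl !dotZr (dotC u) p1 !dotE (u1 : enorm u = 1).
by field; rewrite gt_eqF.
Qed.
End smooth_null.

(** * Polar coordinates *)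

Lemma mnormalize_mrestrE d (T : measurableType d) (R : realType)
    (mu : {measure set T -> \bar R}) (P : probability T R) (D : set T) (mD : measurable D) :
  (0 < mu D)%E -> (mu D < +oo)%E ->
  forall A, (mu D * mnormalize (mrestr mu mD) P A = mu (A `&` D))%E.
Proof.
move=> D0 Doo A; rewrite /mnormalize /= /mrestr setTI ifF; last first.
  apply/negbTE; rewrite negb_or; apply/andP.
  by split; apply/eqP => h; [move: D0|move: Doo]; rewrite h ltxx.
have Df : mu D \is a fin_num by rewrite ge0_fin_numE.
rewrite muleCA -[X in (_ * (X * _))%E](fineK Df) -EFinM divff ?mule1//.
by rewrite fine_eq0// gt_eqF.
Qed.

Lemma vol_body_gt0 (R : realType) n (K : sym_convex_body R n) : (0 < vol K)%E.
Proof. by apply: vol_interior_gt0; [exact: measurable_body|exact: body_interior]. Qed.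

Lemma vol_body_lty (R : realType) n (K : sym_convex_body R n) : (vol K < +oo)%E.
Proof.
have [M _ CM] := body_bounded K.
by apply: (@vol_bounded _ _ _ M); [exact: measurable_body|].
Qed.

Section polar_coordinates.
Variables (R : realType) (n : nat).
Local Notation V := 'rV[R]_n.+1.
Local Notation pi := (@radial_proj R n.+1).
Local Notation B := (@unit_ball R n.+1).
Local Notation S := (@unit_sphere R n.+1).
Local Notation beta := (ball_volume R n.+1).

Lemma vol_ball_lty : (@vol R n.+1 B < +oo)%E.
Proof. by apply: (@vol_bounded _ _ _ 1); [exact: measurable_unit_ball|]. Qed.

Lemma ball_volumeE : @vol R n.+1 B = beta%:E.
Proof. by rewrite fineK// ge0_fin_numE ?vol_ball_lty. Qed.

Lemma ball_volume_gt0 : 0 < beta.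
Proof.
rewrite -lte_fin -ball_volumeE; apply: vol_interior_gt0; first exact: measurable_unit_ball.
exists 0; apply/nbhs_ballP; exists (n.+1%:R^-1) => /=; first by rewrite invr_gt0.
move=> y [_ h]; rewrite /unit_ball/= (le_trans (enorm_le_sum _))//.
apply: (@le_trans _ _ (\sum_(i < n.+1) n.+1%:R^-1)).
  by apply: ler_sum => i _; have := h ord0 i; rewrite /ball/= mxE sub0r normrN => /ltW.
by rewrite sumr_const card_ord -[leLHS]mulr_natr mulVf// pnatr_eq0.
Qed.

Lemma uniform_onE (D : set V) (mD : measurable D) : (0 < vol D)%E -> (vol D < +oo)%E ->
  forall A, (vol D * uniform_on mD A = vol (A `&` D))%E.
Proof.
by move=> D0 Doo A; exact: mnormalize_mrestrE.
Qed.

Lemma measurable_radial_preimage (A : set V) : measurable A -> measurable (pi @^-1` A).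
Proof.
by move=> mA; rewrite -[X in measurable X]setTI; exact: (@measurable_radial_proj R n.+1).
Qed.

Lemma radial_proj0 : pi 0 = 0.
Proof. by rewrite /radial_proj scaler0. Qed.

Lemma radial_projZ a x : 0 < a -> pi (a *: x) = pi x.
Proof.
move=> a0; rewrite /radial_proj enormZ gtr0_norm// scalerA invfM mulrAC.
by rewrite mulVf ?mul1r// gt_eqF.
Qed.

Section body.
Variable (K : sym_convex_body R n.+1).
Local Notation C := (body_set K).
Local Notation rho := (radial_fun C).

Lemma body_radial_le x : x != 0 -> C x <-> enorm x <= rho (pi x).
Proof.
move=> x0; have e0 := enorm_gt0 x0.
have p0 : pi x != 0 by apply: unit_sphere_neq0; exact: radial_proj_unit.
have xE : enorm x *: pi x = x.
  by rewrite /radial_proj scalerA divff ?scale1r// gt_eqF.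
by rewrite -{1}xE; split => /(radial_funP K e0 p0).
Qed.

(** Over the directions in [A], the body lies between the dilates of the ball by [a] and by [b]. *)
Lemma sector_bounds A a b : measurable A -> A `<=` S -> 0 < a -> 0 < b ->
  (forall u, A u -> a <= rho u <= b) ->
  ((a ^+ n.+1)%:E * vol (pi @^-1` A `&` B) <= vol (pi @^-1` A `&` C) /\
   vol (pi @^-1` A `&` C) <= (b ^+ n.+1)%:E * vol (pi @^-1` A `&` B))%E.
Proof.
move=> mA AS a0 b0 Aab.
have mpA := measurable_radial_preimage mA.
have A0 x : A (pi x) -> x != 0.
  move=> Ax; apply/eqP => x0; rewrite x0 radial_proj0 in Ax.
  by have := unit_sphere_neq0 (AS _ Ax); rewrite eqxx.
have mAC : measurable (pi @^-1` A `&` C) by apply: measurableI => //; exact: measurable_body.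
have mAB : measurable (pi @^-1` A `&` B) by apply: measurableI => //; exact: measurable_unit_ball.
have ms c (D : set V) : measurable D -> measurable ((fun x : V => c *: x) @^-1` D).
  move=> mD; rewrite -[X in measurable X]setTI.
  by apply: (measurable_rV_coords (@scaler_continuous _ _ c)).
split.
  rewrite -(volZ a0 mAC); apply: lee_pmul => //; first by rewrite lee_fin exprn_ge0// ltW.
  apply: vol_le => //; first exact: ms.
  move=> x [Ax Bx] /=; rewrite radial_projZ//; split => //.
  have x0 := A0 _ Ax.
  apply/body_radial_le; first by rewrite scaler_eq0 negb_or gt_eqF.
  rewrite radial_projZ// enormZ gtr0_norm//.
  have /andP[+ _] := Aab _ Ax; apply: le_trans.
  by rewrite ler_piMr// ltW.
have bi : 0 < b^-1 by rewrite invr_gt0.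
rewrite -(volZ bi mAB) muleA -EFinM -exprMn divff ?gt_eqF// expr1n mul1e.
apply: vol_le => //; first exact: ms.
move=> x [Ax Cx] /=; rewrite radial_projZ//; split => //.
rewrite /unit_ball/= enormZ gtr0_norm// mulrC ler_pdivrMr// mul1r.
have /andP[_] := Aab _ Ax; apply: le_trans.
by apply/body_radial_le => //; exact: A0.
Qed.

Lemma sphere_measureE A : measurable A -> A `<=` S ->
  (beta%:E * sphere_measure A = vol (pi @^-1` A `&` B))%E.
Proof.
move=> mA AS; rewrite -ball_volumeE.
rewrite -(uniform_onE (@measurable_unit_ball R n.+1))//; last exact: vol_ball_lty.
by rewrite ball_volumeE lte_fin ball_volume_gt0.
Qed.

Lemma radial_measure_bounds A a b : measurable A -> A `<=` S -> 0 < a -> 0 < b ->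
  (forall u, A u -> a <= rho u <= b) ->
  ((a ^+ n.+1)%:E * vol (pi @^-1` A `&` B) <= radial_measure C A /\
   radial_measure C A <= (b ^+ n.+1)%:E * vol (pi @^-1` A `&` B))%E.
Proof.
move=> mA AS a0 b0 Aab.
have AE : A `&` S = A by apply/setIidPl.
have md D : measurable_fun D (fun u => (radial_density C u)%:E).
  by apply: measurable_funTS; apply/measurable_EFinP; exact: measurable_radial_density.
have b1 := ltW ball_volume_gt0.
rewrite -sphere_measureE// !muleA -!EFinM /radial_measure AE.
rewrite -!integral_cst//; split; apply: ge0_le_integral => //.
- by move=> u _; rewrite lee_fin mulr_ge0// exprn_ge0// ltW.
- move=> u Au; rewrite lee_fin /radial_density mulrC ler_wpM2l//.
  by have /andP[h _] := Aab u Au; rewrite lerXn2r ?nnegrE ?(ltW a0)// radial_fun_ge0.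
- by move=> u _; rewrite lee_fin radial_density_ge0.
- move=> u Au; rewrite lee_fin /radial_density [leRHS]mulrC ler_wpM2l//.
  by have /andP[_ h] := Aab u Au; rewrite lerXn2r ?nnegrE ?(ltW b0)// radial_fun_ge0.
Qed.

Lemma radial_fun_ge : exists2 r : R, 0 < r & forall u, S u -> r <= rho u.
Proof.
have [r r0 rC] := body_inner_ball K; exists r => // u u1.
apply/radial_funP => //; first exact: unit_sphere_neq0.
by apply: rC; rewrite enormZ gtr0_norm// (u1 : enorm u = 1) mulr1.
Qed.

(** Polar integration without a change of variables. The directions are cut into cells where [rho]
    lies in an interval of length [e] above its lower bound [m]. On each cell both measures lie
    between the same two multiples of the volume of a sector of the ball, whose ratio is at most
    [(1 + e / m) ^+ n.+1]; finally [e] tends to 0. *)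
Lemma radial_measureE A : measurable A -> radial_measure C A = vol (pi @^-1` A `&` C).
Proof.
move=> mA.
have mS := @measurable_unit_sphere R n.+1.
have mC := measurable_body K.
have [mu2 mu2E] : exists mu2 : {measure set V -> \bar R},
    forall D, mu2 D = vol (pi @^-1` D `&` C).
  pose mu20 : {measure set V -> \bar R} := pushforward (mrestr vol mC) pi.
  by exists (mu20 (@measurable_radial_proj R n.+1)).
have mAS : measurable (A `&` S) by exact: measurableI.
(* [radial_proj] sends 0 to 0, off the sphere, so restricting to the sphere discards at most the
   origin, a null set. *)
have -> : vol (pi @^-1` A `&` C) = mu2 (A `&` S).
  rewrite mu2E -[LHS]add0e.
  have m0 : measurable [set (0 : V)].
    by apply: closed_measurable_rV; apply: compact_closed; [exact: norm_hausdorff|exact: compact_set1].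
  have z0 : vol [set (0 : V)] = 0%E.
    by apply: (vol_line_null (i := ord0)) => // x s -> /rowP /(_ ord0); rewrite !mxE/= mulr1 add0r.
  have mD D : measurable D -> measurable (pi @^-1` D `&` C).
    by move=> mD; apply: measurableI => //; exact: measurable_radial_preimage.
  apply/eqP; rewrite eq_le; apply/andP; split; last first.
    by rewrite add0e; apply: vol_le; [exact: mD|exact: mD|move=> x [[]]].
  rewrite add0e -[leRHS]add0e -z0.
  apply: (@le_trans _ _ (vol ([set 0] `|` (pi @^-1` (A `&` S) `&` C)))).
    apply: vol_le; [exact: mD|by apply: measurableU => //; exact: mD|].
    move=> x [Ax Cx]; have [->|x0] := eqVneq x 0; [by left|right].
    by split => //; split => //; exact: radial_proj_unit.
  by apply: measureU2 => //; exact: mD.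
have -> : radial_measure C A = radial_measure C (A `&` S).
  by rewrite /radial_measure -setIA (setIid S).
have f1 : radial_measure C (A `&` S) \is a fin_num by exact: (@fin_num_measure _ _ _ (radial_measure C) _ mAS).
have f2 : mu2 (A `&` S) \is a fin_num.
  rewrite ge0_fin_numE// mu2E (le_lt_trans _ (vol_body_lty K))//.
  apply: vol_le; [|exact: mC|by move=> x []].
  by apply: measurableI => //; exact: measurable_radial_preimage.
have [m m0 rm] := radial_fun_ge.
have mr := @measurable_radial_fun R n.+1 K.
have H e : 0 < e ->
  (radial_measure C (A `&` S) <= ((1 + e / m) ^+ n.+1)%:E * mu2 (A `&` S) /\
   mu2 (A `&` S) <= ((1 + e / m) ^+ n.+1)%:E * radial_measure C (A `&` S))%E.
  move=> e0; pose t := (1 + e / m) ^+ n.+1.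
  have t0 : 0 <= t by rewrite exprn_ge0// addr_ge0// divr_ge0// ltW.
  pose a (j : nat) := m + j%:R * e.
  have a0 j : 0 < a j by rewrite ltr_pwDl// mulr_ge0// ltW.
  have aS j : a j.+1 <= (1 + e / m) * a j.
    rewrite /a mulrDl mul1r -[in leLHS]addn1 natrD mulrDl mul1r addrA lerD2l.
    by rewrite mulrAC ler_pdivlMr// ler_pM2l// lerDl mulr_ge0// ltW.
  pose P (k : nat) : set V := (A `&` S) `&` (rho @^-1` `[a k, a k.+1[%classic).
  have mP : forall k, measurable (P k).
    move=> k.
    apply: measurableI => //; rewrite -[X in measurable X]setTI; exact: mr.
  have tP : trivIset setT P.
    apply/trivIsetP => i j _ _ ij; apply/seteqP; split => // u [[_ +] [_ +]].
    rewrite /= !in_itv/= => /andP[h1 h2] /andP[h3 h4].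
    have lt k l : a k < a l.+1 -> (k <= l)%N.
      by rewrite ltrD2l ltr_pM2r// ltr_nat ltnS.
    move: ij; apply/negP; rewrite negbK eqn_leq !lt//.
      exact: le_lt_trans h2.
    exact: le_lt_trans h4.
  have UP : A `&` S = \bigcup_j P j.
    apply/seteqP; split => [u ASu|u [j _ []]//].
    have q0 : 0 <= (rho u - m) / e by rewrite divr_ge0 ?subr_ge0 ?(ltW e0)// rm//; case: ASu.
    exists (Num.truncn ((rho u - m) / e)) => //; split => //=.
    have := truncn_itv q0; rewrite in_itv/= /a => /andP[h1 h2].
    rewrite ler_pdivlMr// in h1; rewrite ltr_pdivrMr// in h2.
    by apply/andP; split; lra.
  have PS j : P j `<=` S by move=> u [[]].
  have Pab j u : P j u -> a j <= rho u <= a j.+1.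
    by move=> [_]; rewrite /= in_itv/= => /andP[-> /ltW].
  have bnd j := radial_measure_bounds (mP j) (PS j) (a0 j) (a0 j.+1) (Pab j).
  have bnd2 j : ((a j ^+ n.+1)%:E * vol (pi @^-1` P j `&` B) <= mu2 (P j) /\
      mu2 (P j) <= (a j.+1 ^+ n.+1)%:E * vol (pi @^-1` P j `&` B))%E.
    rewrite mu2E; exact: sector_bounds (mP j) (PS j) (a0 j) (a0 j.+1) (Pab j).
  have at_ j (x : \bar R) : (0 <= x -> (a j.+1 ^+ n.+1)%:E * x <= t%:E * ((a j ^+ n.+1)%:E * x))%E.
    move=> x0; rewrite muleA -EFinM; apply: lee_pmul => //.
      by rewrite lee_fin exprn_ge0// ltW.
    have h0 : 0 <= 1 + e / m by rewrite addr_ge0// divr_ge0// ltW.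
    by rewrite lee_fin -exprMn lerXn2r// nnegrE ?mulr_ge0 ?(ltW (a0 _)).
  have sum (nu1 nu2 : {measure set V -> \bar R}) :
      (forall j, nu1 (P j) <= t%:E * nu2 (P j))%E -> (nu1 (A `&` S) <= t%:E * nu2 (A `&` S))%E.
    move=> h; rewrite UP !measure_semi_bigcup//; [|exact: bigcup_measurable..].
    by rewrite -nneseriesZl//; apply: lee_nneseries => j _.
  split.
    apply: (sum (radial_measure C) mu2) => j.
    apply: (le_trans (bnd j).2); apply: (le_trans (at_ _ _ _)) => //.
    by apply: lee_pmul => //; [rewrite mule_ge0// lee_fin exprn_ge0// ltW|exact: (bnd2 j).1].
  apply: (sum mu2 (radial_measure C)) => j.
  apply: (le_trans (bnd2 j).2); apply: (le_trans (at_ _ _ _)) => //.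
  by apply: lee_pmul => //; [rewrite mule_ge0// lee_fin exprn_ge0// ltW|exact: (bnd j).1].
have lim x y : x \is a fin_num -> y \is a fin_num -> (0 <= y)%E ->
    (forall e, 0 < e -> (x <= ((1 + e / m) ^+ n.+1)%:E * y)%E) -> (x <= y)%E.
  move=> xf yf; rewrite -(fineK xf) -(fineK yf) !lee_fin => y0 h.
  rewrite leNgt; apply/negP => yx.
  have c : (1 + e / m) ^+ n.+1 * fine y @[e --> (0 : R)] --> (1 + 0 / m) ^+ n.+1 * fine y.
    apply: cvgM; last exact: cvg_cst.
    apply: (@cvg_comp _ _ _ (fun e => 1 + e / m) (fun z => z ^+ n.+1)); last exact: exprn_continuous.
    apply: cvgD; first exact: cvg_cst.
    by apply: cvgM; [exact: cvg_id|exact: cvg_cst].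
  rewrite mul0r addr0 expr1n mul1r in c.
  have /nbhs_ballP[d /= d0 hd] : \forall e \near (0 : R), (1 + e / m) ^+ n.+1 * fine y < fine x.
    by move/cvgr_lt : c; apply.
  have d2 : 0 < d / 2 by rewrite divr_gt0.
  have := hd (d / 2); rewrite /ball/= sub0r normrN gtr0_norm// ltr_pdivrMr// ltr_pMr// ltr1n => /(_ isT).
  by apply/negP; rewrite -leNgt -lee_fin EFinM; exact: h.
apply/eqP; rewrite eq_le; apply/andP; split.
  by apply: lim => // e /H[].
by apply: lim => // e /H[].
Qed.
End body.
End polar_coordinates.

(** * Comparison of integrals without full measurability *)

Section ae_integral.
Context d (T : measurableType d) (R : realType) (mu : {measure set T -> \bar R}).
Local Open Scope ereal_scope.

(** The integral of a nonnegative function is a supremum over the simple functions below it, hence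
    monotone for arbitrary functions. This lets [alpha] be compared with measurable costs
    directly. *)
Lemma ge0_le_integral_nonmeas (D : set T) (f g : T -> \bar R) :
  (forall x, D x -> 0 <= f x) -> (forall x, D x -> f x <= g x) ->
  \int[mu]_(x in D) f x <= \int[mu]_(x in D) g x.
Proof.
move=> f0 fg.
rewrite !ge0_integralE//; last by move=> x Dx; exact: le_trans (f0 _ Dx) (fg _ Dx).
apply: ereal_sup_le => _ [h hf <-]; exists h => // x.
apply: le_trans (hf x) _; rewrite !patchE; case: ifPn => // /set_mem; exact: fg.
Qed.

Let ge0_ae_eq_integral_nonmeas (D : set T) (f g : T -> \bar R) :
  measurable D -> measurable_fun D g ->
  (forall x, D x -> 0 <= f x) -> (forall x, D x -> 0 <= g x) ->
  ae_eq mu D f g -> \int[mu]_(x in D) f x = \int[mu]_(x in D) g x.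
Proof.
move=> mD mg f0 g0 [N [mN N0 fgN]].
have fg x : D x -> ~ N x -> f x = g x.
  by move=> Dx nN; apply: contrapT => h; apply: nN; apply: fgN => /(_ Dx).
(* Changing [g] on the null set [N] to +oo or to 0 gives measurable functions above and below [f]
   with the integral of [g]. *)
have H c : 0 <= c -> \int[mu]_(x in D) (if x \in N then c else g x) = \int[mu]_(x in D) g x.
  move=> c0; apply: ge0_ae_eq_integral => //.
  - apply: measurable_fun_if => //.
    + have mN' : measurable_fun setT (fun x => x \in N).
        apply: (measurable_fun_bool true); rewrite setTI (_ : _ @^-1` _ = N)//.
        by apply/seteqP; split => x /=; [move=> h; exact: set_mem|exact: mem_set].
      exact: measurable_funTS mN'.
    + exact: measurable_funS mg.
  - by move=> x Dx; case: ifPn => // _; exact: g0.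
  - exists N; split => // x /= h; apply: contrapT => nN; apply: h => Dx.
    by rewrite memNset.
apply/eqP; rewrite eq_le; apply/andP; split.
  rewrite -(H +oo)//; apply: ge0_le_integral_nonmeas => // x Dx.
  have [xN|xN] := boolP (x \in N); first by rewrite leey.
  by rewrite (fg _ Dx)//; apply/set_mem; rewrite in_setC.
rewrite -(H 0)//; apply: ge0_le_integral_nonmeas => x Dx.
  by case: ifPn => // _; exact: g0.
have [xN|xN] := boolP (x \in N); first exact: f0.
by rewrite (fg _ Dx)//; apply/set_mem; rewrite in_setC.
Qed.

(** Only [g] has to be measurable: the spherical gradient and the logarithm of the Radon-Nikodym
    derivative are identified with an explicit function almost everywhere. *)
Lemma ae_eq_integral_nonmeas (D : set T) (f g : T -> \bar R) :
  measurable D -> measurable_fun D g ->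
  ae_eq mu D f g -> \int[mu]_(x in D) f x = \int[mu]_(x in D) g x.
Proof.
move=> mD mg /ae_eq_funeposneg[fgp fgn].
rewrite integralE [RHS]integralE; congr (_ - _).
  by apply: ge0_ae_eq_integral_nonmeas => //; exact: measurable_funepos.
by apply: ge0_ae_eq_integral_nonmeas => //; exact: measurable_funeneg.
Qed.

Lemma bounded_integrable (P : probability T R) (D : set T) (f : T -> R) (M : R) :
  measurable D -> measurable_fun D f -> (forall x, D x -> `|f x| <= M)%R ->
  P.-integrable D (EFin \o f).
Proof.
move=> mD mf fM; apply: measurable_bounded_integrable => //.
  by rewrite (le_lt_trans (probability_le1 _ mD))// ltry.
exists M; split; first exact: num_real.
by move=> x Mx y Dy; exact: le_trans (fM _ Dy) (ltW Mx).
Qed.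
End ae_integral.

(** * Entropy, gradient and cone measure as integrals over the body *)

Section support.
Variables (R : realType) (n : nat) (K : sym_convex_body R n).
Local Notation C := (body_set K).

Lemma measurable_support_fun : measurable_fun [set: 'rV[R]_n] (support_fun C).
Proof.
apply: (measurability _ (RGenOInfty.measurableE R)) => _ [_ [a ->] <-].
rewrite setTI (_ : _ @^-1` _ = \bigcup_(x in C) [set u | a < dot x u]).
  apply: open_measurable_rV; apply: bigcup_open => x _.
  apply: (@open_comp _ _ (fun u => dot x u) [set y | a < y]); last exact: open_gt.
  by move=> u _; apply: (@cvg_dot _ _ _ (nbhs u)); [exact: cvg_cst|exact: cvg_id].
apply/seteqP; split => u /=; rewrite in_itv/= andbT.
  move=> au; apply: contrapT => H.
  suff : support_fun C u <= a by rewrite leNgt au.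
  apply: support_fun_le => x Cx; rewrite leNgt; apply/negP => h.
  by apply: H; exists x.
by move=> [x Cx /=] /lt_le_trans; apply; exact: support_fun_ub.
Qed.

Lemma support_fun_bounds : exists r M, [/\ 0 < r, 0 < M &
  forall u, unit_sphere u -> r <= support_fun C u <= M].
Proof.
have [r r0 rC] := body_inner_ball K; have [M M0 CM] := body_bounded K.
exists r, M; split => // u u1; apply/andP; split.
  have := @support_fun_ub _ _ K (r *: u) u.
  rewrite dotZl dotE (u1 : enorm u = 1) expr1n mulr1; apply.
  by apply: rC; rewrite enormZ gtr0_norm// (u1 : enorm u = 1) mulr1.
apply: support_fun_le => x Cx; rewrite (le_trans (dot_le _ _))//.
by rewrite (u1 : enorm u = 1) mulr1 CM.
Qed.

Lemma support_fun_gt0 u : unit_sphere u -> 0 < support_fun C u.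
Proof.
by move=> u1; have [r [M [r0 _ /(_ u u1)/andP[+ _]]]] := support_fun_bounds; exact: lt_le_trans.
Qed.

Lemma ln_support_bounded : exists M, forall u, unit_sphere u -> `|ln (support_fun C u)| <= M.
Proof.
have [r [M [r0 M0 rM]]] := support_fun_bounds.
exists (`|ln r| + `|ln M|) => u u1; have /andP[h1 h2] := rM u u1.
have h0 : 0 < support_fun C u := lt_le_trans r0 h1.
have l1 : ln r <= ln (support_fun C u) by rewrite ler_ln.
have l2 : ln (support_fun C u) <= ln M by rewrite ler_ln.
rewrite ler_norml; apply/andP; split.
  rewrite (le_trans _ l1)// lerNl (le_trans (ler_norm _))// normrN lerDl//.
by rewrite (le_trans l2)// (le_trans (ler_norm _))// lerDr.
Qed.
End support.

Section formula.
Variables (R : realType) (n : nat) (K : sym_convex_body R n.+1).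
Local Notation C := (body_set K).
Local Notation V := 'rV[R]_n.+1.
Local Notation pi := (@radial_proj R n.+1).
Local Notation S := (@unit_sphere R n.+1).
Local Notation beta := (ball_volume R n.+1).
Local Notation rho := (radial_fun C).
Local Notation N := (radial_gauss_map C).
Local Notation P := (uniform_on (measurable_body K)).
Local Notation sigma := (@sphere_measure R n.+1).
Local Notation eta := (radial_measure C).
Hypothesis vol1 : vol K = 1%E.

Lemma uniformE A : P A = vol (A `&` C).
Proof.
have := uniform_onE (measurable_body K) (vol_body_gt0 K) (vol_body_lty K) A.
by rewrite vol1 mul1e.
Qed.

Lemma eta_uniform A : measurable A -> eta A = P (pi @^-1` A).
Proof. by move=> mA; rewrite radial_measureE// uniformE. Qed.

Lemma uniform_smooth : P (~` smooth_points K) = 0%E.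
Proof.
have ms := measurableC (measurable_smooth_points K).
apply/eqP; rewrite eq_le measure_ge0 andbT uniformE -(vol_smooth_pointsC K).
by apply: vol_le; [exact: measurableI ms (measurable_body K)|exact: ms|move=> x []].
Qed.

Lemma sigma_smooth : sigma (~` smooth_points K) = 0%E.
Proof.
have ms := measurableC (measurable_smooth_points K).
have mp := measurable_radial_preimage ms.
suff H : uniform_on (@measurable_unit_ball R n.+1) (pi @^-1` (~` smooth_points K)) = 0%E by [].
have b0 : (0 < vol (@unit_ball R n.+1))%E by rewrite ball_volumeE lte_fin ball_volume_gt0.
have /eqP := uniform_onE (@measurable_unit_ball R n.+1) b0 (vol_ball_lty R n) (pi @^-1` (~` smooth_points K)).
rewrite (_ : vol (_ `&` _) = 0%E); last first.
  apply/eqP; rewrite eq_le measure_ge0 andbT -(vol_smooth_pointsC K).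
  apply: vol_le; [exact: measurableI mp (@measurable_unit_ball R n.+1)|exact: ms|].
  by move=> x [/= nx _] sx; apply: nx; exact: smooth_radial.
by rewrite mule_eq0 gt_eqF//= => /eqP.
Qed.

Lemma ae_uniform (A : set V) : smooth_points K `<=` A -> {ae P, forall x, A x}.
Proof.
move=> sA; exists (~` smooth_points K); split.
- exact: measurableC (measurable_smooth_points K).
- exact: uniform_smooth.
- by apply: subsetC.
Qed.

Lemma ae_sigma (A : set V) : smooth_points K `<=` A -> {ae sigma, forall x, A x}.
Proof.
move=> sA; exists (~` smooth_points K); split.
- exact: measurableC (measurable_smooth_points K).
- exact: sigma_smooth.
- by apply: subsetC.
Qed.

Lemma radial_gauss_map_radial x : N (pi x) = N x.
Proof.
have [->|x0] := eqVneq x 0; first by rewrite radial_proj0.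
have e0 := enorm_gt0 x0.
rewrite /radial_gauss_map; congr (gauss_map C _).
have -> : rho (pi x) = enorm x * rho x.
  apply: invr_inj; rewrite -/(gauge K (pi x)) gaugeZ ?invr_ge0 ?enorm_ge0//.
  by rewrite invfM.
by rewrite /radial_proj scalerA mulrAC divff ?mul1r// gt_eqF.
Qed.

(* On the sphere the density of eta is bounded away from 0, which makes all the integrands bounded. *)
Lemma radial_fun_bounds : exists r M, [/\ 0 < r, 0 < M & forall u, S u -> r <= rho u <= M].
Proof.
have [r r0 rr] := radial_fun_ge K; have [M M0 rM] := radial_fun_le K.
exists r, (M + 1); split => //; first by rewrite ltr_wpDl.
by move=> u u1; rewrite rr//= (le_trans (rM _ u1))// lerDl.
Qed.

Definition log_rho u := ln (rho u).
(** At smooth points this is the logarithm of the norm of the gradient of the gauge; written through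
    the Gauss map, it is measurable and bounded on the whole space. *)
Definition log_grad x := - ln (support_fun C (N x)).

Lemma measurable_log_rho : measurable_fun setT log_rho.
Proof. by apply: measurableT_comp => //; exact: measurable_radial_fun. Qed.

Lemma measurable_log_grad : measurable_fun setT log_grad.
Proof.
apply: measurable_funN; apply: measurableT_comp => //.
by apply: measurableT_comp; [exact: measurable_support_fun|exact: measurable_radial_gauss_map].
Qed.

Lemma log_rho_bounded : exists M, forall x, `|log_rho (pi x)| <= M.
Proof.
have [r [M [r0 M0 rM]]] := radial_fun_bounds.
exists (`|ln r| + `|ln M|) => x.
have [->|x0] := eqVneq x 0.
  by rewrite radial_proj0 /log_rho radial_fun0 ln0// normr0 addr_ge0.
have /andP[h1 h2] := rM _ (radial_proj_unit x0).
have h0 : 0 < rho (pi x) := lt_le_trans r0 h1.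
have l1 : ln r <= ln (rho (pi x)) by rewrite ler_ln.
have l2 : ln (rho (pi x)) <= ln M by rewrite ler_ln.
rewrite ler_norml; apply/andP; split.
  by rewrite (le_trans _ l1)// lerNl (le_trans (ler_norm _))// normrN lerDl.
by rewrite (le_trans l2)// (le_trans (ler_norm _))// lerDr.
Qed.

Lemma log_grad_bounded : exists M, forall x, `|log_grad x| <= M.
Proof.
have [M MB] := ln_support_bounded K; exists (Num.max 0 M) => x; rewrite normrN.
have [u1|nu1] := pselect (S (N x)); first by rewrite le_max MB// orbT.
(* Off the sphere the Gauss map has its default value 0, where the support function vanishes and
   [ln 0 = 0]. *)
rewrite (_ : N x = 0).
  rewrite (_ : support_fun C 0 = 0) ?ln0 ?normr0 ?le_max ?lexx//.
  apply/eqP; rewrite eq_le; apply/andP; split.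
    by apply: support_fun_le => y _; rewrite dotC dot0l.
  by rewrite -(dot0l (0 : V)); apply: support_fun_ub; exact: body0.
apply: contrapT => N0; apply: nu1; move: N0; rewrite /radial_gauss_map /gauss_map.
set y := xget _ _ => y0.
have [u uE] : exists u, unit_normals C (rho x *: x) = [set u].
  apply: contrapT => h; apply: y0; rewrite /y xgetPN// => u uE.
  by apply: h; exists u.
have := @xgetPex _ 0 [set u | unit_normals C (rho x *: x) = [set u]] (ex_intro _ u uE).
rewrite -/y /= => yE.
have : [set y] y by [].
by rewrite -yE => -[].
Qed.

Lemma log_grad_smooth x : smooth_points K x -> log_grad x = ln (enorm (gauge_grad K x)).
Proof.
move=> sx; rewrite /log_grad radial_gauss_map_smooth// support_fun_smooth// lnV ?opprK//.
by rewrite posrE enorm_gt0//; exact: gauge_grad_neq0.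
Qed.

End formula.

Section formula_integrals.
Variables (R : realType) (n : nat) (K : sym_convex_body R n.+1).
Local Notation C := (body_set K).
Local Notation V := 'rV[R]_n.+1.
Local Notation pi := (@radial_proj R n.+1).
Local Notation S := (@unit_sphere R n.+1).
Local Notation beta := (ball_volume R n.+1).
Local Notation rho := (radial_fun C).
Local Notation N := (radial_gauss_map C).
Local Notation P := (uniform_on (measurable_body K)).
Local Notation sigma := (@sphere_measure R n.+1).
Local Notation eta := (radial_measure C).
Local Notation dens := (radial_density C).
Hypothesis vol1 : vol K = 1%E.
Local Open Scope ereal_scope.

Let mS : measurable S := @measurable_unit_sphere R n.+1.
Let mpi : measurable_fun setT pi := @measurable_radial_proj R n.+1.

Lemma bounded_integrableP (F : V -> R) (M : R) (D : set V) : measurable D ->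
  measurable_fun setT F -> (forall x, D x -> `|F x| <= M)%R -> P.-integrable D (EFin \o F).
Proof.
by move=> mD mF FM; apply: (@bounded_integrable _ _ _ P D F M mD) => //; exact: measurable_funTS.
Qed.

Lemma eta_dominated : eta `<< sigma.
Proof.
apply/null_content_dominatesP => A mA sA0; rewrite /radial_measure.
have mAS : measurable (A `&` S) by exact: measurableI.
apply: null_set_integral => //.
  apply: measurable_funTS; apply/measurable_EFinP; exact: measurable_radial_density.
by apply/eqP; rewrite eq_le measure_ge0 andbT -sA0 le_measure ?inE//; exact: subIsetl.
Qed.

Let d : V -> \bar R := (EFin \o dens) \_ S.

Let measurable_d : measurable_fun setT d.
Proof.
apply/(measurable_restrictT _ mS); apply: measurable_funTS; apply/measurable_EFinP.
exact: measurable_radial_density.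
Qed.

Let eta_d A : eta A = \int[sigma]_(x in A) d x.
Proof. exact: integral_mkcondr. Qed.
Let RN := Radon_Nikodym (charge_of_finite_measure eta) sigma.

Let dom : charge_of_finite_measure eta `<< sigma.
Proof. exact: eta_dominated. Qed.

Let RN_d : ae_eq sigma setT RN d.
Proof.
apply: integral_ae_eq => //.
- exact: Radon_Nikodym_integrable.
- by move=> A _ mA; rewrite -eta_d -Radon_Nikodym_integral.
Qed.

Let eta_P (F : V -> R) (M : R) : measurable_fun setT F -> (forall x, `|F x| <= M)%R ->
  \int[eta]_x (F x)%:E = \int[P]_x (F (pi x))%:E.
Proof.
move=> mF FM.
have -> : \int[eta]_x (F x)%:E = \int[pushforward P pi]_x (F x)%:E.
  by apply: eq_measure_integral => A mA _; exact: eta_uniform.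
rewrite integral_pushforward//=.
- by apply/measurable_EFinP.
- apply: (@bounded_integrableP (fun x => F (pi x)) M) => //.
    by rewrite preimage_setT.
  exact: (measurableT_comp mF mpi).
Qed.

Let integrable_eta (F : V -> R) (M : R) : measurable_fun setT F -> (forall x, `|F x| <= M)%R ->
  eta.-integrable setT (EFin \o F).
Proof.
move=> mF FM; apply: measurable_bounded_integrable => //.
  by rewrite -ge0_fin_numE//; exact: (@fin_num_measure _ _ _ eta _ measurableT).
by exists M; split; [exact: num_real|move=> y My x _; exact: le_trans (FM _) (ltW My)].
Qed.

Lemma integral_density (F : V -> R) (M : R) :
  measurable_fun setT F -> (forall x, `|F x| <= M)%R ->
  \int[sigma]_(u in S) (F u * dens u)%:E = \int[P]_x (F (pi x))%:E.
Proof.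
move=> mF FM; rewrite -(eta_P mF FM).
rewrite -(Radon_Nikodym_change_of_variables eta_dominated measurableT (integrable_eta mF FM)).
transitivity (\int[sigma]_x ((F x)%:E * d x)).
  rewrite integral_mkcond; apply: eq_integral => x _.
  by rewrite /d !patchE; case: ifPn => _; rewrite ?mule0// EFinM.
apply: ae_eq_integral => //.
- by apply: emeasurable_funM => //; apply/measurable_EFinP.
- by apply: emeasurable_funM => //; apply/measurable_EFinP.
- by apply/ae_eq_sym/ae_eqe_mul2l.
Qed.

Definition mean_log_rho := \int[P]_x (log_rho K (pi x))%:E.
Definition mean_log_grad := \int[P]_x (log_grad K x)%:E.

Let mlr : measurable_fun setT (fun x => log_rho K (pi x)).
Proof. by apply: measurableT_comp => //; exact: measurable_log_rho. Qed.

Let mlg := measurable_log_grad K.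

Lemma integrable_log_rho : P.-integrable setT (fun x => (log_rho K (pi x))%:E).
Proof. by have [M MB] := log_rho_bounded K; apply: (bounded_integrableP (M := M)). Qed.

Lemma integrable_log_grad : P.-integrable setT (fun x => (log_grad K x)%:E).
Proof. by have [M MB] := log_grad_bounded K; apply: (bounded_integrableP (M := M)). Qed.

Lemma radial_density_gt0 u : S u -> (0 < dens u)%R.
Proof.
move=> u1; rewrite mulr_gt0 ?ball_volume_gt0// exprn_gt0//.
by apply: radial_fun_gt0; exact: unit_sphere_neq0.
Qed.

Lemma radial_proj_id u : S u -> pi u = u.
Proof. by move=> u1; rewrite /radial_proj (u1 : enorm u = 1%R) invr1 scale1r. Qed.

Lemma radial_projK x : pi (pi x) = pi x.
Proof.
have [->|x0] := eqVneq x 0%R; first by rewrite !radial_proj0.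
by rewrite radial_proj_id//; exact: radial_proj_unit.
Qed.

Lemma entropy_formula : relative_entropy eta sigma =
  (ln beta)%:E + n.+1%:R%:E * mean_log_rho.
Proof.
rewrite /relative_entropy; case: ifPn => [_|]; last first.
  by move/asboolPn => []; exact: eta_dominated.
have [M MB] := log_rho_bounded K.
(* The argument is projected to the sphere because [log_rho] is unbounded near the origin, while [F]
   must be bounded everywhere. *)
pose F u := (ln beta + n.+1%:R * log_rho K (pi u))%R.
have mF : measurable_fun setT F by apply: measurable_funD => //; exact: measurable_funM.
have FM x : (`|F x| <= `|ln beta| + n.+1%:R * M)%R.
  by rewrite (le_trans (ler_normD _ _))// lerD2l normrM ger0_norm// ler_wpM2l.
transitivity (\int[eta]_x (F x)%:E).
  apply: ae_eq_integral_nonmeas => //; first by apply/measurable_EFinP.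
  have h1 : ae_eq eta setT RN d.
    exact: (null_dominates_ae_eq measurableT eta_dominated RN_d).
  have h2 : {ae eta, forall x, S x}.
    exists (~` S); split => //; first exact: measurableC.
    by rewrite /radial_measure setICl integral_set0.
  move: h1 h2; apply: filterS2 => x /(_ I) h1 Sx _.
  rewrite -/RN h1 /d patchE (mem_set Sx) -[(EFin \o dens) x]/((dens x)%:E).
  rewrite lne_EFin ?radial_density_gt0//; congr EFin.
  rewrite /F /radial_density radial_proj_id// lnM ?posrE ?ball_volume_gt0//.
    by rewrite lnXn ?mulr_natl// radial_fun_gt0//; exact: unit_sphere_neq0.
  by rewrite exprn_gt0// radial_fun_gt0//; exact: unit_sphere_neq0.
rewrite (eta_P mF FM) /F.
under eq_integral do rewrite radial_projK EFinD EFinM.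
rewrite integralD//; last 2 first.
- exact: finite_measure_integrable_cst.
- by apply: integrableZl => //; exact: integrable_log_rho.
rewrite integral_cst// [X in _ * X](_ : _ = 1) ?mule1; last exact: probability_setT.
by rewrite integralZl//; exact: integrable_log_rho.
Qed.

Lemma gradient_formula :
  \int[sigma]_(u in S)
    (ln (1 + enorm (sphere_grad (potential C) u) ^+ 2 / n.+1%:R ^+ 2)
      * expR (- potential C u))%:E = 2%:E * (mean_log_grad + mean_log_rho).
Proof.
pose F u := (2 * (log_grad K u + log_rho K (pi u)))%R.
have [M MB] := log_rho_bounded K; have [M' MB'] := log_grad_bounded K.
have mF : measurable_fun setT F by apply: measurable_funM => //; exact: measurable_funD.
have FM x : (`|F x| <= 2 * (M' + M))%R.
  by rewrite normrM ger0_norm// ler_wpM2l// (le_trans (ler_normD _ _))// lerD.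
transitivity (\int[sigma]_(u in S) (F u * dens u)%:E).
  apply: ae_eq_integral_nonmeas => //.
    apply: measurable_funTS; apply/measurable_EFinP; apply: measurable_funM => //.
    exact: measurable_radial_density.
  have := ae_sigma (@subset_refl _ (smooth_points K)).
  apply: filterS => u su Su; congr EFin.
  rewrite opprK lnK ?posrE ?radial_density_gt0//; congr (_ * _)%R.
  rewrite enorm_sphere_grad ?ball_volume_gt0// /F log_grad_smooth// /log_rho.
  have g0 : (0 < gauge K u)%R by apply: gauge_gt0; exact: unit_sphere_neq0.
  have p0 := enorm_gt0 (gauge_grad_neq0 su).
  rewrite lnXn ?divr_gt0// ln_div ?posrE// radial_proj_id// -[LHS]mulr_natl; congr (_ * (_ + _))%R.
  by rewrite /gauge lnV ?opprK// posrE radial_fun_gt0//; exact: unit_sphere_neq0.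
rewrite (integral_density mF FM) /F.
under eq_integral do rewrite radial_projK /log_grad radial_gauss_map_radial -/(log_grad K _) EFinM.
rewrite integralZl//; last first.
  apply: (@bounded_integrableP (fun x => log_grad K x + log_rho K (pi x))%R (M' + M)%R) => //.
    exact: measurable_funD.
  by move=> x _; rewrite (le_trans (ler_normD _ _))// lerD.
by under eq_integral do rewrite EFinD; rewrite integralD//;
  [exact: integrable_log_grad|exact: integrable_log_rho].
Qed.

Lemma cone_support_formula :
  \int[cone_measure K]_(u in S) (ln (support_fun C u))%:E = - mean_log_grad.
Proof.
have mN : measurable_fun setT N := @measurable_radial_gauss_map R n.+1 K.
have mf : measurable_fun setT (fun u => (ln (support_fun C u))%:E).
  by apply/measurable_EFinP; apply: measurableT_comp => //; exact: measurable_support_fun.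
have mNS : measurable (N @^-1` S) by rewrite -[X in measurable X]setTI; exact: mN.
have [M MB] := log_grad_bounded K.
have -> : \int[cone_measure K]_(u in S) (ln (support_fun C u))%:E =
    \int[P]_(x in N @^-1` S) ((fun u => (ln (support_fun C u))%:E) \o N) x.
  apply: integral_pushforward => //.
  apply: (@bounded_integrableP (fun x => ln (support_fun C (N x))) M) => //.
    exact: (measurableT_comp (measurableT_comp (@measurable_ln R) (measurable_support_fun K)) mN).
  by move=> x _; have := MB x; rewrite /log_grad normrN.
rewrite integral_mkcond.
transitivity (\int[P]_x ((-1)%:E * (log_grad K x)%:E)).
  apply: ae_eq_integral_nonmeas => //.
    by apply: emeasurable_funM => //; apply/measurable_EFinP.
  have := ae_uniform vol1 (@subset_refl _ (smooth_points K)).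
  apply: filterS => x sx _.
  rewrite patchE mem_set; first by rewrite /= -EFinM mulN1r opprK.
  rewrite /= radial_gauss_map_smooth//; apply: radial_proj_unit; exact: gauge_grad_neq0.
rewrite integralZl ?mulN1e//; exact: integrable_log_grad.
Qed.

End formula_integrals.

(** * Polar bodies and the volume product *)

Section make_body.
Variables (R : realType) (n : nat) (A : set 'rV[R]_n) (r M : R).
Hypothesis cA : closed A.
Hypothesis convA : forall (t : R) x y, 0 <= t <= 1 -> A x -> A y -> A (t *: x + (1 - t) *: y).
Hypothesis symA : forall x, A x -> A (- x).
Hypothesis r0 : 0 < r.
Hypothesis ballA : forall x, enorm x <= r -> A x.
Hypothesis boundA : forall x, A x -> enorm x <= M.

Let compactA : compact A.
Proof.
apply: (subclosed_compact cA (@rV_compact R n (fun=> `[(- M), M]%classic) _)).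
  by move=> _; exact: segment_compact.
by move=> x Ax i /=; rewrite in_itv/= -ler_norml (le_trans (coord_le_enorm _ _))// boundA.
Qed.

Let convexA : convex_set A.
Proof.
move=> x y t /set_mem Ax /set_mem Ay; apply/mem_set.
by apply: convA => //; apply/andP; split; [exact: ge0|exact: le1].
Qed.

Let interiorA : interior A !=set0.
Proof.
exists 0; have : \forall x \near (0 : 'rV[R]_n), enorm x < r.
  have /cvgr_lt := @enorm_continuous R n 0; apply.
  by rewrite enorm0.
by apply: (@filterS _ (nbhs (0 : 'rV[R]_n))) => x /ltW; exact: ballA.
Qed.

Definition make_body := SymConvexBody compactA convexA symA interiorA.
End make_body.

Section bodies.
Variables (R : realType) (n : nat).
Implicit Types (K : sym_convex_body R n) (u v x y : 'rV[R]_n).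

Lemma scale_body_ex K a : 0 < a -> exists K' : sym_convex_body R n,
  body_set K' = [set x | body_set K (a^-1 *: x)].
Proof.
move=> a0; have ai : 0 < a^-1 by rewrite invr_gt0.
have [r r0 rC] := body_inner_ball K; have [M M0 CM] := body_bounded K.
have cA : closed [set x | body_set K (a^-1 *: x)].
  apply: (@preimage_closed _ _ (fun x => a^-1 *: x)); last exact: body_closed.
  by move=> x _; exact: scaler_continuous.
have ar : 0 < a * r by rewrite mulr_gt0.
unshelve eexists (@make_body R n [set x | body_set K (a^-1 *: x)] (a * r) (a * M) cA _ _ ar _ _) => //=.
- move=> t x y /andP[t0 t1] /= Kx Ky; have := body_conv t0 t1 Kx Ky.
  by rewrite scalerDr !scalerA ![_ * a^-1]mulrC.
- by move=> x /= Kx; rewrite scalerN; exact: body_sym.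
- move=> x xr; apply: rC; rewrite enormZ gtr0_norm// mulrC ler_pdivrMr// mulrC//.
- move=> x /CM; rewrite enormZ gtr0_norm// mulrC ler_pdivrMr// mulrC//.
Qed.

Definition scale_body K a (a0 : 0 < a) : sym_convex_body R n := sval (cid (scale_body_ex K a0)).

Lemma scale_bodyE K a (a0 : 0 < a) : body_set (scale_body K a0) = [set x | body_set K (a^-1 *: x)].
Proof. by rewrite /scale_body; case: cid. Qed.

Lemma vol_scale_body K a (a0 : 0 < a) : vol (scale_body K a0) = ((a ^+ n)%:E * vol K)%E.
Proof.
have ai : 0 < a^-1 by rewrite invr_gt0.
rewrite scale_bodyE -(volZ ai (measurable_body K)) muleA -EFinM -exprMn.
by rewrite divff ?gt_eqF// expr1n mul1e.
Qed.

Lemma support_scale_body K a (a0 : 0 < a) u :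
  support_fun (scale_body K a0) u = a * support_fun K u.
Proof.
apply/eqP; rewrite eq_le; apply/andP; split.
  apply: support_fun_le => x; rewrite scale_bodyE/= => Kx.
  by rewrite -ler_pdivrMl// -dotZl; exact: support_fun_ub.
rewrite -ler_pdivlMl//; apply: support_fun_le => x Kx.
rewrite ler_pdivlMl// -dotZl; apply: support_fun_ub.
by rewrite scale_bodyE/= scalerA mulVf ?gt_eqF// scale1r.
Qed.

Lemma closed_polar (C : set 'rV[R]_n) : closed (polar C).
Proof.
rewrite (_ : polar C = \bigcap_(x in C) [set y | dot x y <= 1]); last first.
  by apply/seteqP; split => y H x; exact: H.
apply: closed_bigI => x _.
apply: (@preimage_closed _ _ (fun y => dot x y) [set t | t <= 1]); last exact: closed_le.
by move=> y _; apply: (@cvg_dot _ _ _ (nbhs y)); [exact: cvg_cst|exact: cvg_id].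
Qed.

Lemma polar_body_ex K : exists K' : sym_convex_body R n, body_set K' = polar K.
Proof.
have [r r0 rC] := body_inner_ball K; have [M M0 CM] := body_bounded K.
have Mi : 0 < M^-1 by rewrite invr_gt0.
unshelve eexists (@make_body R n (polar K) M^-1 r^-1 (@closed_polar K) _ _ Mi _ _) => //=.
- move=> t x y /andP[t0 t1] Kx Ky z Kz; rewrite dotDr !dotZr.
  have h1 := Kx z Kz; have h2 := Ky z Kz.
  have : t * dot z x <= t * 1 by rewrite ler_wpM2l.
  have : (1 - t) * dot z y <= (1 - t) * 1 by rewrite ler_wpM2l// subr_ge0.
  lra.
- by move=> y Ky x Kx; rewrite dotNr -dotNl; apply: Ky; exact: body_sym.
- move=> y yM x Kx; rewrite (le_trans (dot_le _ _))//.
  by rewrite -[leRHS](@divff _ M) ?gt_eqF// ler_pM ?enorm_ge0// CM.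
- move=> y Ky; have [->|y0] := eqVneq y 0; first by rewrite enorm0 invr_ge0 ltW.
  have e0 := enorm_gt0 y0.
  have := Ky ((r / enorm y) *: y) _; rewrite dotZl dotE expr2 mulrA divfK ?gt_eqF//.
  rewrite -ler_pdivlMl// mulr1; apply; apply: rC.
  by rewrite enormZ ger0_norm ?divfK ?gt_eqF// divr_ge0// ltW.
Qed.

Definition polar_body K : sym_convex_body R n := sval (cid (polar_body_ex K)).

Lemma polar_bodyE K : body_set (polar_body K) = polar K.
Proof. by rewrite /polar_body; case: cid. Qed.

(* Weak duality for the cost alpha; no bipolar theorem is needed since u / h_K(u) is in the polar. *)
Lemma dot_support_le K u v : unit_sphere u -> unit_sphere v ->
  dot u v <= support_fun K u * support_fun (polar K) v.
Proof.
move=> u1 v1; have h0 := support_fun_gt0 K u1.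
rewrite -ler_pdivrMl// -dotZl -polar_bodyE; apply: support_fun_ub.
rewrite polar_bodyE => x Kx; rewrite dotZr -ler_pdivlMl ?invr_gt0// invrK mulr1.
exact: support_fun_ub.
Qed.

(** The absolute value makes the Wulff shape symmetric by construction, with no evenness asked of
    [h]. *)
Lemma wulff_body (h : 'rV[R]_n -> R) (r M : R) : 0 < r ->
  (forall u, unit_sphere u -> r <= h u <= M) ->
  exists L : sym_convex_body R n,
    body_set L = [set y | forall u, unit_sphere u -> `|dot y u| <= h u].
Proof.
move=> r0 hr.
pose A := [set y | forall u, unit_sphere u -> `|dot y u| <= h u].
have cA : closed A.
  rewrite (_ : A = \bigcap_(u in unit_sphere) [set y | `|dot y u| <= h u]); last first.
    by apply/seteqP; split => y H x; exact: H.
  apply: closed_bigI => u _.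
  apply: (@preimage_closed _ _ (fun y => `|dot y u|) [set t | t <= h u]); last exact: closed_le.
  move=> y _; apply: (@cvg_norm _ _ _ (nbhs y)).
  by apply: (@cvg_dot _ _ _ (nbhs y)); [exact: cvg_id|exact: cvg_cst].
unshelve eexists (@make_body R n A r `|M| cA _ _ r0 _ _) => //=.
- move=> t x y /andP[t0 t1] Ax Ay u u1; rewrite dotDl !dotZl.
  rewrite (le_trans (ler_normD _ _))// !normrM ger0_norm// (ger0_norm (_ : 0 <= 1 - t)) ?subr_ge0//.
  have : t * `|dot x u| <= t * h u by rewrite ler_wpM2l// Ax.
  have : (1 - t) * `|dot y u| <= (1 - t) * h u by rewrite ler_wpM2l ?subr_ge0// Ay.
  lra.
- by move=> y Ay u u1; rewrite dotNl normrN; exact: Ay.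
- move=> y yr u u1; have /andP[h1 _] := hr u u1; apply: le_trans h1.
  have H z : dot z u <= enorm z by have := dot_le z u; rewrite (u1 : enorm u = 1) mulr1.
  rewrite ler_norml lerNl -dotNl (le_trans (H _)) ?enormN// (le_trans (H _))//.
- move=> y Ay; have [->|y0] := eqVneq y 0; first by rewrite enorm0.
  have e0 := enorm_gt0 y0.
  have u1 : unit_sphere (radial_proj y) by exact: radial_proj_unit.
  have := Ay _ u1; rewrite dotZr dotE expr2 mulrA mulVf ?gt_eqF// mul1r ger0_norm ?enorm_ge0//.
  by move=> /le_trans; apply; have /andP[_ h2] := hr _ u1; rewrite (le_trans h2)// ler_norm.
Qed.

Lemma exists_root (v : R) : 0 < v -> (0 < n)%N -> exists2 a, 0 < a & a ^+ n = v.
Proof.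
move=> v0 n0; exists (v `^ (n%:R^-1)); first by rewrite powR_gt0.
by rewrite -powR_mulrn ?powR_ge0// -powRrM mulVf ?powRr1 ?ltW// pnatr_eq0 -lt0n.
Qed.
End bodies.

Section volume_product.
Variable R : realType.

Lemma dot_cons n (t s : R) (y z : 'rV[R]_n) :
  dot (cons_rV (t, y)) (cons_rV (s, z)) = t * s + dot y z.
Proof.
rewrite /dot big_ord_recl !cons_rV0; congr (_ + _).
by apply: eq_bigr => i _; rewrite !cons_rVS.
Qed.

Lemma cons_rV_surj n (x : 'rV[R]_n.+1) : exists t y, x = cons_rV (t, y).
Proof.
exists (x 0 ord0), (\row_j x 0 (lift ord0 j)); apply: cons_rVP => [|i].
  by rewrite cons_rV0.
by rewrite cons_rVS/= mxE.
Qed.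

Lemma cons_rVD n (t s : R) (y z : 'rV[R]_n) :
  cons_rV (t, y) + cons_rV (s, z) = cons_rV (t + s, y + z).
Proof. by apply: cons_rVP => [|i]; rewrite mxE ?cons_rV0 ?cons_rVS ?mxE. Qed.

Lemma cons_rVZ n (t s : R) (z : 'rV[R]_n) : t *: cons_rV (s, z) = cons_rV (t * s, t *: z).
Proof. by apply: cons_rVP => [|i]; rewrite mxE ?cons_rV0 ?cons_rVS ?mxE. Qed.

Lemma lebesgue_measure_segment (u v : R) : u <= v ->
  (@lebesgue_measure R) `[u, v]%classic = (v - u)%:E.
Proof.
move=> uv; rewrite lebesgue_measure_itv/= lte_fin; case: ltP => // vu.
by rewrite (@le_anti _ _ u v) ?uv// subrr.
Qed.

Lemma vol_ge_slices n (A : set 'rV[R]_n.+1) (u v : R) (c : \bar R) : measurable A ->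
  (0 <= c)%E -> u <= v ->
  (forall t, u <= t <= v -> (c <= vol [set y | A (cons_rV (t, y))])%E) ->
  (c * (v - u)%:E <= vol A)%E.
Proof.
move=> mA c0 uv H; rewrite vol_section1//.
have mi : measurable (`[u, v]%classic : set (measurableTypeR R)) by exact: measurable_itv.
apply: (@le_trans _ _ (\int[lebesgue_measure]_(t in `[u, v]) vol [set y | A (cons_rV (t, y))])%E); last first.
  apply: ge0_subset_integral => //; exact: measurable_vol_section1.
have <- : (\int[lebesgue_measure]_(t in `[u, v]) cst c t = c * (v - u)%:E)%E.
  by rewrite integral_cst//; congr (_ * _)%E; exact: lebesgue_measure_segment.
apply: ge0_le_integral => //.
by apply: measurable_funTS; exact: measurable_vol_section1.
Qed.

Lemma vol_ge_fibres n (A : set 'rV[R]_n.+1) (B : set 'rV[R]_n) (c : \bar R) : measurable A ->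
  measurable B -> (0 <= c)%E ->
  (forall y, B y -> (c <= (@lebesgue_measure R) [set t | A (cons_rV (t, y))])%E) ->
  (c * vol B <= vol A)%E.
Proof.
move=> mA mB c0 H; rewrite vol_section2//.
apply: (@le_trans _ _ (\int[vol]_(y in B) (@lebesgue_measure R) [set t | A (cons_rV (t, y))])%E); last first.
  apply: ge0_subset_integral => //; exact: measurable_lebesgue_section2.
rewrite -integral_cst//; apply: ge0_le_integral => //.
by apply: measurable_funTS; exact: measurable_lebesgue_section2.
Qed.

Lemma section_body_ex n (K : sym_convex_body R n.+1) :
  exists K' : sym_convex_body R n, body_set K' = [set y | body_set K (cons_rV (0, y))].
Proof.
have [r r0 rC] := body_inner_ball K; have [M M0 CM] := body_bounded K.
have nE (y : 'rV[R]_n) : enorm (cons_rV (0, y)) = enorm y by rewrite /enorm dot_cons mulr0 add0r.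
have cA : closed [set y | body_set K (cons_rV (0, y))].
  apply: (@preimage_closed _ _ (fun y => cons_rV (0, y))); last exact: body_closed.
  move=> y _; have [d dE] : exists d, d = cons_rV (0, y) by eexists.
  apply/(@cvgrPdist_le _ _ _ (nbhs y)) => e e0.
  have : \forall z \near y, `|y - z| <= e.
    by have /cvgrPdist_le := @cvg_id _ (nbhs y); apply.
  apply: (@filterS _ (nbhs y)) => z yz.
  rewrite -scaleN1r cons_rVZ cons_rVD mulr0 addr0 scaleN1r.
  rewrite [leLHS]mx_normrE; apply/bigmax_leP; split; first exact: ltW.
  move=> [i j] _ /=; rewrite ord1.
  case: (unliftP ord0 j) => [k ->|->]; last by rewrite cons_rV0/= normr0 ltW.
  rewrite cons_rVS/=; apply: le_trans yz.
  rewrite [leRHS]mx_normrE; exact: (le_bigmax _ (fun i : 'I_1 * 'I_n => `|(y - z) i.1 i.2|) (0, k)).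
unshelve eexists (@make_body R n _ r M cA _ _ r0 _ _) => //=.
- move=> t x y /andP[t0 t1] Kx Ky; have := body_conv t0 t1 Kx Ky.
  by rewrite !cons_rVZ cons_rVD !mulr0 addr0.
- by move=> x /body_sym; rewrite -scaleN1r cons_rVZ mulr0 scaleN1r.
- by move=> x xr; apply: rC; rewrite nE.
- by move=> x /CM; rewrite nE.
Qed.

(* One-dimensional Hahn-Banach extension of a functional from the section x_0 = 0. *)
Lemma polar_extend n (K : sym_convex_body R n.+1) (z : 'rV[R]_n) :
  polar [set y | body_set K (cons_rV (0, y))] z -> exists s, polar K (cons_rV (s, z)).
Proof.
move=> Kz; have [r r0 rC] := body_inner_ball K.
(* Points of the body with negative first coordinate bound the sought [s] from below, by the
   elements of [N]; those with positive first coordinate bound it from above. Joining two such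
   points crosses the section, where [z] is at most 1, and this orders the bounds. *)
pose N := [set (1 - dot p.2 z) / p.1 | p in [set p : R * 'rV[R]_n | p.1 < 0 /\ body_set K (cons_rV p)]].
have key t s x y : body_set K (cons_rV (t, x)) -> body_set K (cons_rV (s, y)) -> 0 < t -> s < 0 ->
    (1 - dot y z) / s <= (1 - dot x z) / t.
  move=> Kx Ky t0 s0.
  have d0 : 0 < t - s by rewrite subr_gt0 (lt_trans s0).
  have l0 : 0 <= t / (t - s) by rewrite divr_ge0// ltW.
  have l1 : t / (t - s) <= 1 by rewrite ler_pdivrMr// mul1r lerBrDl gerDr ltW.
  have := body_conv l0 l1 Ky Kx; rewrite !cons_rVZ cons_rVD.
  rewrite (_ : _ * s + _ = 0); last by field; rewrite gt_eqF.
  move=> /Kz; rewrite dotDl !dotZl.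
  rewrite (_ : _ + _ = (t * dot y z - s * dot x z) / (t - s)); last by field; rewrite gt_eqF.
  rewrite ler_pdivrMr// mul1r => H.
  rewrite -[s]opprK invrN mulrN lerNl -mulNr ler_pdivlMr ?oppr_gt0// mulrAC ler_pdivrMr//.
  lra.
have [p0 Kp0] : exists p, 0 < p /\ body_set K (cons_rV (p, 0)).
  exists r; split => //; apply: rC; rewrite /enorm dot_cons dot0l addr0 -expr2 sqrtr_sqr.
  by rewrite gtr0_norm.
have Nn : N !=set0.
  exists ((1 - dot 0 z) / - p0), (- p0, 0) => //=; split; first by rewrite oppr_lt0 Kp0.1.
  by have := body_sym Kp0.2; rewrite -scaleN1r cons_rVZ mulN1r scaler0.
have Nub t x : 0 < t -> body_set K (cons_rV (t, x)) -> ubound N ((1 - dot x z) / t).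
  by move=> t0 Kx _ [[s y] /= [s0 Ky] <-]; exact: key.
exists (sup N) => x; have [t [y ->]] := cons_rV_surj x => Ky; rewrite dot_cons.
have [t0|t0|t0] := ltgtP t 0.
- have : (1 - dot y z) / t <= sup N.
    by apply: ub_le_sup; [exists ((1 - dot 0 z) / p0); apply: Nub; case: Kp0|exists (t, y)].
  by rewrite ler_ndivrMr// mulrC; lra.
- have : sup N <= (1 - dot y z) / t by apply: ge_sup => //; exact: Nub.
  by rewrite ler_pdivlMr// mulrC; lra.
- by rewrite t0 mul0r add0r; apply: Kz => /=; rewrite -t0.
Qed.

(** With [a] the height of [K] over the hyperplane, [K] has volume at least (a / 4) |K' / 2| and its
    polar at least (1 / a) |K'^o / 2|. The height cancels in the product; the 4 comes from the first
    bound and each [2 ^+ n] from one halving. *)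
Lemma volume_product_section n (K : sym_convex_body R n.+1) (K' : sym_convex_body R n) :
  body_set K' = [set y | body_set K (cons_rV (0, y))] ->
  fine (vol K') * fine (vol (polar K')) <=
  4 * 2 ^+ n * 2 ^+ n * (fine (vol K) * fine (vol (polar K))).
Proof.
move=> K'E; have [r r0 rC] := body_inner_ball K.
pose e : 'rV[R]_n.+1 := cons_rV (1, 0).
have e1 : unit_sphere e by rewrite /unit_sphere/= /enorm dot_cons dot0l addr0 mul1r sqrtr1.
have [a aE] : exists a, a = support_fun K e by eexists.
have a0 : 0 < a by rewrite aE; exact: support_fun_gt0.
have Ka t y : body_set K (cons_rV (t, y)) -> t <= a.
  move=> /(@support_fun_ub _ _ K _ e); rewrite -aE dot_cons mulr1 dotC dot0l addr0//.
have [b [w [bw Kw]]] : exists b w, a / 2 <= b /\ body_set K (cons_rV (b, w)).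
  apply: contrapT => H; have : support_fun K e <= a / 2.
    apply: support_fun_le => x; have [t [y ->]] := cons_rV_surj x => Ky.
    rewrite dot_cons mulr1 dotC dot0l addr0 leNgt; apply/negP => ht; apply: H.
    by exists t, y; split => //; exact: ltW.
  by rewrite -aE; lra.
have b0 : 0 < b by lra.
have two0 : 0 < 2 :> R by [].
have mK' : measurable (body_set K') := measurable_body K'.
have mP' : measurable (polar K') by apply: closed_measurable_rV; exact: closed_polar.
have mP : measurable (polar K) by apply: closed_measurable_rV; exact: closed_polar.
have half A : measurable A -> measurable ((fun x : 'rV[R]_n => 2 *: x) @^-1` A).
  move=> mA; rewrite -[X in measurable X]setTI; apply: measurable_rV_coords => //.
  exact: scaler_continuous.
(* At height [t] the section of [K] contains [s *: w] plus K' / 2: average the point [2 * s] times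
   (b, w) with a point of K'. Since [b] is at least [a / 2], heights up to [a / 4] keep [2 * s]
   below 1. *)
have h1 : (vol ((fun x => 2 *: x)%R @^-1` (body_set K')) * (a / 4)%:E <= vol K)%E.
  rewrite -[a / 4]subr0; apply: vol_ge_slices => //; [exact: measurable_body|lra|].
  move=> t /andP[t0 ta]; pose s := t / b.
  have s0 : 0 <= s by rewrite divr_ge0// ltW.
  have s1 : s <= 1 / 2 by rewrite ler_pdivrMr//; lra.
  rewrite -(volD (- (s *: w)) (half _ mK')); apply: vol_le.
  - rewrite -[X in measurable X]setTI; apply: measurable_rV_coords => //; last exact: half.
    by move=> x; apply: (@cvgD _ _ _ (nbhs x)); [exact: cvg_id|exact: cvg_cst].
  - by apply: measurable_section1; exact: measurable_body.
  - move=> y /=; rewrite K'E/= => Ky.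
    have hl : 0 <= (1 / 2 : R) <= 1 by apply/andP; split; lra.
    have [hl0 hl1] := andP hl.
    have s2 : 0 <= 2 * s by lra.
    have s21 : 2 * s <= 1 by lra.
    have := body_conv hl0 hl1 (bodyZ s2 s21 Kw) Ky; rewrite !cons_rVZ cons_rVD.
    rewrite (_ : _ + _ = t); last by rewrite /s; field; rewrite gt_eqF.
    rewrite !scalerA (_ : 1 / 2 * (2 * s) = s); last by field.
    by rewrite (_ : (1 - 1 / 2) * 2 = 1); [rewrite scale1r addrCA subrr addr0|field].
(* If 2y is in the polar of K', extend it to (s, 2y) in the polar of [K]. Half of this point uses
   1/2 of the constraint; the remaining 1/2 allows the first coordinate to move by [(2 * a)^-1]
   either way, as first coordinates in [K] are at most [a] in absolute value. *)
have h2 : ((a^-1)%:E * vol ((fun x => 2 *: x)%R @^-1` (polar K')) <= vol (polar K))%E.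
  apply: vol_ge_fibres => //; [exact: half|by rewrite lee_fin invr_ge0 ltW|].
  move=> y /=; rewrite K'E => /polar_extend[s Ks].
  have il : s / 2 - (2 * a)^-1 <= s / 2 + (2 * a)^-1.
    by rewrite lerD2l ge0_cp// invr_ge0 mulr_ge0// ltW.
  have -> : (a^-1)%:E = (@lebesgue_measure R) `[s / 2 - (2 * a)^-1, s / 2 + (2 * a)^-1]%classic.
    by rewrite lebesgue_measure_segment//; congr EFin; field; rewrite gt_eqF.
  apply: le_measure; rewrite ?inE; first exact: measurable_itv.
    exact: (measurable_section2 _ mP).
  move=> t /=; rewrite in_itv/= => /andP[t1 t2] x; have [p [x' ->]] := cons_rV_surj x => Kx.
  have := Ks _ Kx; rewrite !dot_cons dotZr => hs.
  have pa := Ka _ _ Kx.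
  have pa' : - a <= p.
    have := body_sym Kx; rewrite -scaleN1r cons_rVZ mulN1r => /Ka; lra.
  have [q qE] : exists q, q = t - s / 2 by eexists.
  have tq : t = q + s / 2 by rewrite qE; lra.
  have ia : (2 * a)^-1 * a = 1 / 2 by field; rewrite gt_eqF.
  have : `|p * q| <= a * (2 * a)^-1.
    by rewrite normrM ler_pM// ler_norml; apply/andP; split; lra.
  rewrite [a * _]mulrC ia ler_norml => /andP[_]; rewrite tq; lra.
have vK := vol_body_lty K; have vK' := vol_body_lty K'.
have := vol_body_lty (polar_body K); have := vol_body_lty (polar_body K').
rewrite !polar_bodyE => vP' vP.
have e1' := volZ two0 mK'; have e2' := volZ two0 mP'.
have fin n' (A : set 'rV[R]_n') : (vol A < +oo)%E -> vol A = (fine (vol A))%:E.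
  by move=> h; rewrite fineK// ge0_fin_numE.
have v1 : (vol ((fun x => 2 *: x)%R @^-1` (body_set K')) < +oo)%E.
  rewrite ltey; apply/eqP => h; move: vK'; rewrite -e1' h gt0_muley ?ltxx// lte_fin exprn_gt0//.
have v2 : (vol ((fun x => 2 *: x)%R @^-1` (polar K')) < +oo)%E.
  rewrite ltey; apply/eqP => h; move: vP'; rewrite -e2' h gt0_muley ?ltxx// lte_fin exprn_gt0//.
move: h1 h2; rewrite -e1' -e2' (fin _ _ vK) (fin _ _ vP) (fin _ _ v1) (fin _ _ v2).
rewrite -!EFinM !lee_fin /= => h1 h2.
set x := fine _ in h1 *; set x' := fine _ in h2 *; set X := fine _ in h1 *; set X' := fine _ in h2 *.
have x0 : 0 <= x by exact: fine_ge0.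
have x0' : 0 <= x' by exact: fine_ge0.
have : (x * (a / 4)) * (a^-1 * x') <= X * X'.
  by rewrite ler_pM// mulr_ge0// ?invr_ge0 ?divr_ge0// ltW.
rewrite (_ : x * (a / 4) * (a^-1 * x') = x * x' / 4); last by field; rewrite gt_eqF.
have p0 : 0 <= (2 : R) ^+ n by rewrite exprn_ge0.
have : 0 <= (2 : R) ^+ n * 2 ^+ n by rewrite mulr_ge0.
nra.
Qed.

(** Only positivity matters. The constant obtained is 4 to the power - n (n + 1) / 2, starting from
    1 in dimension 0, where the volume is a Dirac mass. *)
Lemma volume_product_gt0 n : exists2 c : R, 0 < c &
  forall K : sym_convex_body R n, c <= fine (vol K) * fine (vol (polar K)).
Proof.
elim: n => [|n [c c0 IH]].
  have v1 (A : set 'rV[R]_0) : A 0 -> vol A = 1%E.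
    by move=> A0; change (dirac (0%R : 'rV[R]_0) A = 1%E :> \bar R); rewrite diracE mem_set.
  exists 1 => // K; rewrite !v1 ?mulr1//; last exact: body0.
  by move=> x _; rewrite dotC dot0l.
have d0 : 0 < 4 * 2 ^+ n * 2 ^+ n :> R by rewrite !mulr_gt0// exprn_gt0.
exists (c / (4 * 2 ^+ n * 2 ^+ n)); first by rewrite divr_gt0.
move=> K; have [K' K'E] := section_body_ex K.
by rewrite ler_pdivrMr// mulrC (le_trans (IH K'))// volume_product_section.
Qed.

Lemma min_volume_product_le n (K : sym_convex_body R n) :
  min_volume_product R n <= fine (vol K) * fine (vol (polar K)).
Proof.
have [c _ cK] := volume_product_gt0 n.
by apply: ge_inf; [exists c => _ [L _ <-]; exact: cK|exists K].
Qed.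

Lemma sym_body_exists n : sym_convex_body R n.
Proof.
apply: (@make_body R n unit_ball 1 1) => //; first exact: closed_unit_ball.
- move=> t x y /andP[t0 t1] x1 y1.
  rewrite /unit_ball/= -(ler_pXn2r (_ : 0 < 2)%N) ?nnegrE ?enorm_ge0// -dotE expr1n.
  rewrite !(dotDl, dotDr) !dotZ (dotC y x) !dotE.
  have xy : dot x y <= 1 by rewrite (le_trans (dot_le _ _))// mulr_ile1 ?enorm_ge0.
  have hx : enorm x ^+ 2 <= 1 by rewrite expr_le1// enorm_ge0.
  have hy : enorm y ^+ 2 <= 1 by rewrite expr_le1// enorm_ge0.
  have s0 : 0 <= 1 - t by rewrite subr_ge0.
  have a1 : t * t * (enorm x ^+ 2) <= t * t by rewrite ler_piMr ?mulr_ge0.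
  have a2 : (1 - t) * (1 - t) * (enorm y ^+ 2) <= (1 - t) * (1 - t) by rewrite ler_piMr ?mulr_ge0.
  have a3 : t * (1 - t) * dot x y <= t * (1 - t) by rewrite ler_piMr ?mulr_ge0.
  nra.
- by move=> x; rewrite /unit_ball/= enormN.
Qed.

Lemma min_volume_product_ge n c :
  (forall K : sym_convex_body R n, c <= fine (vol K) * fine (vol (polar K))) ->
  c <= min_volume_product R n.
Proof.
move=> H; apply: lb_le_inf => [|_ [K _ <-]]; last exact: H.
by eexists; exists (sym_body_exists n).
Qed.

Lemma min_volume_product_gt0 n : 0 < min_volume_product R n.
Proof.
have [c c0 cK] := volume_product_gt0 n.
by apply: (lt_le_trans c0); exact: min_volume_product_ge.
Qed.
End volume_product.

(** * Consequences of the log-Minkowski inequality *)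

Section cone_measure_facts.
Variables (R : realType) (n : nat) (K : sym_convex_body R n.+1).
Local Notation V := 'rV[R]_n.+1.
Local Notation S := (@unit_sphere R n.+1).
Local Notation N := (radial_gauss_map (body_set K)).
Local Notation nu := (cone_measure K).
Hypothesis vol1 : vol K = 1%E.

Let mN : measurable_fun setT N := @measurable_radial_gauss_map R n.+1 K.

Lemma cone_measure_sphereC : nu (~` S) = 0%E.
Proof.
apply/eqP; rewrite eq_le measure_ge0 andbT -(uniform_smooth vol1).
rewrite -[leLHS]/(uniform_on (measurable_body K) (N @^-1` (~` S))).
apply: le_measure; rewrite ?inE.
- rewrite -[X in measurable X]setTI; apply: mN => //.
  by apply: measurableC; exact: measurable_unit_sphere.
- by apply: measurableC; exact: measurable_smooth_points.
- move=> x /=; apply: contra_not => sx.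
  by rewrite /= radial_gauss_map_smooth//; apply: radial_proj_unit; exact: gauge_grad_neq0.
Qed.

Lemma cone_measure_sphere : nu S = 1%E.
Proof.
have mS := @measurable_unit_sphere R n.+1.
have := cone_measure_sphereC; rewrite probability_setC// => h.
have : nu S \is a fin_num by exact: fin_num_measure.
move: h; case: (nu S) => // r; rewrite -EFinB => -[h] _; congr EFin; lra.
Qed.

Lemma unit_normalsN x : unit_normals K (- x) = [set u | unit_normals K x (- u)].
Proof.
apply/seteqP; split => u /= [u1 H]; split.
- by rewrite /unit_sphere/= enormN.
- by move=> y Ky; rewrite !dotNr -!dotNl; apply: H; exact: body_sym.
- by rewrite /unit_sphere/= -enormN.
- by move=> y Ky; rewrite dotNl -dotNr -[y]opprK dotNl -dotNr; apply: H; exact: body_sym.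
Qed.

Lemma gauss_mapN x : gauss_map K (- x) = - gauss_map K x.
Proof.
have H y v : unit_normals K y = [set v] -> gauss_map K y = v.
  move=> yv; rewrite /gauss_map; case: xgetP => [u _ yu|/(_ v)//].
  by have : [set u] v by rewrite -yu yv.
have HN y v : unit_normals K y = [set v] -> unit_normals K (- y) = [set - v].
  move=> yv; rewrite unit_normalsN yv; apply/seteqP; split => u /=.
    by move=> <-; rewrite opprK.
  by move=> ->; rewrite opprK.
have [[v yv]|nv] := pselect (exists v, unit_normals K x = [set v]).
  by rewrite (H _ _ yv) (H _ _ (HN _ _ yv)).
rewrite /gauss_map xgetPN; last first.
  by move=> v /= yv; apply: nv; exists (- v); rewrite -[x]opprK; exact: HN.
by rewrite xgetPN ?oppr0// => v /= yv; apply: nv; exists v.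
Qed.

Lemma radial_gauss_mapN x : N (- x) = - N x.
Proof.
rewrite /radial_gauss_map (_ : radial_fun K (- x) = radial_fun K x).
  by rewrite scalerN gauss_mapN.
by apply: invr_inj; exact: gaugeN.
Qed.

Lemma cone_measureN (A : set V) : measurable A -> nu [set u | A (- u)] = nu A.
Proof.
move=> mA; have mNA : measurable (N @^-1` A) by rewrite -[X in measurable X]setTI; exact: mN.
have -> : nu [set u | A (- u)] = vol ((fun x => - x) @^-1` (N @^-1` A `&` body_set K)).
  rewrite -[LHS]/(uniform_on (measurable_body K) _) uniformE//; congr (vol _).
  apply/seteqP; split => x /= [Ax Kx].
    by rewrite radial_gauss_mapN; split => //; exact: body_sym.
  by split; [rewrite -radial_gauss_mapN|move: Kx => /body_sym; rewrite opprK].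
rewrite volN; last by apply: measurableI => //; exact: measurable_body.
by rewrite -uniformE.
Qed.

Let mS := @measurable_unit_sphere R n.+1.

Lemma cone_integrable (f : V -> R) M : measurable_fun setT f ->
  (forall u, S u -> `|f u| <= M) -> nu.-integrable S (EFin \o f).
Proof.
by move=> mf fM; apply: (@bounded_integrable _ _ _ nu S f M) => //; exact: measurable_funTS.
Qed.

Lemma cone_integralN (f : V -> R) M : measurable_fun setT f ->
  (forall u, S u -> `|f u| <= M) -> \int[nu]_(u in S) f (- u) = \int[nu]_(u in S) f u.
Proof.
move=> mf fM; have mneg : measurable_fun setT (fun u : V => - u).
  by apply: measurable_rV_coords => x; apply: (@cvgN _ _ _ (nbhs x)); exact: cvg_id.
have SN : (fun u : V => - u) @^-1` S = S.
  by apply/seteqP; split => u; rewrite /unit_sphere/= enormN.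
rewrite /Rintegral; congr fine.
have := @integral_pushforward _ _ V V R (fun u => - u) mneg nu S (EFin \o f).
rewrite SN => <- //; last 2 first.
- by apply/measurable_EFinP.
- apply: (@bounded_integrable _ _ _ nu S (fun u => f (- u)) M) => //.
    by apply: measurable_funTS; exact: measurableT_comp.
  by move=> u u1; apply: fM; rewrite /unit_sphere/= enormN.
apply: eq_measure_integral => A mA _; exact: cone_measureN.
Qed.

Lemma cone_integral_cst c : \int[nu]_(u in S) c = c.
Proof.
by rewrite Rintegral_cst//[X in fine X]cone_measure_sphere mulr1.
Qed.

Definition mean_log_support : R := \int[nu]_(u in S) ln (support_fun K u).

Lemma mean_log_grad_support : mean_log_grad K = (- mean_log_support)%:E.
Proof.
rewrite /mean_log_support /Rintegral cone_support_formula//.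
have f : mean_log_grad K \is a fin_num.
  by apply: integrable_fin_num => //; exact: integrable_log_grad.
by rewrite fineN opprK fineK.
Qed.

Lemma log_support_integrable (L : sym_convex_body R n.+1) :
  nu.-integrable S (EFin \o (fun u => ln (support_fun L u))).
Proof.
have [M MB] := ln_support_bounded L; apply: (cone_integrable (M := M)) => //.
by apply: measurableT_comp => //; exact: measurable_support_fun.
Qed.

(** The log-Minkowski inequality for the dilate of [L] of unit volume: the factor [a] adds [ln a],
    that is - ln |L| / (n + 1), to the logarithm of the support function. *)
Lemma mean_log_support_minimal (L : sym_convex_body R n.+1) :
  log_minkowski R n.+1 -> mean_log_support + ln (fine (vol L)) / n.+1%:R <=
    \int[nu]_(u in S) ln (support_fun L u).
Proof.
move=> logM; have vL0 := vol_body_gt0 L; have vLoo := vol_body_lty L.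
have vLE : vol L = (fine (vol L))%:E by rewrite fineK// gt0_fin_numE.
have [v vE] : exists v, v = fine (vol L) by eexists.
have v0 : 0 < v by rewrite vE fine_gt0// vL0.
have vi0 : 0 < v^-1 by rewrite invr_gt0.
have [a a0 aE] := exists_root vi0 (ltn0Sn n).
have volL : vol (scale_body L a0) = 1%E.
  by rewrite vol_scale_body vLE -vE aE -EFinM mulVf// gt_eqF.
have lna : ln a = - (ln v / n.+1%:R).
  apply: (@mulIf _ n.+1%:R) => //; rewrite mulNr divfK// mulr_natr -lnXn// aE lnV//.
have i1 := log_support_integrable L; have i2 := log_support_integrable K.
have i3 : nu.-integrable S (EFin \o (fun=> ln a)).
  by apply: (cone_integrable (M := `|ln a|)).
have i4 := integrableB mS i1 i2.
have := logM _ (scale_body L a0) vol1 volL => /fine_ge0.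
rewrite (_ : fine _ = \int[nu]_(u in S) (ln a + (ln (support_fun L u) - ln (support_fun K u)))).
  rewrite RintegralD// RintegralB// cone_integral_cst -/mean_log_support lna -vE.
  by move: (ln v / _) (\int[nu]_(x in S) ln (support_fun L x)) => x y; lra.
rewrite /Rintegral; congr fine; apply: eq_integral => u /set_mem u1.
have p1 := support_fun_gt0 L u1; have p2 := support_fun_gt0 K u1.
by rewrite support_scale_body ln_div ?posrE ?mulr_gt0// lnM ?posrE// addrA.
Qed.
End cone_measure_facts.

Section dual_bound.
Variables (R : realType) (n : nat) (C1 C2 : sym_convex_body R n.+1).
Local Notation V := 'rV[R]_n.+1.
Local Notation S := (@unit_sphere R n.+1).
Hypothesis logM : log_minkowski R n.+1.
Hypothesis vol1 : vol C1 = 1%E.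
Hypothesis vol2 : vol C2 = 1%E.

Definition transport_bound : R :=
  - (mean_log_support C1 + mean_log_support C2) - ln (min_volume_product R n.+1) / n.+1%:R.

(* The Wulff shape of the even function exp (- (phi u + phi (- u)) / 2) and its polar have
   support functions below exp (- phi) and exp (- psi), up to symmetrisation. *)
Lemma dual_bound (phi psi : V -> R) (M : R) :
  measurable_fun setT phi -> measurable_fun setT psi ->
  (forall u, S u -> `|phi u| <= M) -> (forall u, S u -> `|psi u| <= M) ->
  (forall u v, S u -> S v -> ((phi u + psi v)%:E <= alpha u v)%E) ->
  \int[cone_measure C1]_(u in S) phi u + \int[cone_measure C2]_(u in S) psi u
    <= transport_bound.
Proof.
move=> mphi mpsi phiM psiM phipsi.
have SN u : S u -> S (- u) by rewrite /unit_sphere/= enormN.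
have mneg : measurable_fun setT (fun u : V => - u).
  by apply: measurable_rV_coords => x; apply: (@cvgN _ _ _ (nbhs x)); exact: cvg_id.
have mS := @measurable_unit_sphere R n.+1.
pose sphi u := (phi u + phi (- u)) / 2; pose spsi u := (psi u + psi (- u)) / 2.
have sM (f : V -> R) u : (forall u, S u -> `|f u| <= M) -> S u -> - M <= (f u + f (- u)) / 2 <= M.
  move=> fM u1; have := fM _ u1; have := fM _ (SN _ u1).
  by rewrite !ler_norml => /andP[h1 h2] /andP[h3 h4]; apply/andP; split; lra.
have half (K : sym_convex_body R n.+1) (f : V -> R) : vol K = 1%E -> measurable_fun setT f ->
    (forall u, S u -> `|f u| <= M) ->
    (\int[cone_measure K]_(u in S) - ((f u + f (- u)) / 2) =
      - (\int[cone_measure K]_(u in S) f u)) /\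
    (cone_measure K).-integrable S (EFin \o (fun u : V => - ((f u + f (- u)) / 2))).
  move=> vK mf fM.
  have mfN : measurable_fun setT (fun u : V => f (- u)) by exact: measurableT_comp.
  have fNM u : S u -> `|f (- u)| <= M by move=> /SN; exact: fM.
  split; last first.
    apply: (@cone_integrable _ _ _ _ M).
      by apply: measurable_funN; apply: measurable_funM => //; exact: measurable_funD.
    by move=> u u1; rewrite normrN ler_norml; exact: sM.
  transitivity (\int[cone_measure K]_(u in S) (- (1 / 2) * (f u + f (- u)))).
    by apply: eq_Rintegral => u _; field.
  have i1 := cone_integrable K mf fM; have i2 := cone_integrable K mfN fNM.
  rewrite RintegralZl ?RintegralD ?(cone_integralN vK mf fM)//; first by field.
  have mfD : measurable_fun setT (fun u : V => f u + f (- u)) by exact: measurable_funD.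
  apply: (cone_integrable K mfD (M := M + M)).
  by move=> u u1; rewrite (le_trans (ler_normD _ _))// lerD//; [exact: fM|exact: fNM].
(* According to the sign of [dot u v], the constraint is averaged over (u, v) and (-u, -v), or over
   (-u, v) and (u, -v). Both averages contain the same symmetrised potentials, so the absolute value
   is bounded in either case. *)
have sym_le u v : S u -> S v -> `|dot u v| <= expR (- sphi u) * expR (- spsi v).
  have le_exp x y : S x -> S y -> 0 < dot x y -> ln (dot x y) <= - (phi x + psi y).
    move=> x1 y1 d0; have := phipsi _ _ x1 y1; rewrite /alpha d0 lee_fin div1r lnV ?posrE//; lra.
  move=> u1 v1; rewrite -expRD.
  have [d0|d0|->] := ltgtP (dot u v) 0; last by rewrite normr0 expR_ge0.
    have h1 := le_exp _ _ (SN _ u1) v1; have h2 := le_exp _ _ u1 (SN _ v1).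
    move: h1 h2; rewrite dotNl dotNr oppr_gt0 => /(_ d0) h1 /(_ d0) h2.
    by rewrite ltr0_norm// -[leLHS]lnK ?posrE ?oppr_gt0// ler_expR /sphi /spsi; lra.
  have h1 := le_exp _ _ u1 v1 d0; have h2 := le_exp _ _ (SN _ u1) (SN _ v1).
  move: h2; rewrite dotNl dotNr opprK => /(_ d0) h2.
  by rewrite gtr0_norm// -[leLHS]lnK ?posrE// ler_expR /sphi /spsi; lra.
have [L LE] : exists L : sym_convex_body R n.+1,
    body_set L = [set y | forall u, S u -> `|dot y u| <= expR (- sphi u)].
  apply: (@wulff_body R n.+1 _ (expR (- M)) (expR M)); first exact: expR_gt0.
  by move=> u u1; have /andP[h1 h2] := sM _ _ phiM u1; rewrite !ler_expR /sphi; apply/andP; split; lra.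
have hL u : S u -> ln (support_fun L u) <= - sphi u.
  move=> u1; rewrite -[leRHS]expRK ler_ln ?posrE ?expR_gt0 ?support_fun_gt0//.
  apply: support_fun_le => x; rewrite LE => /(_ _ u1); exact: le_trans (ler_norm _).
(* By [sym_le] the vector v / exp (- spsi v) belongs to [L]; testing the elements of the polar
   against it bounds the support function of the polar. *)
have hL' v : S v -> ln (support_fun (polar_body L) v) <= - spsi v.
  move=> v1; rewrite -[leRHS]expRK ler_ln ?posrE ?expR_gt0 ?support_fun_gt0//.
  apply: support_fun_le => y; rewrite polar_bodyE => Ly.
  have e0 := expR_gt0 (- spsi v).
  have := Ly ((expR (- spsi v))^-1 *: v); rewrite dotZl ler_pdivrMl// mulr1 dotC; apply.
  rewrite LE => u u1; rewrite dotZl normrM gtr0_norm ?invr_gt0// ler_pdivrMl// dotC.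
  by rewrite [leRHS]mulrC; exact: sym_le.
have [I1 J1] := half C1 phi vol1 mphi phiM; have [I2 J2] := half C2 psi vol2 mpsi psiM.
have [x xE] : exists x, x = ln (fine (vol L)) / n.+1%:R by eexists.
have [y yE] : exists y, y = ln (fine (vol (polar_body L))) / n.+1%:R by eexists.
have h1 : mean_log_support C1 + x <= \int[cone_measure C1]_(u in S) ln (support_fun L u).
  by rewrite xE; exact: mean_log_support_minimal.
have h2 : mean_log_support C2 + y <=
    \int[cone_measure C2]_(u in S) ln (support_fun (polar_body L) u).
  by rewrite yE; exact: mean_log_support_minimal.
have h3 := le_Rintegral mS (log_support_integrable C1 L) J1 hL.
have h4 := le_Rintegral mS (log_support_integrable C2 (polar_body L)) J2 hL'.
have cS : ln (min_volume_product R n.+1) <= ln (fine (vol L)) + ln (fine (vol (polar_body L))).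
  have f0 (K : sym_convex_body R n.+1) : 0 < fine (vol K).
    by rewrite fine_gt0// vol_body_gt0 vol_body_lty.
  rewrite -lnM ?posrE ?f0// ler_ln ?posrE ?mulr_gt0 ?f0 ?min_volume_product_gt0//.
  by rewrite polar_bodyE; exact: min_volume_product_le.
have : ln (min_volume_product R n.+1) / n.+1%:R <= x + y.
  by rewrite xE yE -mulrDl ler_pM2r// invr_gt0.
rewrite /transport_bound; move: h1 h2 h3 h4; rewrite I1 I2.
move: (ln _ / _) => z.
move: (\int[cone_measure C1]_(x in S) ln _) (\int[cone_measure C2]_(x in S) ln _) => p q.
lra.
Qed.
End dual_bound.

(** * Upper bound of the transport cost *)

Section discretisation.
Variables (R : realType) (n : nat).
Local Notation V := 'rV[R]_n.+1.
Local Notation S := (@unit_sphere R n.+1).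
Implicit Types (e : R) (u v : V).

Lemma sphere_partition e : 0 < e -> exists r (c : 'I_r -> V) (G : 'I_r -> set V),
  [/\ forall i, S (c i), forall i, measurable (G i), forall i, G i `<=` ball (c i) e &
    forall u, S u -> exists i, G i u /\ forall j, G j u -> j = i].
Proof.
move=> e0; have := @compact_unit_sphere R n.+1; rewrite compact_cover.
move=> /(_ V S (fun c => ball c e))[|u u1|D DS SD].
- by move=> c _; exact: ball_open.
- by exists u => //; exact: ballxx.
pose s : seq V := finmap.enum_fset D; pose c (i : 'I_(size s)) := nth 0 s i.
pose F k := if (k < size s)%N then ball (nth 0 s k) e else set0.
have mF k : measurable (F k).
  by rewrite /F; case: ifP => // _; apply: open_measurable_rV; exact: ball_open.
exists (size s), c, (fun i => seqDU F i); split.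
- by move=> i; apply/set_mem/(DS (c i)); exact: (mem_nth 0 (ltn_ord i)).
- by move=> i; apply: measurableD => //; exact: bigsetU_measurable.
- by move=> i u [Fu _]; move: Fu; rewrite /F ltn_ord.
- move=> u u1; have [x xD xu] := SD u u1.
  have xs : (index x s < size s)%N by rewrite index_mem; exact: xD.
  have : (\bigcup_k F k) u by exists (index x s) => //; rewrite /F xs nth_index//.
  rewrite seqDU_bigcup_eq => -[k _ ku].
  have ks : (k < size s)%N by move: ku => [+ _]; rewrite /F; case: ifP.
  exists (Ordinal ks); split => // j ju; apply: val_inj => /=.
  by apply: (trivIset_seqDU F) => //; exists u.
Qed.

Lemma Rintegral_sum d (T : measurableType d) (mu : {measure set T -> \bar R}) (D : set T)
    (I : Type) (s : seq I) (f : I -> T -> R) : measurable D ->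
  (forall i, mu.-integrable D (EFin \o f i)) ->
  mu.-integrable D (EFin \o (fun x => \sum_(i <- s) f i x)) /\
  \int[mu]_(x in D) (\sum_(i <- s) f i x) = \sum_(i <- s) \int[mu]_(x in D) f i x.
Proof.
move=> mD If; elim: s => [|i s [IH1 IH2]].
  have E : (fun x : T => \sum_(i <- [::]) f i x) = (fun=> 0) by apply/funext => x; rewrite big_nil.
  by rewrite E big_nil; split; [exact: integrable0|rewrite Rintegral_cst// mul0r].
have E : (fun x => \sum_(j <- i :: s) f j x) = (fun x => f i x + \sum_(j <- s) f j x).
  by apply/funext => x; rewrite big_cons.
rewrite E big_cons; split; first exact: (integrableD mD (If i) IH1).
by rewrite RintegralD// IH2.
Qed.

(** A bounded continuous substitute for [alpha]: the shift [e] absorbs the variation of [dot] over a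
    pair of cells and removes the singularity at 0. The outer maximum restores nonnegativity when
    the shifted product exceeds 1. *)
Definition grid_cost e u v : R := Num.max 0 (- ln (Num.max (dot u v) 0 + e)).

(** Balls are those of the sup norm and coordinates on the sphere are at most 1, so each of the
    [n.+1] products moves by at most [2 * e]. *)
Lemma dot_ball e a b u v : S a -> S v -> ball a e u -> ball b e v ->
  dot u v <= dot a b + n.+1%:R * (2 * e).
Proof.
move=> a1 v1 au bv.
rewrite -lerBlDl /dot -sumrB.
rewrite (_ : n.+1%:R * (2 * e) = \sum_(i < n.+1) (2 * e)); last first.
  by rewrite sumr_const card_ord mulr_natl.
apply: ler_sum => i _.
have := au.2 0 i; have := bv.2 0 i; rewrite /ball/= => h1 h2.
have va : `|v 0 i| <= 1 by rewrite -v1 coord_le_enorm.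
have aa : `|a 0 i| <= 1 by rewrite -a1 coord_le_enorm.
rewrite (_ : u 0 i * v 0 i - _ = - ((a 0 i - u 0 i) * v 0 i) - a 0 i * (b 0 i - v 0 i)); last by ring.
rewrite (le_trans (ler_norm _))// (le_trans (ler_normB _ _))// normrN !normrM.
have h3 : `|a 0 i - u 0 i| * `|v 0 i| <= e * 1 by rewrite ler_pM// ltW.
have h4 : `|a 0 i| * `|b 0 i - v 0 i| <= 1 * e by rewrite ler_pM// ltW.
lra.
Qed.

Lemma grid_cost_le_alpha e a b u v : 0 < e -> S a -> S u -> S v -> ball a e u -> ball b e v ->
  ((grid_cost (n.+1%:R * (2 * e)) a b)%:E <= alpha u v)%E.
Proof.
move=> e0 a1 u1 v1 au bv; rewrite /alpha; case: ltP => d0; last by rewrite leey.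
have d1 : dot u v <= 1 by rewrite (le_trans (dot_le _ _))// u1 v1 mulr1.
have h := dot_ball a1 v1 au bv.
rewrite lee_fin /grid_cost ge_max div1r lnV ?posrE// oppr_ge0 ln_le0//= lerN2.
rewrite ler_ln ?posrE//; last first.
  by rewrite (lt_le_trans d0)// (le_trans h)// lerD2r le_max lexx.
by rewrite (le_trans h)// lerD2r le_max lexx.
Qed.

Variables (C1 C2 : sym_convex_body R n.+1).
Local Notation nu1 := (cone_measure C1).
Local Notation nu2 := (cone_measure C2).
Hypothesis logM : log_minkowski R n.+1.
Hypothesis vol1 : vol C1 = 1%E.
Hypothesis vol2 : vol C2 = 1%E.

Lemma sphere_nonempty : exists u, S u.
Proof.
exists (delta_mx 0 ord0); rewrite /unit_sphere/= /enorm dot_delta mxE !eqxx sqrtr1//.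
Qed.

(* On a pair of cells [grid_cost] is below alpha, so that feasible discrete potentials give step
   functions to which [dual_bound] applies. *)
Lemma discrete_plan e : 0 < e -> exists (I : finType) (w : I -> R) (z : I -> V * V),
  [/\ forall i, 0 <= w i, \sum_i w i = 1, forall i, S (z i).1 /\ S (z i).2,
    forall F A : set V, open A -> (forall x, F x -> ball x e `<=` A) ->
      ((\sum_i w i * \1_F (z i).1)%:E <= nu1 A)%E /\
      ((\sum_i w i * \1_F (z i).2)%:E <= nu2 A)%E &
    \sum_i w i * grid_cost (n.+1%:R * (2 * e)) (z i).1 (z i).2 <= transport_bound C1 C2].
Proof.
move=> e0; have [r [c [G [cS mG Gc SG]]]] := sphere_partition e0.
have mS := @measurable_unit_sphere R n.+1.
pose step (y : 'I_r -> R) u := \sum_i y i * \1_(G i) u.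
have stepE y u i : G i u -> (forall j, G j u -> j = i) -> step y u = y i.
  move=> Gi Gu; rewrite /step (bigD1 i)//= indicE mem_set// mulr1 big1 ?addr0// => j ji.
  by rewrite indicE memNset ?mulr0// => /Gu; apply/eqP.
have mstep y : measurable_fun setT (step y).
  by apply: measurable_sum => i; apply: measurable_funM => //; exact: measurable_indic.
have stepM y u : S u -> `|step y u| <= \sum_i `|y i|.
  move=> /SG[i [Gi Gu]]; rewrite (stepE _ _ _ Gi Gu) (bigD1 i)//= lerDl.
  by apply: sumr_ge0.
pose p (K : sym_convex_body R n.+1) i := \int[cone_measure K]_(u in S) \1_(G i) u.
have int_indic (K : sym_convex_body R n.+1) A : measurable A ->
    (cone_measure K).-integrable S (EFin \o (\1_A : V -> R)).
  move=> mA; apply: (cone_integrable K (M := 1)); first exact: measurable_indic.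
  by move=> u _; rewrite indicE; case: (_ \in _); rewrite ?normr1// normr0.
have int_step (K : sym_convex_body R n.+1) y :
    \int[cone_measure K]_(u in S) step y u = \sum_i y i * p K i.
  have Iy i : (cone_measure K).-integrable S (EFin \o (fun u => y i * \1_(G i) u)).
    have mf : measurable_fun setT (fun u : V => y i * \1_(G i) u).
      by apply: measurable_funM => //; exact: measurable_indic.
    apply: (cone_integrable K mf (M := `|y i|)) => u _.
    by rewrite normrM indicE; case: (_ \in _); rewrite ?normr1 ?mulr1// normr0 mulr0.
  rewrite /step (Rintegral_sum _ mS Iy).2; apply: eq_bigr => i _.
  by rewrite RintegralZl//; exact: int_indic.
(* Plans live on pairs of cells. The constraints are indexed by a disjoint union, one side for each
   marginal, so that dual variables are pairs of discrete potentials. *)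
pose a (t : 'I_r * 'I_r) (k : 'I_r + 'I_r) : R :=
  match k with inl i => (i == t.1)%:R | inr j => (j == t.2)%:R end.
pose b (k : 'I_r + 'I_r) : R := match k with inl i => p C1 i | inr j => p C2 j end.
pose cost (t : 'I_r * 'I_r) := grid_cost (n.+1%:R * (2 * e)) (c t.1) (c t.2).
have sum_delta (y : 'I_r -> R) i : \sum_j y j * (j == i)%:R = y i.
  rewrite (bigD1 i)//= eqxx mulr1 big1 ?addr0// => j /negbTE ->; exact: mulr0.
have sum_a (y : 'I_r + 'I_r -> R) t : \sum_k y k * a t k = y (inl t.1) + y (inr t.2).
  by rewrite big_sumType /= !sum_delta.
have sum_b (y : 'I_r + 'I_r -> R) : \sum_k y k * b k =
    \int[nu1]_(u in S) step (y \o inl) u + \int[nu2]_(u in S) step (y \o inr) u.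
  by rewrite big_sumType /= !int_step.
have int_s K y := cone_integrable K (mstep y) (stepM y).
have [u0 u01] := sphere_nonempty.
have [|y m H|w [w0 w1 wa wc]] := @finite_duality R _ _ a b cost (transport_bound C1 C2).
(* With no cost involved, the pointwise bound on the sphere is integrated in one variable and then
   in the other. *)
- move=> y m H; rewrite sum_b.
  have H' u v : S u -> S v -> step (y \o inl) u + step (y \o inr) v <= m.
    move=> /SG[i [Gi Gu]] /SG[j [Gj Gv]].
    by rewrite (stepE _ _ _ Gi Gu) (stepE _ _ _ Gj Gv); have := H (i, j); rewrite sum_a.
  have icst (K : sym_convex_body R n.+1) x : (cone_measure K).-integrable S (EFin \o (fun=> x)).
    by apply: (cone_integrable K (M := `|x|)).
  rewrite -lerBrDl -[leRHS](cone_integral_cst vol2).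
  apply: (le_Rintegral mS (int_s C2 _) (icst C2 _)) => v v1.
  rewrite lerBrDl -lerBrDr -[leRHS](cone_integral_cst vol1).
  apply: (le_Rintegral mS (int_s C1 _) (icst C1 _)) => u u1.
  by rewrite lerBrDr; exact: H'.
- rewrite sum_b.
  (* The slack [m] is absorbed into the first potential, [nu1] having mass one on the sphere; the
     potentials are then admissible for [dual_bound]. *)
  have E : \int[nu1]_(u in S) step (y \o inl) u = \int[nu1]_(u in S) (step (y \o inl) u - m) + m.
    have im : nu1.-integrable S (EFin \o (fun=> m)).
      by apply: (cone_integrable C1 (M := `|m|)).
    by rewrite (RintegralB mS (int_s C1 _) im) (cone_integral_cst vol1) subrK.
  rewrite E addrAC lerD2r.
  pose M := (\sum_i `|y (inl i)| + `|m|) + \sum_i `|y (inr i)|.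
  apply: (dual_bound logM vol1 vol2 (M := M)) => //.
  + by apply: measurable_funB.
  + move=> u u1; rewrite (le_trans (ler_normB _ _))// /M -addrA lerD ?stepM// lerDl sumr_ge0//.
  + by move=> u u1; rewrite (le_trans (stepM _ _ u1))// /M lerDr addr_ge0// sumr_ge0.
  + move=> u v u1 v1; have [i [Gi Gu]] := SG _ u1; have [j [Gj Gv]] := SG _ v1.
    apply: le_trans (grid_cost_le_alpha e0 (cS i) u1 v1 (Gc _ _ Gi) (Gc _ _ Gj)).
    rewrite lee_fin (stepE _ _ _ Gi Gu) (stepE _ _ _ Gj Gv).
    by have := H (i, j); rewrite sum_a /= /cost/=; lra.
exists ('I_r * 'I_r)%type, w, (fun t => (c t.1, c t.2)); split => //.
  by move=> t; split; exact: cS.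
(* A centre lying in [F] forces its whole cell into [A], since the cell is within [e] of its
   centre. *)
have mass (K : sym_convex_body R n.+1) (F A : set V) : vol K = 1%E -> open A ->
    (forall x, F x -> ball x e `<=` A) ->
    ((\sum_i \1_F (c i) * p K i)%:E <= cone_measure K A)%E.
  move=> vK oA FA; have mA := open_measurable_rV oA.
  rewrite -int_step.
  have fA : (cone_measure K A) \is a fin_num by exact: fin_num_measure.
  have mAS : measurable (A `&` S) by apply: measurableI.
  have fAS : (cone_measure K (A `&` S)) \is a fin_num by exact: fin_num_measure.
  apply: (@le_trans _ _ (cone_measure K (A `&` S))); last first.
    by apply: le_measure; [exact: mem_set|exact: mem_set|exact: subIsetl].
  rewrite -(fineK fAS) lee_fin -integral_indic//.
  apply: (le_Rintegral mS (int_s K _) (int_indic K _ mA)) => u /SG[i [Gi Gu]]; rewrite (stepE _ _ _ Gi Gu) !indicE.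
  have [Fi|nFi] := boolP (c i \in F); last by case: (_ \in _).
  by rewrite mem_set//; apply: (FA (c i)); [exact: set_mem|exact: Gc].
have pushw (f : 'I_r -> R) (g : 'I_r * 'I_r -> 'I_r) (q : 'I_r -> R) :
    (forall i, \sum_t w t * (i == g t)%:R = q i) ->
    \sum_t w t * f (g t) = \sum_i f i * q i.
  move=> wq; under [RHS]eq_bigr do rewrite -wq mulr_sumr.
  rewrite exchange_big /=; apply: eq_bigr => t _.
  rewrite (bigD1 (g t))//= eqxx mulr1 big1 ?addr0 1?mulrC// => i ig.
  by rewrite (negbTE ig) !mulr0.
move=> F A oA FA; split.
  rewrite (pushw (fun i => \1_F (c i)) fst (p C1)); last by move=> i; exact: (wa (inl i)).
  exact: mass.
rewrite (pushw (fun i => \1_F (c i)) snd (p C2)); last by move=> i; exact: (wa (inr i)).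
exact: mass.
Qed.
End discretisation.

Section optimal_transport.
Variables (R : realType) (n : nat).
Local Notation V := 'rV[R]_n.+1.
Local Notation S := (@unit_sphere R n.+1).
Implicit Types (e : R) (u v : V).

Lemma grid_cost_ge0 e u v : 0 <= grid_cost e u v.
Proof. by rewrite le_max lexx. Qed.

Lemma grid_cost_anti e e' u v : 0 < e -> e <= e' -> grid_cost e' u v <= grid_cost e u v.
Proof.
move=> e0 ee'; have m0 : 0 <= Num.max (dot u v) 0 by rewrite le_max lexx orbT.
rewrite /grid_cost ge_max le_max lexx /= le_max lerN2 ler_ln ?posrE ?ltr_wpDl// ?(lt_le_trans e0)//.
by rewrite lerD2l ee' orbT.
Qed.

Lemma grid_cost_bound e u v : 0 < e <= 1 -> 0 <= grid_cost e u v <= - ln e.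
Proof.
move=> /andP[e0 e1]; rewrite grid_cost_ge0 /grid_cost ge_max oppr_ge0 ln_le0//= lerN2.
have m0 : 0 <= Num.max (dot u v) 0 by rewrite le_max lexx orbT.
by rewrite ler_ln ?posrE ?ltr_wpDl// lerDr.
Qed.

Let max0_continuous (T : topologicalType) (f : T -> R) (p : T) :
  {for p, continuous f} -> {for p, continuous (fun x => Num.max 0 (f x))}.
Proof.
by move=> cf; apply: (@continuous_max R _ (fun=> 0) f p) => //; exact: cvg_cst.
Qed.

Lemma grid_cost_continuous e : 0 < e -> continuous (fun p : V * V => grid_cost e p.1 p.2).
Proof.
move=> e0 p; have m0 : 0 <= Num.max (dot p.1 p.2) 0 by rewrite le_max lexx orbT.
apply: (@max0_continuous _ (fun q : V * V => - ln (Num.max (dot q.1 q.2) 0 + e)) p).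
apply: (@cvgN _ _ _ (nbhs p)).
have h : Num.max (dot q.1 q.2) 0 + e @[q --> p] --> Num.max (dot p.1 p.2) 0 + e.
  apply: (@cvgD _ _ _ (nbhs p)); last exact: cvg_cst.
  rewrite maxC; under eq_fun do rewrite maxC.
  apply: (@max0_continuous _ (fun q : V * V => dot q.1 q.2) p).
  by apply: (@cvg_dot _ _ _ (nbhs p)); [exact: cvg_fst|exact: cvg_snd].
by apply: (cvg_comp _ _ h); apply: continuous_ln; rewrite ltr_wpDl.
Qed.

Lemma measurable_grid_cost e : measurable_fun setT (fun p : V * V => grid_cost e p.1 p.2).
Proof.
apply: measurable_maxr; first exact: measurable_cst.
apply: measurable_funN; apply: measurableT_comp => //.
apply: measurable_funD => //; apply: measurable_maxr => //.
apply: measurable_sum => i; apply: measurable_funM.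
  exact: (measurableT_comp (@measurable_coord R n.+1 i) measurable_fst).
exact: (measurableT_comp (@measurable_coord R n.+1 i) measurable_snd).
Qed.

Lemma alpha_le_sup u v : S u -> S v ->
  (alpha u v <= ereal_sup (range (fun k : nat => (grid_cost k.+1%:R^-1 u v)%:E)))%E.
Proof.
move=> u1 v1; set s := ereal_sup _.
have ub k : ((grid_cost k.+1%:R^-1 u v)%:E <= s)%E by apply: ereal_sup_ubound; exists k.
have small e : 0 < e -> exists k : nat, k.+1%:R^-1 <= e.
  move=> e0; exists (Num.bound e^-1); rewrite invf_ple ?posrE//.
  by rewrite ltW// (lt_trans (archi_boundP _))// ?invr_ge0 ?ltW// ltr_nat.
rewrite /alpha; case: ltP => d0.
  rewrite div1r lnV ?posrE//; apply/lee_addgt0Pr => e e0.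
  (* Chosen so that [dot u v + k.+1%:R^-1] is at most [dot u v * (1 + e)]; the logarithm then loses
     at most [e]. *)
  have [k ke] := small (dot u v * e) (mulr_gt0 d0 e0).
  rewrite -leeBlDr// (le_trans _ (ub k))// -EFinB lee_fin /grid_cost le_max; apply/orP; right.
  have l1 : ln (dot u v + k.+1%:R^-1) <= ln (dot u v * (1 + e)).
    by rewrite ler_ln ?posrE ?mulr_gt0 ?addr_gt0// mulrDr mulr1 lerD2l.
  have l2 : ln (1 + e) <= e by apply: le_ln1Dx; lra.
  move: l1; rewrite lnM ?posrE ?addr_gt0// max_l; [lra|exact: ltW].
suff -> : s = +oo%E by rewrite leey.
(* Where [dot u v <= 0] the cost is governed by the shift alone, and reaches [A] once the shift is
   at most [expR (- A)]. *)
apply/eqyP => A A0; have [k ke] := small (expR (- A)) (expR_gt0 _).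
rewrite (le_trans _ (ub k))// lee_fin /grid_cost [Num.max (dot u v) 0]max_r// add0r le_max lerNr; apply/orP; right.
by rewrite -[leRHS]expRK ler_ln ?posrE ?expR_gt0.
Qed.

Variables (C1 C2 : sym_convex_body R n.+1).
Local Notation nu1 := (cone_measure C1).
Local Notation nu2 := (cone_measure C2).
Hypothesis logM : log_minkowski R n.+1.
Hypothesis vol1 : vol C1 = 1%E.
Hypothesis vol2 : vol C2 = 1%E.

Let plan_choice (P : nat -> forall I : finType, (I -> R) -> (I -> V * V) -> Prop) :
  (forall k, exists I w z, P k I w z) ->
  exists (I : nat -> finType) (w : forall k, I k -> R) (z : forall k, I k -> V * V),
    forall k, P k (I k) (w k) (z k).
Proof.
move=> H; have plan k : {I : finType & {w : I -> R & {z : I -> V * V | P k I w z}}}.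
  have [I HI] := cid (H k); have [w Hw] := cid HI.
  by exists I, w; exact: cid.
exists (fun k => projT1 (plan k)), (fun k => projT1 (projT2 (plan k))).
exists (fun k => proj1_sig (projT2 (projT2 (plan k)))) => k.
exact: proj2_sig (projT2 (projT2 (plan k))).
Qed.

(** Two limits. For a fixed scale [k], the plans of finer scale have [f k]-cost at most the bound,
    as grid costs grow when the scale shrinks, and this survives in the limit coupling. Then [k]
    tends to infinity along one and the same coupling. *)
Lemma transport_cost_le : (transport_cost nu1 nu2 <= (transport_bound C1 C2)%:E)%E.
Proof.
have e0 (k : nat) : 0 < k.+1%:R^-1 :> R by rewrite invr_gt0.
have e1 (k : nat) : k.+1%:R^-1 <= 1 :> R by rewrite invf_le1// ler1n.
have cS := @compact_unit_sphere R n.+1.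
have mS := @measurable_unit_sphere R n.+1.
have [I [w [z P]]] := plan_choice (fun k => discrete_plan logM vol1 vol2 (e0 k)).
(* A compact set inside an open one stays at a positive distance from its complement, so cells of
   small radius centred in [F] lie in [A]. *)
have nearF (F A : set V) : closed F -> open A -> F `<=` A -> F `<=` S ->
    \forall k \near \oo, forall x, F x -> ball x k.+1%:R^-1 `<=` A.
  move=> cF oA FA FS; have := subclosed_compact cF cS FS.
  move/compact_near_coveringP => /(_ _ \oo (fun (k : nat) x => ball x k.+1%:R^-1 `<=` A)).
  apply => x Fx; have : nbhs x A by apply: open_nbhs_nbhs; split => //; exact: FA.
  move=> /nbhs_ballP[d /= d0 dA]; have d20 : 0 < d / 2 by rewrite divr_gt0.
  exists (ball x (d / 2), [set k : nat | k.+1%:R^-1 < d / 2]).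
    by split; [exact: nbhsx_ballx|exact: (near_infty_natSinv_lt (PosNum d20))].
  move=> [y k] [/= xy kd] t yt; apply: dA; rewrite [d]splitr.
  by apply: (ball_triangle xy); exact: (le_ball (ltW kd)).
have [||||||pi cpi Hpi] := @coupling_limit R n.+1 nu1 nu2 S I w z cS.
- by move=> k i; have [w0 _ _ _ _] := P k; exact: w0.
- by move=> k; have [] := P k.
- by move=> k i; have [_ _ H _ _] := P k; exact: (H i).1.
- by move=> k i; have [_ _ H _ _] := P k; exact: (H i).2.
- move=> F A cF oA FA FS; apply: filterS (nearF F A cF oA FA FS) => k kF.
  by have [_ _ _ H _] := P k; exact: (H F A oA kF).1.
- move=> F A cF oA FA FS; apply: filterS (nearF F A cF oA FA FS) => k kF.
  by have [_ _ _ H _] := P k; exact: (H F A oA kF).2.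
pose f (k : nat) (p : V * V) := grid_cost k.+1%:R^-1 p.1 p.2.
have mf k : measurable_fun setT (f k) by exact: measurable_grid_cost.
have intf k : (\int[pi]_x (f k x)%:E <= (transport_bound C1 C2)%:E)%E.
  apply: (Hpi _ (- ln k.+1%:R^-1)) => //.
  - by move=> x; apply: grid_cost_bound; rewrite e0 e1.
  - move=> t; apply: (@open_comp _ _ (f k) [set y | t < y]); last exact: open_gt.
    by move=> p _; exact: grid_cost_continuous.
  (* The plan [j] is built for the shift [n.+1%:R * (2 * j.+1%:R^-1)], which falls below
     [k.+1%:R^-1] as soon as [j.+1%:R^-1] is below this threshold. *)
  - have d0 : 0 < k.+1%:R^-1 / (n.+1%:R * 2) :> R by rewrite divr_gt0// mulr_gt0.
    apply: filterS (near_infty_natSinv_lt (PosNum d0)) => j /= jd.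
    have [w0 _ _ _] := P j; apply: le_trans; apply: ler_sum => i _.
    rewrite ler_wpM2l ?w0//; apply: grid_cost_anti; first by rewrite !mulr_gt0.
    by rewrite mulrA mulrC -ler_pdivlMr ?mulr_gt0// ltW.
apply: ereal_inf_le; eexists; first by exists pi => //; exact: cpi.
have mSS : measurable (S `*` S) by exact: measurableX.
have f_homo p : {homo (fun k => (f k p)%:E) : a b / (a <= b)%N >-> (a <= b)%E}.
  move=> a b ab; rewrite lee_fin; apply: grid_cost_anti; first exact: e0.
  by rewrite lef_pV2 ?posrE// ler_nat.
have mfD k : measurable_fun (S `*` S) (fun p => (f k p)%:E).
  by apply: measurable_funTS; apply/measurable_EFinP.
have f0 k p : (0 <= (f k p)%:E)%E by rewrite lee_fin grid_cost_ge0.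
have := @cvg_monotone_convergence _ _ R pi _ mSS _ mfD (fun k x _ => f0 k x) (fun p _ => f_homo p).
(* Only the bound of [alpha] by the increasing limit of grid costs is used; monotone convergence
   concerns the measurable grid costs. *)
move=> cf; apply: (@le_trans _ _ (\int[pi]_(p in S `*` S) limn (fun k => (f k p)%:E))%E).
  apply: ge0_le_integral_nonmeas => -[u v] [/= u1 v1].
    rewrite /alpha; case: ifP => // d0; rewrite lee_fin div1r lnV ?posrE// oppr_ge0 ln_le0//.
    by rewrite (le_trans (dot_le _ _))// u1 v1 mulr1.
  apply: le_trans (alpha_le_sup u1 v1) _.
  have /(@cvg_lim _ _) := ereal_nondecreasing_cvgn (f_homo (u, v)).
  by move=> ->.
rewrite -(cvg_lim _ cf)//; apply: lime_le; first by apply/cvg_ex; eexists; exact: cf.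
apply: nearW => k; apply: le_trans (intf k).
by apply: ge0_subset_integral => //; apply/measurable_EFinP.
Qed.
End optimal_transport.

(** * Lower bound of the transport cost *)

Section weak_duality.
Variables (R : realType) (n : nat).
Local Notation V := 'rV[R]_n.+1.
Local Notation S := (@unit_sphere R n.+1).

Lemma alpha_ge0 (u v : V) : S u -> S v -> (0 <= alpha u v)%E.
Proof.
move=> u1 v1; rewrite /alpha; case: ifP => // d0; rewrite lee_fin div1r lnV ?posrE//.
by rewrite oppr_ge0 ln_le0// (le_trans (dot_le _ _))// u1 v1 mulr1.
Qed.

Let mS := @measurable_unit_sphere R n.+1.

(** [S]*[S] and the preimage of [S] under [proj] differ by a [pi]-null set; on the latter the change
    of variables applies. *)
Lemma Rintegral_marginal (pi : probability (V * V)%type R) (nu : probability V R)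
    (proj : V * V -> V) (g : V -> R) (M : R) : measurable_fun setT proj ->
  (forall A, measurable A -> pi (proj @^-1` A) = nu A) ->
  measurable_fun setT g -> (forall u, S u -> `|g u| <= M) ->
  (forall p, (S `*` S) p -> S (proj p)) ->
  pi (~` (S `*` S)) = 0%E ->
  pi.-integrable (S `*` S) (EFin \o (g \o proj)) /\
  \int[pi]_(p in S `*` S) g (proj p) = \int[nu]_(u in S) g u.
Proof.
move=> mp pinu mg gM Sproj pi0.
have mD : measurable (proj @^-1` S) by rewrite -[X in measurable X]setTI; exact: mp.
have mSS : measurable (S `*` S) by exact: measurableX.
have mgp : measurable_fun setT (g \o proj) by exact: measurableT_comp.
have ig : pi.-integrable (proj @^-1` S) (EFin \o (g \o proj)).
  apply: (@bounded_integrable _ _ _ pi _ (g \o proj) M mD) => [|p]; last exact: gM.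
  exact: measurable_funTS.
split.
  by apply: (@bounded_integrable _ _ _ pi _ (g \o proj) M mSS) => [|p /Sproj];
    [exact: measurable_funTS|exact: gM].
have mN : measurable (~` (S `*` S)) by exact: measurableC.
rewrite /Rintegral; congr fine.
transitivity (\int[pi]_(p in proj @^-1` S) (g (proj p))%:E)%E.
  rewrite [RHS](negligible_integral mN mD ig pi0); congr (integral _ _ _).
  apply/seteqP; split => [p pS|p [_ /contrapT]//].
  by split; [exact: Sproj|move=> h; exact: h].
have := @integral_pushforward _ _ _ V R proj mp pi S (EFin \o g).
move=> <- //; last exact/measurable_EFinP.
by apply: eq_measure_integral => A mA _; exact: pinu.
Qed.

Lemma weak_duality (nu1 nu2 : probability V R) (g1 g2 : V -> R) (c M : R) :
  nu1 (~` S) = 0%E -> nu2 (~` S) = 0%E ->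
  measurable_fun setT g1 -> measurable_fun setT g2 ->
  (forall u, S u -> `|g1 u| <= M) -> (forall u, S u -> `|g2 u| <= M) ->
  (forall u v, S u -> S v -> ((c - g1 u - g2 v)%:E <= alpha u v)%E) ->
  ((c - \int[nu1]_(u in S) g1 u - \int[nu2]_(u in S) g2 u)%:E <= transport_cost nu1 nu2)%E.
Proof.
move=> nuS1 nuS2 mg1 mg2 gM1 gM2 galpha; apply: le_ereal_inf_tmp => _ [pi cpi <-].
have mSC : measurable (~` S) by exact: measurableC.
have mSS : measurable (S `*` S) by exact: measurableX.
have p1 A : measurable A -> pi (fst @^-1` A) = nu1 A.
  by move=> /cpi[+ _]; rewrite (_ : fst @^-1` A = A `*` setT)//; apply/seteqP; split => x //= [].
have p2 A : measurable A -> pi (snd @^-1` A) = nu2 A.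
  by move=> /cpi[_ +]; rewrite (_ : snd @^-1` A = setT `*` A)//; apply/seteqP; split => x //= [].
have piS : pi (~` (S `*` S)) = 0%E.
  have [h1 _] := cpi _ mSC; have [_ h2] := cpi _ mSC.
  have mA : measurable (~` S `*` [set: V]) by exact: measurableX.
  have mB : measurable ([set: V] `*` ~` S) by exact: measurableX.
  apply/eqP; rewrite eq_le measure_ge0 andbT.
  have -> : ~` (S `*` S) = (~` S `*` setT) `|` (setT `*` ~` S).
    apply/seteqP; split => x /=; last by case=> [[h _] [h' _]|[_ h] [_ h']].
    by move/not_andP => [h|h]; [left|right].
  apply: le_trans (measureU2 pi mA mB) _.
  by rewrite [X in (X + _)%E]h1 [X in (_ + X)%E]h2 nuS1 nuS2 addr0.
have [i1 E1] := @Rintegral_marginal pi nu1 fst g1 M measurable_fst p1 mg1 gM1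
  (fun p h => h.1) piS.
have [i2 E2] := @Rintegral_marginal pi nu2 snd g2 M measurable_snd p2 mg2 gM2
  (fun p h => h.2) piS.
pose G (p : V * V) := c - g1 p.1 - g2 p.2.
have mG : measurable_fun setT G.
  apply: measurable_funB; last exact: (measurableT_comp mg2 measurable_snd).
  by apply: measurable_funB => //; exact: (measurableT_comp mg1 measurable_fst).
have ic x : pi.-integrable (S `*` S) (EFin \o (fun=> x)).
  exact: (@bounded_integrable _ _ _ pi _ (fun=> x) `|x|).
have pS : fine (pi (S `*` S)) = 1.
  have := piS; rewrite probability_setC//.
  have : pi (S `*` S) \is a fin_num by exact: fin_num_measure.
  by case: (pi _) => // r _; rewrite -EFinB => -[]/=; lra.
have GM p : (S `*` S) p -> `|G p| <= `|c| + M + M.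
  move=> [u1 v1]; rewrite /G (le_trans (ler_normB _ _))// lerD ?gM2//.
  by rewrite (le_trans (ler_normB _ _))// lerD ?gM1.
have iG : pi.-integrable (S `*` S) (EFin \o G).
  by apply: (@bounded_integrable _ _ _ pi _ G _ mSS _ GM); exact: measurable_funTS.
have icg : pi.-integrable (S `*` S) (EFin \o (fun p => c - g1 p.1)).
  exact: (integrableB mSS (ic c) i1).
have EG : \int[pi]_(p in S `*` S) G p = c - \int[nu1]_(u in S) g1 u - \int[nu2]_(u in S) g2 u.
  by rewrite RintegralB// RintegralB// E1 E2 Rintegral_cst// pS mulr1.
rewrite -EG /Rintegral fineK; last exact: integrable_fin_num.
(* The comparison with [alpha] requires nonnegative integrands, while [G] may be negative; its
   positive part still lies below [alpha], which is nonnegative on the sphere. *)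
pose G0 p := Num.max 0 (G p).
have mG0 : measurable_fun setT G0 by exact: measurable_maxr.
apply: (@le_trans _ _ (\int[pi]_(p in S `*` S) (G0 p)%:E)%E).
  apply: le_integral => //; last by move=> p _; rewrite lee_fin le_max lexx orbT.
  apply: (@bounded_integrable _ _ _ pi _ G0 (`|c| + M + M) mSS); first exact: measurable_funTS.
  move=> p Sp; rewrite ger0_norm ?le_max ?lexx// ge_max (le_trans _ (GM _ Sp))//.
  by rewrite (le_trans (ler_norm _))// GM.
apply: ge0_le_integral_nonmeas => [p _|[u v] [u1 v1]]; first by rewrite lee_fin le_max lexx.
rewrite EFin_max ge_max alpha_ge0//=; exact: galpha.
Qed.
End weak_duality.

(** * Reduction of the inequality to transport, and sharpness *)

Section assembly.
Variables (R : realType) (n : nat).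
Local Notation V := 'rV[R]_n.+1.
Local Notation S := (@unit_sphere R n.+1).
Local Notation N := (n.+1%:R : R).

(** An equality of propositions, so that rewriting serves both halves of the theorem. The radial
    terms cancel because the entropy carries the dimension once, while the gradient integral carries
    a factor 2 against one half of it. *)
Lemma inequality_transport (C1 C2 : sym_convex_body R n.+1) (c : R) :
  vol C1 = 1%E -> vol C2 = 1%E -> 0 < c ->
  (relative_entropy (radial_measure C1) sphere_measure
   + relative_entropy (radial_measure C2) sphere_measure
   + N%:E * transport_cost (cone_measure C1) (cone_measure C2)
   <= (ln (ball_volume R n.+1 ^+ 2 / c))%:E
    + (N / 2)%:E * \int[sphere_measure]_(u in unit_sphere)
        (ln (1 + enorm (sphere_grad (potential C1) u) ^+ 2 / N ^+ 2)
         * expR (- potential C1 u))%:E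
    + (N / 2)%:E * \int[sphere_measure]_(u in unit_sphere)
        (ln (1 + enorm (sphere_grad (potential C2) u) ^+ 2 / N ^+ 2)
         * expR (- potential C2 u))%:E)%E =
  (N%:E * transport_cost (cone_measure C1) (cone_measure C2)
   <= (- (N * (mean_log_support C1 + mean_log_support C2)) - ln c)%:E)%E.
Proof.
move=> v1 v2 c0; rewrite !entropy_formula// !gradient_formula// !mean_log_grad_support//.
have mr (K : sym_convex_body R n.+1) : vol K = 1%E -> exists r, mean_log_rho K = r%:E.
  move=> vK; exists (fine (mean_log_rho K)); rewrite fineK//.
  by apply: integrable_fin_num => //; exact: integrable_log_rho.
have [r1 ->] := mr _ v1; have [r2 ->] := mr _ v2; rewrite -!(EFinM, EFinD).
have b0 : 0 < ball_volume R n.+1 := ball_volume_gt0 R n.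
rewrite -leeBrDl// -EFinB; congr (_ <= _)%E; congr EFin.
rewrite ln_div ?posrE ?exprn_gt0// lnXn// mulr2n.
by field.
Qed.

Lemma unit_volume_scaling (K : sym_convex_body R n.+1) : exists a (a0 : 0 < a),
  vol (scale_body K a0) = 1%E /\ N * ln a = - ln (fine (vol K)).
Proof.
have f0 : 0 < fine (vol K) by rewrite fine_gt0// vol_body_gt0 vol_body_lty.
have fi0 : 0 < (fine (vol K))^-1 by rewrite invr_gt0.
have [a a0 aE] := exists_root fi0 (ltn0Sn n); exists a, a0; split.
  have vE : vol K = (fine (vol K))%:E by rewrite fineK// gt0_fin_numE; [exact: vol_body_lty|exact: vol_body_gt0].
  by rewrite vol_scale_body aE [in X in (_ * X)%E]vE -EFinM mulVf// gt_eqF.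
by rewrite mulrC mulr_natr -lnXn// aE lnV.
Qed.

Lemma admissible_volume_product (c : R) (K : sym_convex_body R n.+1) : 0 < c ->
  (forall C1 C2 : sym_convex_body R n.+1, vol C1 = 1%E -> vol C2 = 1%E ->
    (N%:E * transport_cost (cone_measure C1) (cone_measure C2)
     <= (- (N * (mean_log_support C1 + mean_log_support C2)) - ln c)%:E)%E) ->
  c <= fine (vol K) * fine (vol (polar K)).
Proof.
move=> c0 H.
have [a [a0 [va la]]] := unit_volume_scaling K.
have [b [b0 [vb lb]]] := unit_volume_scaling (polar_body K).
set C1 := scale_body K a0 in va; set C2 := scale_body (polar_body K) b0 in vb.
have := H C1 C2 va vb; have [M1 B1] := ln_support_bounded C1; have [M2 B2] := ln_support_bounded C2.
have mls L : measurable_fun setT (fun u : V => ln (support_fun (body_set L) u)).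
  by apply: measurableT_comp => //; exact: measurable_support_fun.
(* The potentials are minus the logarithms of the two support functions; the additive constant
   [ln a + ln b] comes from the dilations to unit volume. *)
have wd : ((ln a + ln b - mean_log_support C1 - mean_log_support C2)%:E <=
    transport_cost (cone_measure C1) (cone_measure C2))%E.
  apply: (@weak_duality R n _ _ (fun u => ln (support_fun C1 u)) (fun u => ln (support_fun C2 u))
    _ (Num.max M1 M2)) => //.
  - exact: cone_measure_sphereC.
  - exact: cone_measure_sphereC.
  - by move=> u u1; rewrite le_max B1.
  - by move=> u u1; rewrite le_max B2// orbT.
  move=> u v u1 v1; rewrite /alpha; case: ifP => // d0; last by rewrite leey.
  have h1 := support_fun_gt0 K u1; have h2 := support_fun_gt0 (polar_body K) v1.
  rewrite lee_fin /C1 /C2 !support_scale_body div1r lnV ?posrE// !lnM ?posrE//.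
  have : ln (dot u v) <= ln (support_fun K u * support_fun (polar_body K) v).
    by rewrite ler_ln ?posrE ?mulr_gt0// polar_bodyE; exact: dot_support_le.
  rewrite lnM ?posrE//; lra.
have N0 : (0 <= N%:E)%E by rewrite lee_fin.
move=> /(le_trans (lee_wpmul2l N0 wd)); rewrite -EFinM lee_fin.
set L1 := mean_log_support C1; set L2 := mean_log_support C2 => h.
have f1 : 0 < fine (vol K) by rewrite fine_gt0// vol_body_gt0 vol_body_lty.
have f2 : 0 < fine (vol (polar_body K)) by rewrite fine_gt0// vol_body_gt0 vol_body_lty.
rewrite -polar_bodyE -ler_ln ?posrE ?mulr_gt0// lnM ?posrE//.
(* The mean logarithms of the support functions occur with the same factor on both sides and drop
   out; what remains is the logarithm of the volume product. *)
have : N * ln a + N * ln b <= - ln c.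
  by move: h; move: (ln c) (ln a) (ln b) => x y z; lra.
rewrite la lb; lra.
Qed.
End assembly.

Theorem theorem5p15 (R : realType) (n : nat) :
  log_minkowski R n.+1 ->
  let cS : R := min_volume_product R n.+1 in
  let admissible : set R := [set c : R | 0 < c /\
    forall C1 C2 : sym_convex_body R n.+1,
      vol C1 = 1%E -> vol C2 = 1%E ->
      let V1 := potential C1 in
      let V2 := potential C2 in
      (relative_entropy (radial_measure C1) sphere_measure
       + relative_entropy (radial_measure C2) sphere_measure
       + n.+1%:R%:E
         * transport_cost (cone_measure C1) (cone_measure C2)
       <= (ln (ball_volume R n.+1 ^+ 2 / c))%:E
          + (n.+1%:R / 2)%:E
            * \int[sphere_measure]_(u in unit_sphere)
                (ln (1 + enorm (sphere_grad V1 u) ^+ 2 / n.+1%:R ^+ 2)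
                 * expR (- V1 u))%:E
          + (n.+1%:R / 2)%:E
            * \int[sphere_measure]_(u in unit_sphere)
                (ln (1 + enorm (sphere_grad V2 u) ^+ 2 / n.+1%:R ^+ 2)
                 * expR (- V2 u))%:E)%E] in
  admissible cS /\ ubound admissible cS.
Proof.
move=> logM cS admissible; have cS0 : 0 < cS := min_volume_product_gt0 R n.+1.
split.
  split; first exact: cS0.
  move=> C1 C2 v1 v2; cbv zeta; rewrite (inequality_transport v1 v2 cS0).
  have N0 : (0 <= (n.+1%:R : R)%:E)%E by rewrite lee_fin.
  apply: le_trans (lee_wpmul2l N0 (transport_cost_le logM v1 v2)) _.
  rewrite -EFinM lee_fin /transport_bound -/cS mulrDr mulrN mulrN.
  by rewrite [_ * (ln cS / _)]mulrC divfK.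
move=> c [c0 H]; apply: min_volume_product_ge => K.
apply: admissible_volume_product => // C1 C2 v1 v2.
by rewrite -(inequality_transport v1 v2 c0); exact: H.
Qed.
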